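(* Let $0\le\alpha<1$. (a) The function $u_\nu$ is starlike of order $\alpha$ in $\mathbb{D}$ if and only if $\nu\ge\nu_\alpha^\star(u_\nu)$, where $\nu_\alpha^\star(u_\nu)$ is the unique root of the equation (in $\nu$) $$J_\nu(1)I_{\nu+1}(1)-J_{\nu+1}(1)I_\nu(1)+2\nu(1-\alpha)J_\nu(1)I_\nu(1)=0.$$ In particular, $u_\nu$ is starlike in $\mathbb{D}$ if and only if $\nu\ge\nu_0^\star(u_\nu)\simeq0.05\ldots$, where $\nu_0^\star(u_\nu)$ is the unique root of this equation when $\alpha=0$. (b) The function $v_\nu$ is starlike of order $\alpha$ in $\mathbb{D}$ if and only if $\nu\ge\nu_\alpha^\star(v_\nu)$, where $\nu_\alpha^\star(v_\nu)$ is the unique root of the equation (in $\nu$) $$J_\nu(1)I_{\nu+1}(1)-J_{\nu+1}(1)I_\nu(1)+(1-\alpha)J_\nu(1)I_\nu(1)=0.$$ In particular, $v_\nu$ is starlike in $\mathbb{D}$ if and only if $\nu\ge\nu_0^\star(v_\nu)\simeq-0.53\ldots$, where $\nu_0^\star(v_\nu)$ is the unique root of this equation when $\alpha=0$. (c) The function $w_\nu$ is starlike of order $\alpha$ in $\mathbb{D}$ if and only if $\nu\ge\nu_\alpha^\star(w_\nu)$, where $\nu_\alpha^\star(w_\nu)$ is the unique root of the equation (in $\nu$) $$J_\nu(1)I_{\nu+1}(1)-J_{\nu+1}(1)I_\nu(1)+4(1-\alpha)J_\nu(1)I_\nu(1)=0.$$ In particular, $w_\nu$ is starlike in $\mathbb{D}$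 if and only if $\nu\ge\nu_0^\star(w_\nu)\simeq-0.69\ldots$, where $\nu_0^\star(w_\nu)$ is the unique root of this equation when $\alpha=0$.
   Context: $J_\nu,I_\nu$ are the Bessel and modified Bessel functions of the first kind, and $$\mathbf{\Pi}_\nu(z)=J_\nu(z)I_\nu(z)=\sum_{n\ge0}\frac{(-1)^n(z/2)^{2\nu+4n}}{n!\,\Gamma(\nu+n+1)\Gamma(\nu+2n+1)}.$$ For $\nu>-1$ the normalized functions are defined by $$u_\nu(z)=\left(2^{2\nu}\Gamma^2(\nu+1)\mathbf{\Pi}_\nu(z)\right)^{\frac{1}{2\nu}}\ (\nu\ne0),\quad v_\nu(z)=2^{2\nu}z^{-2\nu+1}\Gamma^2(\nu+1)\mathbf{\Pi}_\nu(z),$$ $$w_\nu(z)=2^{2\nu}z^{-\frac{\nu}{2}+1}\Gamma^2(\nu+1)\mathbf{\Pi}_\nu(\sqrt[4]{z}),$$ each normalized so as to be analytic near $0$ with value $0$ and derivative $1$ at $0$. $\mathbb{D}$ is the open unit disk. A function $f$ analytic in $\mathbb{D}$ with $f(0)=f'(0)-1=0$ is starlike of order $\alpha$ in $\mathbb{D}$ if it is univalent and $\operatorname{Re}(zf'(z)/f(z))>\alpha$ for all $z\in\mathbb{D}$; starlike means starlike of order $0$.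
   Formalization: In (a), that starlikeness of u_ν implies ν ≥ ν* is stated only for ν > 0 (both for order α and for α = 0), since it fails for some negative ν: u_{-1/2}(z) = z/(cos z cosh z) is starlike although -1/2 < 0.05. *)

(* Defs.v *)
From Stdlib Require Import Reals Factorial.
From Coquelicot Require Import Coquelicot.
Open Scope R_scope.

(* Euler's integral; meaningful for x > 0, the only arguments occurring below. *)
Definition Gamma (x : R) : R :=
  RInt_gen (fun t => Rpower t (x - 1) * exp (- t))
    (at_right 0) (Rbar_locally p_infty).

(* Coquelicot's [Series] is real-valued, so complex series are summed
   componentwise. *)
Definition CSeries (a : nat -> C) : C :=
  (Series (fun n => Re (a n)), Series (fun n => Im (a n))).

(* Principal argument, in ]-PI, PI]; the value at 0 is irrelevant. *)
Definition Carg (z : C) : R :=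
  if Rle_dec 0 (Im z) then acos (Re z / Cmod z) else - acos (Re z / Cmod z).

(* Principal value of z ^ a for real a, with 0 ^ 0 = 1 and 0 ^ a = 0 for a <> 0
   (for a < 0 the latter is a mere convention: [Rpower 0 a] would be 1). *)
Definition Cpower (z : C) (a : R) : C :=
  if Req_EM_T (Cmod z) 0 then (if Req_EM_T a 0 then RtoC 1 else RtoC 0)
  else (Rpower (Cmod z) a * cos (a * Carg z),
        Rpower (Cmod z) a * sin (a * Carg z)).

Definition BesselJ (nu : R) (z : C) : C :=
  (Cpower (z / 2) nu *
   CSeries (fun n => RtoC ((-1) ^ n / (INR (fact n) * Gamma (nu + INR n + 1)))
                     * (z / 2) ^ (2 * n)))%C.

Definition BesselI (nu : R) (z : C) : C :=
  (Cpower (z / 2) nu *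
   CSeries (fun n => RtoC (1 / (INR (fact n) * Gamma (nu + INR n + 1)))
                     * (z / 2) ^ (2 * n)))%C.

Definition PiJI (nu : R) (z : C) : C := (BesselJ nu z * BesselI nu z)%C.

(* With every power principal, (2^(2 nu) Gamma(nu+1)^2 Pi_nu(z))^(1/(2 nu)) is
   not analytic near 0 for 2 nu > 1, where z^(2 nu) crosses the cut.  The branch
   that is analytic near 0 with derivative 1 there is obtained by taking the
   factor z out of the power; what remains inside tends to 1 as z -> 0.
   For some nu in ]-1, 0[ (e.g. nu = -0.65, for small alpha) u_nu is starlike of
   order alpha although nu is below the positive root of the equation for u; so
   necessity of nu >= nu_star holds for nu > 0 only. *)
Definition u_fun (nu : R) (z : C) : C :=
  (z * Cpower (RtoC (Rpower 2 (2 * nu)) * Cpower z (- 2 * nu)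
               * RtoC (Gamma (nu + 1) ^ 2) * PiJI nu z) (1 / (2 * nu)))%C.

(* In v and w the principal powers of z cancel exactly; at z = 0 both formulas
   give the removable value 0. *)
Definition v_fun (nu : R) (z : C) : C :=
  (RtoC (Rpower 2 (2 * nu)) * Cpower z (- 2 * nu + 1)
   * RtoC (Gamma (nu + 1) ^ 2) * PiJI nu z)%C.

Definition w_fun (nu : R) (z : C) : C :=
  (RtoC (Rpower 2 (2 * nu)) * Cpower z (- nu / 2 + 1)
   * RtoC (Gamma (nu + 1) ^ 2) * PiJI nu (Cpower z (1 / 4)))%C.

Definition unit_disk (z : C) : Prop := Cmod z < 1.

Definition analytic_in_disk (f : C -> C) : Prop :=
  forall z : C, unit_disk z -> ex_derive f z.

Definition univalent_in_disk (f : C -> C) : Prop :=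
  forall z1 z2 : C, unit_disk z1 -> unit_disk z2 -> f z1 = f z2 -> z1 = z2.

(* z f'(z) / f(z) has a removable singularity at 0 with value 1 > alpha, while in
   Coquelicot 0 / 0 = 0; hence the exclusion of z = 0. *)
Definition starlike_of_order (alpha : R) (f : C -> C) : Prop :=
  analytic_in_disk f /\ f (RtoC 0) = RtoC 0 /\ C_derive f (RtoC 0) = RtoC 1 /\
  univalent_in_disk f /\
  (forall z : C, unit_disk z -> z <> RtoC 0 ->
     alpha < Re (z * C_derive f z / f z)%C).

Definition starlike (f : C -> C) : Prop := starlike_of_order 0 f.

Definition equation_lhs (c nu : R) : C :=
  (BesselJ nu 1 * BesselI (nu + 1) 1 - BesselJ (nu + 1) 1 * BesselI nu 1
   + RtoC c * BesselJ nu 1 * BesselI nu 1)%C.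

Definition is_unique_root (c : R -> R) (nu0 : R) : Prop :=
  unique (fun nu => -1 < nu /\ equation_lhs (c nu) nu = RtoC 0) nu0.

(* Main.v *)
Require Import Defs.
From Stdlib Require Import Reals.
From Coquelicot Require Import Coquelicot.
From Stdlib Require Import Factorial Ranalysis5 Wf_nat Lra Lia Psatz.
Open Scope R_scope.

(** Multiplying the two Bessel series gives
      2^(2 nu) z^(-2 nu) Gamma(nu+1)^2 J_nu(z) I_nu(z) = phi(z^4),
    where phi(w) = sum (-1)^n c_n w^n and c_n = 1 / (16^n n! (nu+1)_n (nu+1)_(2n))
    ([JI_product_even], [PiJI_series]).  Since all powers in the definitions are
    principal they cancel, and the three functions become z phi(z^4)^(1/(2 nu)),
    z phi(z^4) and z phi(z).

    The logarithmic derivative of phi has coefficients of one sign: it is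
    - sum s_n w^n, where s_n is the sum of the j^(-4n-4) over the positive zeros j
    of J_nu.  No zeros are needed for this: the power sums are defined by the
    recurrence of Kishore, which is the Riccati equation for A'/A when A is the
    Bessel series, and which visibly preserves nonnegativity ([even_Rayleigh]).
    Hence each of the three functions is f(z) = z exp(-k G(z^m)) with
    G' = sum s_n w^n, and z f'/f = 1 - k m sum s_n z^(m(n+1)) has its least real
    part at z = 1.  So Re (z f'/f) > alpha in the disk amounts to
    k m (sum s_n) <= 1 - alpha, and since sum s_n = - phi'(1) / phi(1), to
    c phi(1) + 4 phi'(1) >= 0 with c = 2 nu (1 - alpha), 1 - alpha, 4 (1 - alpha)
    respectively.  By the formulas for the derivatives of J_nu and I_nu the
    left-hand side is, up to a positive factor, that of the equation in the
    theorem ([equation_lhs_char_fun]).  Univalence needs no general theorem on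
    starlike functions: in the coordinate log z, the function log f(z) is a
    contractive perturbation of the identity ([exp_form_starlike]).

    It remains to study c phi(1) + 4 phi'(1) as a function of nu > -1.  The
    coefficients c_n drop so fast with n, and so do their decreases between two
    orders, that phi(1) and phi'(1) are continuous and strictly increasing in nu
    ([Phi_increasing]).  For v and w, where c > 0 does not depend on nu, this gives
    existence and uniqueness of the root, and two terms of the series locate it.
    For u one first excludes nu <= 0 and then divides by nu.  All roots exceed
    -7/10, and there c_1 + c_2 + ... is well below 1, which is why the series
    sum s_n converges geometrically ([even_Rayleigh_rapid]).  For smaller nu
    the function phi may vanish in the disk, and for v and w the necessity of the
    condition is therefore derived directly from phi on the real axis
    ([starlike_product_bound]). *)

(** * Complex differentiability *)

(** Rules of differentiation apply to the target space that [C] carries as an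
    absolute ring, whereas [C_derive] refers to its structure of normed module
    inherited from the product [R * R]; both have the same norm. *)
Definition Cderiv (f : C -> C) (z l : C) : Prop :=
  @is_derive C_AbsRing (AbsRing_NormedModule C_AbsRing) f z l.

Lemma Cderiv_is_derive f z l : Cderiv f z l ->
  @is_derive C_AbsRing C_NormedModule f z l.
Proof. intros [[H1 H2 H3] H']; split; [split|]; auto. Qed.

(** The derivatives computed from scratch below (power series, exponential) all
    come from an explicit second-order remainder. *)
Lemma Cderiv_quadratic (f : C -> C) (z l : C) (M d : R) : 0 < d ->
  (forall h : C, Cmod h < d ->
     Cmod (f (z + h) - f z - l * h)%C <= M * Cmod h ^ 2) ->
  Cderiv f z l.
Proof.
intros Hd H. split. { apply is_linear_scal_l. }
intros x Hx.
assert (Hx' : z = x).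
{ apply (@is_filter_lim_locally_unique C_AbsRing
          (AbsRing_NormedModule C_AbsRing)). exact Hx. }
subst x. clear Hx.
intros eps.
assert (Hm : 0 < Rmin d (eps / (Rabs M + 1))).
{ apply Rmin_pos; trivial. apply Rdiv_lt_0_compat. apply eps.
  generalize (Rabs_pos M); lra. }
enough (K : forall y : C, Cmod (y - z)%C < Rmin d (eps / (Rabs M + 1)) ->
  Cmod (f y - f z - (y - z) * l)%C <= eps * Cmod (y - z)%C).
{ exists (mkposreal _ Hm). intros y Hy. exact (K y Hy). }
intros y Hy.
assert (Hlt : Cmod (y - z)%C < d) by (eapply Rlt_le_trans; [apply Hy|apply Rmin_l]).
assert (Hlt2 : Cmod (y - z)%C < eps / (Rabs M + 1))
  by (eapply Rlt_le_trans; [apply Hy|apply Rmin_r]).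
replace (f y - f z - (y - z) * l)%C
  with (f (z + (y - z)) - f z - l * (y - z))%C
  by (replace (z + (y - z))%C with y by ring; ring).
eapply Rle_trans. apply H; trivial.
set (t := Cmod (y - z)%C) in *.
assert (Ht : 0 <= t) by apply Cmod_ge_0.
assert (HM := Rle_abs M). assert (HM0 := Rabs_pos M).
apply Rlt_div_r in Hlt2; [|lra].
simpl. rewrite Rmult_1_r, <- Rmult_assoc.
apply Rmult_le_compat_r; trivial. nra.
Qed.

Lemma Cderiv_ext f g z l : (forall x, f x = g x) -> Cderiv f z l -> Cderiv g z l.
Proof. intros H. apply is_derive_ext. exact H. Qed.

Lemma Cderiv_ext_ball f g z l d : 0 < d ->
  (forall x : C, Cmod (x - z)%C < d -> f x = g x) -> Cderiv f z l -> Cderiv g z l.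
Proof.
intros Hd H. apply is_derive_ext_loc. exists (mkposreal d Hd). intros y Hy.
apply H. exact Hy.
Qed.

Lemma Cderiv_id z : Cderiv (fun x => x) z 1.
Proof. apply (@is_derive_id C_AbsRing). Qed.

Lemma Cderiv_const (c z : C) : Cderiv (fun _ => c) z 0.
Proof. apply (@is_derive_const C_AbsRing (AbsRing_NormedModule C_AbsRing)). Qed.

Lemma Cderiv_mult f g z df dg : Cderiv f z df -> Cderiv g z dg ->
  Cderiv (fun x => f x * g x)%C z (df * g z + f z * dg)%C.
Proof.
intros Hf Hg. apply (@is_derive_mult C_AbsRing f g z df dg Hf Hg).
intros; apply Cmult_comm.
Qed.

Lemma Cderiv_comp f g z df dg : Cderiv f (g z) df -> Cderiv g z dg ->
  Cderiv (fun x => f (g x)) z (dg * df)%C.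
Proof.
intros Hf Hg.
exact (@is_derive_comp C_AbsRing (AbsRing_NormedModule C_AbsRing) f g z df dg Hf Hg).
Qed.

Lemma Cderiv_scal (c : C) f z df : Cderiv f z df ->
  Cderiv (fun x => c * f x)%C z (c * df)%C.
Proof.
intros Hf. evar_last.
apply (Cderiv_mult (fun _ => c) f); [apply Cderiv_const|exact Hf].
ring.
Qed.

Lemma Cderiv_pow m z : Cderiv (fun x => x ^ S m)%C z (RtoC (INR (S m)) * z ^ m)%C.
Proof.
induction m as [|m IH].
- apply (Cderiv_ext (fun x => x)). intros; now rewrite Cpow_1_r.
  evar_last. apply Cderiv_id. simpl. ring.
- apply (Cderiv_ext (fun x => x * x ^ S m)%C). intros; now rewrite (Cpow_S _ (S m)).
  evar_last. apply Cderiv_mult. apply Cderiv_id. apply IH.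
  rewrite (S_INR (S m)), RtoC_plus, !Cpow_S. ring.
Qed.

(** Along a ray the real part of a complex differentiable function is an
    ordinary differentiable function of one real variable. *)
Lemma Cderiv_ray f z (t : R) l : Cderiv f (RtoC t * z)%C l ->
  is_derive (fun s : R => Re (f (RtoC s * z)%C)) t (Re (l * z)%C).
Proof.
intros [_ H]. apply is_derive_Reals.
intros eps Heps.
set (N := Cmod z + 1). assert (HN : 0 < N) by (unfold N; generalize (Cmod_ge_0 z); lra).
assert (He : 0 < eps / N / 2) by (apply Rdiv_lt_0_compat; [apply Rdiv_lt_0_compat|]; lra).
destruct (H (RtoC t * z)%C (fun P HP => HP) (mkposreal _ He)) as [d Hd].
assert (Hd' : 0 < d / N) by (apply Rdiv_lt_0_compat; [apply d|lra]).
exists (mkposreal _ Hd'). intros h Hh0 Hh. simpl in Hh.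
assert (HzN : Cmod z < N) by (unfold N; lra). assert (Hz0 := Cmod_ge_0 z).
assert (Hah : 0 < Rabs h) by now apply Rabs_pos_lt.
assert (Hhz : Cmod (RtoC (t + h) * z - RtoC t * z)%C = Rabs h * Cmod z).
{ replace (RtoC (t + h) * z - RtoC t * z)%C with (RtoC h * z)%C
    by (rewrite RtoC_plus; ring).
  now rewrite Cmod_mult, Cmod_R. }
assert (B : Cmod (f (RtoC (t + h) * z) - f (RtoC t * z)
    - (RtoC (t + h) * z - RtoC t * z) * l)%C
    <= eps / N / 2 * Cmod (RtoC (t + h) * z - RtoC t * z)%C).
{ apply Hd. change (Cmod (RtoC (t + h) * z - RtoC t * z)%C < d).
  rewrite Hhz. apply Rlt_div_r in Hh; [|lra]. nra. }
rewrite Hhz in B.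
set (D := (f (RtoC (t + h) * z) - f (RtoC t * z)
    - (RtoC (t + h) * z - RtoC t * z) * l)%C) in *.
replace ((Re (f (RtoC (t + h) * z)%C) - Re (f (RtoC t * z)%C)) / h - Re (l * z)%C)
  with (Re D / h).
2:{ unfold D. destruct (f (RtoC (t + h) * z)%C), (f (RtoC t * z)%C), z, l.
    simpl. unfold Re, Im. simpl. field. exact Hh0. }
unfold Rdiv. rewrite Rabs_mult, Rabs_inv.
apply Rlt_div_l; trivial.
assert (HRe : Rabs (Re D) <= Cmod D).
{ eapply Rle_trans; [|apply Rmax_Cmod]. apply Rmax_l. }
apply Rle_lt_trans with (eps / N / 2 * (Rabs h * Cmod z)); [lra|].
replace (eps / N / 2 * (Rabs h * Cmod z)) with ((eps * Rabs h) * (Cmod z / N / 2))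
  by (field; lra).
rewrite <- (Rmult_1_r (eps * Rabs h)) at 2.
apply Rmult_lt_compat_l. nra.
apply Rlt_div_l; [lra|]. apply Rlt_div_l; [lra|]. nra.
Qed.

(** A function with zero derivative in a disk is constant there: integrate
    along rays, separately for the real part and (after multiplication by -i)
    the imaginary part. *)
Lemma Cderiv_zero_disk f r : 0 < r -> (forall z, Cmod z < r -> Cderiv f z 0) ->
  forall z, Cmod z < r -> f z = f 0.
Proof.
intros Hr H.
assert (ReC : forall g, (forall z, Cmod z < r -> Cderiv g z 0) ->
   forall z, Cmod z < r -> Re (g z) = Re (g 0)).
{ intros g Hg z Hz.
  assert (D : forall t : R, 0 <= t <= 1 ->
    is_derive (fun s : R => Re (g (RtoC s * z)%C)) t 0).
  { intros t Ht. evar_last. apply Cderiv_ray. apply Hg.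
    rewrite Cmod_mult, Cmod_R, Rabs_pos_eq by lra.
    generalize (Cmod_ge_0 z). nra.
    destruct z; simpl; unfold Re; simpl; ring. }
  destruct (MVT_gen (fun s : R => Re (g (RtoC s * z)%C)) 0 1 (fun _ => 0)) as [c [_ Hc]].
  - rewrite Rmin_left, Rmax_right by lra. intros t Ht. apply D; lra.
  - rewrite Rmin_left, Rmax_right by lra. intros t Ht.
    apply continuity_pt_filterlim.
    apply (@ex_derive_continuous R_AbsRing R_NormedModule).
    exists 0. apply D; lra.
  - replace z with (RtoC 1 * z)%C at 1 by ring.
    replace (RtoC 0) with (RtoC 0 * z)%C by ring. lra. }
intros z Hz.
assert (E1 := ReC f H z Hz).
assert (E2 : Re (- Ci * f z)%C = Re (- Ci * f 0)%C).
{ apply (ReC (fun z => - Ci * f z)%C); trivial.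
  intros y Hy. replace (RtoC 0) with (- Ci * 0)%C by ring. apply Cderiv_scal. now apply H. }
destruct (f z) as [a b], (f (RtoC 0)) as [c d].
unfold Re in *; simpl in *. f_equal; lra.
Qed.

(** * The complex exponential *)

Definition Cexp (z : C) : C := (exp (Re z) * cos (Im z), exp (Re z) * sin (Im z)).

Lemma Cexp_plus a b : Cexp (a + b) = (Cexp a * Cexp b)%C.
Proof.
destruct a as [a1 a2], b as [b1 b2]. unfold Cexp, Re, Im. simpl.
rewrite exp_plus, cos_plus, sin_plus. unfold Cmult; simpl. f_equal; ring.
Qed.

Lemma Cexp_0 : Cexp 0 = 1.
Proof. unfold Cexp, Re, Im; simpl. rewrite exp_0, cos_0, sin_0. unfold RtoC; f_equal; ring. Qed.

Lemma Cexp_R (x : R) : Cexp x = exp x.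
Proof. unfold Cexp, Re, Im; simpl. rewrite cos_0, sin_0. unfold RtoC. f_equal; ring. Qed.

Lemma Cmod_Cexp z : Cmod (Cexp z) = exp (Re z).
Proof.
unfold Cmod, Cexp; simpl.
replace (_ + _) with ((exp (Re z))²).
- apply sqrt_Rsqr. left; apply exp_pos.
- unfold Rsqr. generalize (sin2_cos2 (Im z)). unfold Rsqr. intros.
  transitivity (exp (Re z) * exp (Re z) * (sin (Im z) * sin (Im z) + cos (Im z) * cos (Im z))).
  rewrite H; ring. ring.
Qed.

Lemma Cexp_neq_0 z : Cexp z <> 0.
Proof. apply Cmod_gt_0. rewrite Cmod_Cexp. apply exp_pos. Qed.

Lemma Cexp_opp z : Cexp (- z) = (/ Cexp z)%C.
Proof.
assert (H : (Cexp (- z) * Cexp z)%C = 1).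
{ rewrite <- Cexp_plus. replace (- z + z)%C with (RtoC 0) by ring. apply Cexp_0. }
transitivity (/ Cexp z * (Cexp (- z) * Cexp z))%C; [|rewrite H; ring].
field. apply Cexp_neq_0.
Qed.

Lemma Cexp_pow z n : (Cexp z ^ n)%C = Cexp (RtoC (INR n) * z).
Proof.
induction n as [|n IH].
- simpl. replace (0 * z)%C with (RtoC 0) by ring. now rewrite Cexp_0.
- rewrite Cpow_S, IH, <- Cexp_plus, S_INR, RtoC_plus. f_equal. ring.
Qed.

Lemma one_minus_cos_bounds b : 0 <= 1 - cos b <= b ^ 2 / 2.
Proof.
split. { generalize (COS_bound b); lra. }
replace b with (2 * (b / 2)) at 1 by field. rewrite cos_2a_sin.
assert (H : Rabs (sin (b / 2)) <= Rabs (b / 2)).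
{ destruct (MVT_gen sin 0 (b / 2) cos) as [c [_ Hc]].
  - intros x _. apply is_derive_sin.
  - intros x _. apply continuity_sin.
  - rewrite sin_0, !Rminus_0_r in Hc. rewrite Hc, Rabs_mult.
    assert (Rabs (cos c) <= 1) by (apply Rabs_le; generalize (COS_bound c); lra).
    generalize (Rabs_pos (b / 2)). nra. }
apply Rsqr_le_abs_1 in H. unfold Rsqr in H. nra.
Qed.

Lemma exp_minus_1_bound a : Rabs (exp a - 1) <= Rabs a * Rmax 1 (exp a).
Proof.
destruct (MVT_gen exp 0 a exp) as [c [Hc E]].
- intros x _. apply is_derive_exp.
- intros x _. apply continuity_pt_filterlim, continuous_exp.
- rewrite exp_0, Rminus_0_r in E. rewrite E, Rabs_mult, Rmult_comm.
  apply Rmult_le_compat_l. apply Rabs_pos.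
  rewrite Rabs_pos_eq by (left; apply exp_pos).
  destruct (Rle_dec a 0).
  + rewrite Rmin_right, Rmax_left in Hc by lra.
    eapply Rle_trans; [|apply Rmax_l]. rewrite <- exp_0. 
    destruct (Rle_lt_or_eq_dec c 0) as [Hl|He]; [lra| |].
    left; now apply exp_increasing. subst; lra.
  + rewrite Rmin_left, Rmax_right in Hc by lra.
    eapply Rle_trans; [|apply Rmax_r].
    destruct (Rle_lt_or_eq_dec c a) as [Hl|He]; [lra| |].
    left; now apply exp_increasing. subst; lra.
Qed.

(** Because |e^h - 1|^2 = (e^a - 1)^2 + 2 e^a (1 - cos b) for h = a + ib. *)
Lemma Cexp_minus_1_bound h : Cmod (Cexp h - 1)%C <= Cmod h * Rmax 1 (exp (Re h)).
Proof.
set (m := Rmax 1 (exp (Re h))).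
assert (Hm1 : 1 <= m) by apply Rmax_l.
assert (Hm2 : exp (Re h) <= m) by apply Rmax_r.
assert (H0 := exp_pos (Re h)).
apply Rsqr_incr_0_var; [|apply Rmult_le_pos; [apply Cmod_ge_0|lra]].
rewrite Rsqr_mult. unfold Cmod. rewrite !Rsqr_sqrt by nra.
destruct h as [a b]. unfold Cexp, Re, Im in *; simpl in *.
assert (H1 := exp_minus_1_bound a). fold m in H1.
assert (H2 : (exp a - 1) ^ 2 <= a ^ 2 * m ^ 2).
{ rewrite <- (pow2_abs (exp a - 1)), <- (pow2_abs a).
  assert (0 <= Rabs (exp a - 1)) by apply Rabs_pos.
  replace (Rabs a ^ 2 * m ^ 2) with ((Rabs a * m) ^ 2) by ring.
  apply pow_incr. now split. }
assert (H3 := one_minus_cos_bounds b).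
assert (H4 := sin2_cos2 b). unfold Rsqr in H4.
assert (E : (exp a * cos b + - (1)) * ((exp a * cos b + - (1)) * 1)
   + (exp a * sin b + - 0) * ((exp a * sin b + - 0) * 1)
   = (exp a - 1) ^ 2 + 2 * exp a * (1 - cos b)).
{ transitivity (exp a ^ 2 * (sin b * sin b + cos b * cos b) - 2 * exp a * cos b + 1).
  ring. rewrite H4. ring. }
rewrite E. unfold Rsqr.
assert (2 * exp a * (1 - cos b) <= b ^ 2 * (m * m)).
{ apply Rle_trans with (m * b ^ 2). nra. assert (0 <= b ^ 2) by nra. nra. }
nra.
Qed.

(** Factor out Cexp y; the two values of the maximum in [Cexp_minus_1_bound]
    then become exp (Re y) and exp (Re x). *)
Lemma Cexp_lipschitz x y M : Re x <= M -> Re y <= M ->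
  Cmod (Cexp x - Cexp y)%C <= exp M * Cmod (x - y)%C.
Proof.
intros Hx Hy.
replace (Cexp x - Cexp y)%C with (Cexp y * (Cexp (x - y) - 1))%C.
2:{ rewrite Cmult_comm. replace ((Cexp (x - y) - 1) * Cexp y)%C
      with (Cexp (x - y) * Cexp y - Cexp y)%C by ring.
    rewrite <- Cexp_plus. f_equal. f_equal. ring. }
rewrite Cmod_mult, Cmod_Cexp.
assert (exp (Re x) <= exp M) by (destruct Hx; [left; now apply exp_increasing|subst; lra]).
assert (exp (Re y) <= exp M) by (destruct Hy; [left; now apply exp_increasing|subst; lra]).
assert (H1 := Cexp_minus_1_bound (x - y)).
assert (H2 : exp (Re y) * Rmax 1 (exp (Re (x - y)%C)) <= exp M).
{ assert (E : exp (Re y) * exp (Re (x - y)%C) = exp (Re x)).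
  { rewrite <- exp_plus. f_equal. destruct x, y; unfold Re; simpl; ring. }
  unfold Rmax. destruct Rle_dec; lra. }
assert (H4 := Cmod_ge_0 (x - y)%C). assert (H3 := exp_pos (Re y)).
apply Rle_trans with (exp (Re y) * (Cmod (x - y)%C * Rmax 1 (exp (Re (x - y)%C)))).
apply Rmult_le_compat_l; lra. nra.
Qed.

(** Second-order remainder of the exponential, the real and imaginary parts
    being estimated separately. *)
Lemma Cexp_remainder h : Cmod h <= 1 -> Cmod (Cexp h - 1 - h)%C <= 8 * Cmod h ^ 2.
Proof.
intros Hh.
assert (Hr := Rmax_Cmod h).
assert (Ha : Rabs (Re h) <= Cmod h) by (eapply Rle_trans; [apply Rmax_l|apply Hr]).
assert (Hb : Rabs (Im h) <= Cmod h) by (eapply Rle_trans; [apply Rmax_r|apply Hr]).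
clear Hr. assert (Ht0 := Cmod_ge_0 h).
set (t := Cmod h) in *.
assert (Hm : Rmax 1 (exp (Re h)) <= 3).
{ apply Rmax_lub; [lra|]. eapply Rle_trans; [|apply exp_le_3].
  assert (Re h <= 1) by (generalize (Rle_abs (Re h)); lra).
  destruct H; [left; now apply exp_increasing|rewrite H; lra]. }
assert (He : exp (Re h) <= 3) by (eapply Rle_trans; [apply Rmax_r|apply Hm]).
assert (He0 := exp_pos (Re h)).
assert (He1 : Rabs (exp (Re h) - 1) <= 3 * t).
{ eapply Rle_trans. apply exp_minus_1_bound. generalize (Rabs_pos (Re h)). nra. }
assert (He2 : 0 <= exp (Re h) - 1 - Re h <= 3 * t ^ 2).
{ split. { generalize (exp_ineq1_le (Re h)). lra. }
  (* convexity: exp a - 1 <= a exp a *)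
  assert (exp (Re h) - 1 <= Re h * exp (Re h)).
  { generalize (exp_ineq1_le (- Re h)). rewrite exp_Ropp. intros G.
    apply Rmult_le_compat_r with (r := exp (Re h)) in G; [|lra].
    rewrite Rinv_l in G by lra. lra. }
  assert (Re h * (exp (Re h) - 1) <= t * (3 * t)).
  { eapply Rle_trans; [apply Rle_abs|]. rewrite Rabs_mult.
    apply Rmult_le_compat; auto using Rabs_pos. }
  lra. }
assert (Hc := one_minus_cos_bounds (Im h)).
assert (Hb2 : (Im h) ^ 2 <= t ^ 2).
{ rewrite <- (pow2_abs (Im h)). apply pow_incr. split; auto using Rabs_pos. }
assert (Hs : Rabs (sin (Im h) - Im h) <= t ^ 2).
{ destruct (MVT_gen (fun x => sin x - x) 0 (Im h) (fun x => cos x - 1)) as [c [Hc' E]].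
  - intros x _. auto_derive; trivial. ring.
  - intros x _. apply continuity_pt_minus. apply continuity_sin. apply continuity_pt_id.
  - rewrite sin_0, !Rminus_0_r in E. rewrite E, Rabs_mult.
    assert (Hc2 := one_minus_cos_bounds c).
    assert (Rabs c <= Rabs (Im h)).
    { destruct (Rle_dec 0 (Im h)).
      rewrite Rmin_left, Rmax_right in Hc' by lra. rewrite !Rabs_pos_eq; lra.
      rewrite Rmin_right, Rmax_left in Hc' by lra. rewrite !Rabs_left1; lra. }
    assert (c ^ 2 <= t).
    { rewrite <- (pow2_abs c). generalize (Rabs_pos c). nra. }
    assert (Rabs (cos c - 1) <= t) by (rewrite Rabs_left1; lra).
    simpl. rewrite Rmult_1_r. apply Rmult_le_compat; auto using Rabs_pos. }
assert (X1 : Rabs (Re (Cexp h - 1 - h)%C) <= 5 * t ^ 2).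
{ replace (Re (Cexp h - 1 - h)%C)
    with ((exp (Re h) - 1 - Re h) - exp (Re h) * (1 - cos (Im h)))
    by (destruct h; unfold Cexp, Re, Im; simpl; ring).
  apply Rabs_le. nra. }
assert (X2 : Rabs (Im (Cexp h - 1 - h)%C) <= 6 * t ^ 2).
{ replace (Im (Cexp h - 1 - h)%C)
    with (exp (Re h) * (sin (Im h) - Im h) + (exp (Re h) - 1) * Im h)
    by (destruct h; unfold Cexp, Re, Im; simpl; ring).
  eapply Rle_trans. apply Rabs_triang. rewrite !Rabs_mult, (Rabs_pos_eq (exp _)) by lra.
  assert (Rabs (exp (Re h) - 1) * Rabs (Im h) <= (3 * t) * t)
    by (apply Rmult_le_compat; auto using Rabs_pos).
  assert (0 <= Rabs (sin (Im h) - Im h)) by apply Rabs_pos.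
  nra. }
set (w := (Cexp h - 1 - h)%C) in *.
apply Rsqr_incr_0_var; [|nra].
unfold Cmod. rewrite Rsqr_sqrt by nra.
change (fst w) with (Re w); change (snd w) with (Im w).
rewrite <- (pow2_abs (Re w)), <- (pow2_abs (Im w)).
assert (Rabs (Re w) ^ 2 <= (5 * t ^ 2) ^ 2) by (apply pow_incr; split; auto using Rabs_pos).
assert (Rabs (Im w) ^ 2 <= (6 * t ^ 2) ^ 2) by (apply pow_incr; split; auto using Rabs_pos).
unfold Rsqr. nra.
Qed.

Lemma Cderiv_Cexp z : Cderiv Cexp z (Cexp z).
Proof.
apply (Cderiv_quadratic _ _ _ (Cmod (Cexp z) * 8) 1); [lra|].
intros h Hh. rewrite Cexp_plus.
replace (Cexp z * Cexp h - Cexp z - Cexp z * h)%C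
  with (Cexp z * (Cexp h - 1 - h))%C by ring.
rewrite Cmod_mult, Rmult_assoc. apply Rmult_le_compat_l. apply Cmod_ge_0.
apply Cexp_remainder. lra.
Qed.

(** * Rapidly decreasing coefficients *)

(** Faster than any power: this class is stable under formal differentiation
    and integration, and series with such coefficients converge on the closed
    unit disk together with all their derivatives, including at 1. *)
Definition rapid (a : nat -> R) : Prop :=
  forall k, ex_series (fun n => INR n ^ k * Rabs (a n)).

Lemma ex_series_Rle (a b : nat -> R) :
  (forall n, Rabs (a n) <= b n) -> ex_series b -> ex_series a.
Proof. intros H. apply (@ex_series_le R_AbsRing R_CompleteNormedModule a b H). Qed.

Lemma ex_series_scal_R (c : R) (a : nat -> R) :
  ex_series a -> ex_series (fun n => c * a n).
Proof. apply (@ex_series_scal R_AbsRing R_NormedModule). Qed.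

Lemma ex_series_plus_R (a b : nat -> R) :
  ex_series a -> ex_series b -> ex_series (fun n => a n + b n).
Proof. apply (@ex_series_plus R_AbsRing R_NormedModule). Qed.

Lemma Series_zero (a : nat -> R) : (forall n, a n = 0) -> Series a = 0.
Proof.
intros H. rewrite (Series_ext a (fun n => 0 * a n)) by (intros; rewrite H; ring).
rewrite Series_scal_l. ring.
Qed.

Lemma Series_nonneg (a : nat -> R) : (forall n, 0 <= a n) -> ex_series a -> 0 <= Series a.
Proof.
intros H Ha. rewrite <- (Series_zero (fun _ => 0)) by trivial.
apply Series_le; trivial. intros n; split; [lra|apply H].
Qed.

Lemma rapid_abs a : rapid a -> ex_series (fun n => Rabs (a n)).
Proof. intros H. eapply ex_series_ext; [|apply (H O)]. intros n. simpl. ring. Qed.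

Lemma rapid_le a b : (forall n, Rabs (a n) <= Rabs (b n)) -> rapid b -> rapid a.
Proof.
intros H Hb k. apply ex_series_Rle with (2 := Hb k). intros n.
rewrite Rabs_mult, Rabs_Rabsolu, Rabs_pos_eq by (apply pow_le, pos_INR).
apply Rmult_le_compat_l. apply pow_le, pos_INR. apply H.
Qed.

Lemma rapid_INR a : rapid a -> rapid (fun n => INR n * a n).
Proof.
intros H k. eapply ex_series_ext; [|apply (H (S k))].
intros n. simpl. rewrite Rabs_mult, (Rabs_pos_eq (INR n)) by apply pos_INR. ring.
Qed.

Lemma rapid_shift a : rapid a -> rapid (fun n => a (S n)).
Proof.
intros H k. apply ex_series_Rle with (fun n => INR (S n) ^ k * Rabs (a (S n))).
- intros n. rewrite Rabs_mult, Rabs_Rabsolu, Rabs_pos_eq by (apply pow_le, pos_INR).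
  apply Rmult_le_compat_r. apply Rabs_pos.
  apply pow_incr. split. apply pos_INR. apply le_INR; lia.
- apply (ex_series_incr_1 (fun n => INR n ^ k * Rabs (a n))). apply H.
Qed.

Lemma rapid_unshift a : rapid (fun n => a (S n)) -> rapid a.
Proof.
intros H k. apply (ex_series_incr_1 (fun n => INR n ^ k * Rabs (a n))).
(* (n+1)^k <= 2^k (n^k + 1) *)
apply ex_series_Rle with
  (fun n => 2 ^ k * (INR n ^ k * Rabs (a (S n)) + INR n ^ 0 * Rabs (a (S n)))).
2:{ apply ex_series_scal_R, ex_series_plus_R; apply H. }
intros n. rewrite Rabs_mult, Rabs_Rabsolu, Rabs_pos_eq by (apply pow_le, pos_INR).
rewrite <- Rmult_plus_distr_r, <- Rmult_assoc.
apply Rmult_le_compat_r. apply Rabs_pos.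
simpl (INR n ^ 0). rewrite S_INR.
assert (Hn := pos_INR n).
destruct (Nat.eq_dec n 0) as [->|Hn0].
- simpl. rewrite Rplus_0_l, pow1. assert (1 <= 2 ^ k) by (apply pow_R1_Rle; lra).
  assert (0 <= 0 ^ k) by (apply pow_le; lra). nra.
- assert (1 <= INR n) by (apply (le_INR 1); lia).
  apply Rle_trans with ((2 * INR n) ^ k). apply pow_incr; lra.
  rewrite Rpow_mult_distr. assert (0 <= INR n ^ k) by (now apply pow_le).
  assert (0 <= 2 ^ k) by (apply pow_le; lra). nra.
Qed.

Lemma rapid_derive a : rapid a -> rapid (PS_derive a).
Proof. intros H. apply (rapid_shift (fun n => INR n * a n)). now apply rapid_INR. Qed.

Lemma rapid_Int a : rapid a -> rapid (PS_Int a).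
Proof.
intros H. apply rapid_unshift, rapid_le with a; trivial.
intros n. unfold PS_Int. unfold Rdiv. rewrite Rabs_mult.
rewrite <- (Rmult_1_r (Rabs (a n))) at 2. apply Rmult_le_compat_l. apply Rabs_pos.
assert (1 <= INR (S n)) by (apply (le_INR 1); lia).
rewrite Rabs_pos_eq. rewrite <- Rinv_1. apply Rinv_le_contravar; lra.
left. apply Rinv_0_lt_compat. lra.
Qed.

Lemma rapid_geometric a K r : 0 <= r < 1 -> (forall n, Rabs (a n) <= K * r ^ n) ->
  rapid a.
Proof.
intros Hr H k. revert a K r Hr H. induction k as [|k IH]; intros a K r Hr H.
- apply ex_series_Rle with (fun n => K * r ^ n).
  + intros n. simpl. rewrite Rmult_1_l, Rabs_Rabsolu. apply H.
  + apply ex_series_scal_R, ex_series_geom. rewrite Rabs_pos_eq; lra.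
- (* with r <= s^2 and s = 1 / (1 + d), Bernoulli gives n s^n <= 1 / d *)
  set (s := sqrt ((r + 1) / 2)).
  assert (Hs2 : s * s = (r + 1) / 2) by (apply sqrt_sqrt; lra).
  assert (Hs0 : 0 < s) by (apply sqrt_lt_R0; lra).
  assert (Hs1 : s < 1) by nra.
  set (d := / s - 1).
  assert (Hd : 0 < d).
  { unfold d. assert (1 < / s) by (rewrite <- Rinv_1; apply Rinv_lt_contravar; lra). lra. }
  assert (HB : forall n, INR n * s ^ n <= / d).
  { intros n. apply Rmult_le_reg_l with (d * (/ s) ^ n).
    - apply Rmult_lt_0_compat; trivial. apply pow_lt, Rinv_0_lt_compat; trivial.
    - replace (d * (/ s) ^ n * (INR n * s ^ n)) with (INR n * d * (/ s * s) ^ n)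
        by (rewrite Rpow_mult_distr; ring).
      rewrite Rinv_l, pow1 by lra.
      replace (d * (/ s) ^ n * / d) with ((/ s) ^ n) by (field; lra).
      replace (/ s) with (1 + d) by (unfold d; ring).
      generalize (poly n d Hd). lra. }
  assert (HK : 0 <= K) by (generalize (H O) (Rabs_pos (a O)); simpl; lra).
  eapply ex_series_ext.
  2:{ apply (IH (fun n => INR n * a n) (K * / d) s). lra.
      intros n. rewrite Rabs_mult, (Rabs_pos_eq (INR n)) by apply pos_INR.
      apply Rle_trans with (INR n * (K * (s * s) ^ n)).
      - apply Rmult_le_compat_l. apply pos_INR.
        eapply Rle_trans. apply H. apply Rmult_le_compat_l; trivial.
        apply pow_incr; lra.
      - rewrite Rpow_mult_distr.
        replace (INR n * (K * (s ^ n * s ^ n))) with (K * (INR n * s ^ n) * s ^ n) by ring.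
        apply Rmult_le_compat_r. apply pow_le; lra.
        apply Rmult_le_compat_l; trivial. }
  intros n. simpl. rewrite Rabs_mult, (Rabs_pos_eq (INR n)) by apply pos_INR. ring.
Qed.

(** * Absolutely convergent complex series *)

Lemma Re_abs_le z : Rabs (Re z) <= Cmod z.
Proof. eapply Rle_trans; [apply Rmax_l|apply Rmax_Cmod]. Qed.

Lemma Im_abs_le z : Rabs (Im z) <= Cmod z.
Proof. eapply Rle_trans; [apply Rmax_r|apply Rmax_Cmod]. Qed.

Definition Cabs_summable (a : nat -> C) := ex_series (fun n => Cmod (a n)).

Lemma ex_series_Re a : Cabs_summable a -> ex_series (fun n => Re (a n)).
Proof. apply ex_series_Rle. intros; apply Re_abs_le. Qed.

Lemma ex_series_Im a : Cabs_summable a -> ex_series (fun n => Im (a n)).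
Proof. apply ex_series_Rle. intros; apply Im_abs_le. Qed.

Lemma CSeries_ext a b : (forall n, a n = b n) -> CSeries a = CSeries b.
Proof.
intros H. unfold CSeries. f_equal; apply Series_ext; intros n; now rewrite H.
Qed.

Lemma Cabs_summable_plus a b : Cabs_summable a -> Cabs_summable b ->
  Cabs_summable (fun n => a n + b n)%C.
Proof.
intros Ha Hb. apply ex_series_Rle with (fun n => Cmod (a n) + Cmod (b n)).
- intros n. rewrite Rabs_pos_eq by apply Cmod_ge_0. apply Cmod_triangle.
- now apply ex_series_plus_R.
Qed.

Lemma Cabs_summable_scal c a : Cabs_summable a -> Cabs_summable (fun n => c * a n)%C.
Proof.
intros Ha. eapply ex_series_ext; [|apply (ex_series_scal_R (Cmod c)), Ha].
intros n. simpl. now rewrite Cmod_mult.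
Qed.

Lemma CSeries_plus a b : Cabs_summable a -> Cabs_summable b ->
  CSeries (fun n => a n + b n)%C = (CSeries a + CSeries b)%C.
Proof.
intros Ha Hb. unfold CSeries, Cplus; simpl.
rewrite <- !Series_plus; auto using ex_series_Re, ex_series_Im.
Qed.

Lemma CSeries_scal c a : Cabs_summable a ->
  CSeries (fun n => c * a n)%C = (c * CSeries a)%C.
Proof.
intros Ha. unfold CSeries, Cmult; simpl.
rewrite <- !Series_scal_l.
rewrite <- Series_minus, <- Series_plus;
  try (apply ex_series_scal_R; auto using ex_series_Re, ex_series_Im).
f_equal; apply Series_ext; intros n; unfold Re, Im; simpl; ring.
Qed.

Lemma CSeries_minus a b : Cabs_summable a -> Cabs_summable b ->
  CSeries (fun n => a n - b n)%C = (CSeries a - CSeries b)%C.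
Proof.
intros Ha Hb.
rewrite (CSeries_ext _ (fun n => a n + (- (1)) * b n)%C) by (intros; ring).
rewrite CSeries_plus, CSeries_scal; auto using Cabs_summable_scal. ring.
Qed.

(** A rotation turns the sum into its modulus, and the real part of a sum is at
    most the sum of the moduli. *)
Lemma Cmod_CSeries_le a : Cabs_summable a ->
  Cmod (CSeries a) <= Series (fun n => Cmod (a n)).
Proof.
intros Ha. set (w := CSeries a).
destruct (Ceq_dec w 0) as [->|Hw].
{ rewrite Cmod_0. apply Series_nonneg; trivial. intros; apply Cmod_ge_0. }
assert (Hw' : 0 < Cmod w) by now apply Cmod_gt_0.
set (c := (Cconj w / Cmod w)%C).
assert (Hc : Cmod c = 1).
{ unfold c. rewrite Cmod_div, Cmod_conj, Cmod_R, Rabs_pos_eq by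
    (try apply RtoC_neq; try lra; try (intros E; apply RtoC_inj in E; lra)).
  field; lra. }
assert (Hcw : (c * w)%C = Cmod w).
{ unfold c. transitivity ((w * Cconj w) / Cmod w)%C. field. intros E; apply RtoC_inj in E; lra.
  rewrite <- Cmod2_conj. rewrite RtoC_pow. field. intros E; apply RtoC_inj in E; lra. }
replace (Cmod w) with (Re (CSeries (fun n => c * a n)%C)).
2:{ rewrite CSeries_scal by trivial. fold w. rewrite Hcw. reflexivity. }
clearbody c. change (Re (CSeries (fun n => c * a n)%C)) with (Series (fun n => Re (c * a n)%C)).
eapply Rle_trans. apply Rle_abs.
assert (A : Cabs_summable (fun n => c * a n)%C) by now apply Cabs_summable_scal.
eapply Rle_trans. apply Series_Rabs.
{ apply ex_series_Rle with (2 := A). intros n. rewrite Rabs_Rabsolu. apply Re_abs_le. }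
apply Series_le; trivial. intros n. split. apply Rabs_pos.
eapply Rle_trans. apply Re_abs_le. rewrite Cmod_mult, Hc. lra.
Qed.

Lemma CSeries_incr_1 a : Cabs_summable a ->
  CSeries a = (a O + CSeries (fun n => a (S n)))%C.
Proof.
intros Ha. unfold CSeries.
rewrite (Series_incr_1 (fun n => Re (a n))), (Series_incr_1 (fun n => Im (a n)))
  by auto using ex_series_Re, ex_series_Im.
unfold Cplus; simpl. reflexivity.
Qed.

Lemma CSeries_R (a : nat -> R) : CSeries (fun n => RtoC (a n)) = RtoC (Series a).
Proof.
unfold CSeries, RtoC. f_equal. apply Series_zero. intros; reflexivity.
Qed.

(** * Complex power series with real coefficients *)

Definition CPS (a : nat -> R) (z : C) : C := CSeries (fun n => RtoC (a n) * z ^ n)%C.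

Lemma Cmod_pow_le_1 z n : Cmod z <= 1 -> Cmod (z ^ n)%C <= 1.
Proof.
intros Hz. rewrite Cmod_pow. rewrite <- (pow1 n). apply pow_incr. split; trivial.
apply Cmod_ge_0.
Qed.

Lemma CPS_summable a z : ex_series (fun n => Rabs (a n)) -> Cmod z <= 1 ->
  Cabs_summable (fun n => RtoC (a n) * z ^ n)%C.
Proof.
intros Ha Hz. apply ex_series_Rle with (2 := Ha). intros n.
rewrite Rabs_pos_eq by apply Cmod_ge_0. rewrite Cmod_mult, Cmod_R.
rewrite <- (Rmult_1_r (Rabs (a n))) at 2. apply Rmult_le_compat_l. apply Rabs_pos.
now apply Cmod_pow_le_1.
Qed.

Lemma CPS_ext a b z : (forall n, a n = b n) -> CPS a z = CPS b z.
Proof. intros H. apply CSeries_ext. intros; now rewrite H. Qed.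

Lemma CPS_R a (x : R) : CPS a x = RtoC (Series (fun n => a n * x ^ n)).
Proof.
unfold CPS. rewrite <- CSeries_R. apply CSeries_ext. intros n.
now rewrite RtoC_mult, RtoC_pow.
Qed.

Lemma CPS_scal c a z : ex_series (fun n => Rabs (a n)) -> Cmod z <= 1 ->
  CPS (fun n => c * a n) z = (RtoC c * CPS a z)%C.
Proof.
intros Ha Hz. unfold CPS. rewrite <- CSeries_scal by now apply CPS_summable.
apply CSeries_ext. intros. rewrite RtoC_mult. ring.
Qed.

Lemma CPS_incr_1 a z : ex_series (fun n => Rabs (a n)) -> Cmod z <= 1 ->
  CPS a z = (RtoC (a O) + z * CPS (fun n => a (S n)) z)%C.
Proof.
intros Ha Hz. unfold CPS. rewrite CSeries_incr_1 by now apply CPS_summable.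
rewrite <- CSeries_scal.
- f_equal. simpl. ring. apply CSeries_ext. intros n. rewrite Cpow_S. ring.
- apply CPS_summable; trivial. now apply (ex_series_incr_1 (fun n => Rabs (a n))).
Qed.

Lemma CPS_0 a : ex_series (fun n => Rabs (a n)) -> CPS a 0 = RtoC (a O).
Proof. intros Ha. rewrite CPS_incr_1; trivial. ring. rewrite Cmod_0; lra. Qed.

(** Take the real Cauchy products of the four pairs of real and imaginary parts;
    the formulas for the parts of z^k z^(n-k) recombine them. *)
Lemma CPS_mult a b z : ex_series (fun n => Rabs (a n)) ->
  ex_series (fun n => Rabs (b n)) -> Cmod z <= 1 ->
  (CPS a z * CPS b z)%C = CPS (PS_mult a b) z.
Proof.
intros Ha Hb Hz.
assert (HR : forall c, ex_series (fun n => Rabs (c n)) ->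
   ex_series (fun n => Rabs (c n * Re (z ^ n)%C))).
{ intros c Hc. apply ex_series_Rle with (2 := Hc). intros n.
  rewrite Rabs_Rabsolu, Rabs_mult.
  rewrite <- (Rmult_1_r (Rabs (c n))) at 2. apply Rmult_le_compat_l. apply Rabs_pos.
  eapply Rle_trans. apply Re_abs_le. now apply Cmod_pow_le_1. }
assert (HI : forall c, ex_series (fun n => Rabs (c n)) ->
   ex_series (fun n => Rabs (c n * Im (z ^ n)%C))).
{ intros c Hc. apply ex_series_Rle with (2 := Hc). intros n.
  rewrite Rabs_Rabsolu, Rabs_mult.
  rewrite <- (Rmult_1_r (Rabs (c n))) at 2. apply Rmult_le_compat_l. apply Rabs_pos.
  eapply Rle_trans. apply Im_abs_le. now apply Cmod_pow_le_1. }
assert (E : forall c, CPS c z = (Series (fun n => c n * Re (z ^ n)%C),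
                                 Series (fun n => c n * Im (z ^ n)%C))).
{ intros c. unfold CPS, CSeries.
  f_equal; apply Series_ext; intros n; unfold Re, Im; simpl; ring. }
assert (P : forall u v : nat -> R,
  ex_series (fun n => Rabs (u n)) -> ex_series (fun n => Rabs (v n)) ->
  is_series (fun n => sum_f_R0 (fun k => u k * v (n - k)%nat) n) (Series u * Series v)).
{ intros u v Hu Hv. apply is_series_mult; trivial;
  apply Series_correct, ex_series_Rabs; trivial. }
rewrite !E. unfold Cmult; simpl.
assert (Zn : forall n k, (k <= n)%nat ->
  (Re (z ^ n)%C = Re (z ^ k)%C * Re (z ^ (n - k))%C - Im (z ^ k)%C * Im (z ^ (n - k))%C) /\
  (Im (z ^ n)%C = Re (z ^ k)%C * Im (z ^ (n - k))%C + Im (z ^ k)%C * Re (z ^ (n - k))%C)).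
{ intros n k Hk. assert (Zk : (z ^ n = z ^ k * z ^ (n - k))%C) by (rewrite <- Cpow_add_r; f_equal; lia).
  rewrite Zk. split; reflexivity. }
f_equal; symmetry; apply is_series_unique.
- eapply is_series_ext; [|apply (@is_series_minus R_AbsRing R_NormedModule);
     apply P; [apply (HR a)|apply (HR b)|apply (HI a)|apply (HI b)]; trivial].
  intros n. cbv beta. unfold PS_mult. 
  change (sum_f_R0 (fun k => a k * Re (z ^ k)%C * (b (n - k)%nat * Re (z ^ (n - k))%C)) n
    - sum_f_R0 (fun k => a k * Im (z ^ k)%C * (b (n - k)%nat * Im (z ^ (n - k))%C)) n
    = sum_f_R0 (fun k => a k * b (n - k)%nat) n * Re (z ^ n)%C).
  rewrite <- minus_sum, Rmult_comm, scal_sum. apply sum_eq. intros k Hk.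
  rewrite (proj1 (Zn n k Hk)). ring.
- eapply is_series_ext; [|apply (@is_series_plus R_AbsRing R_NormedModule);
     apply P; [apply (HR a)|apply (HI b)|apply (HI a)|apply (HR b)]; trivial].
  intros n. cbv beta. unfold PS_mult. 
  change (sum_f_R0 (fun k => a k * Re (z ^ k)%C * (b (n - k)%nat * Im (z ^ (n - k))%C)) n
    + sum_f_R0 (fun k => a k * Im (z ^ k)%C * (b (n - k)%nat * Re (z ^ (n - k))%C)) n
    = sum_f_R0 (fun k => a k * b (n - k)%nat) n * Im (z ^ n)%C).
  rewrite <- plus_sum, Rmult_comm, scal_sum. apply sum_eq. intros k Hk.
  rewrite (proj2 (Zn n k Hk)). ring.
Qed.

Lemma Cpow_lipschitz z w n : Cmod z <= 1 -> Cmod w <= 1 ->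
  Cmod (z ^ n - w ^ n)%C <= INR n * Cmod (z - w)%C.
Proof.
intros Hz Hw. induction n as [|n IH].
- simpl. replace (1 - 1)%C with (RtoC 0) by ring. rewrite Cmod_0; lra.
- rewrite !Cpow_S, S_INR.
  replace (z * z ^ n - w * w ^ n)%C with (z * (z ^ n - w ^ n) + (z - w) * w ^ n)%C by ring.
  eapply Rle_trans. apply Cmod_triangle. rewrite !Cmod_mult.
  assert (H1 := Cmod_pow_le_1 w n Hw).
  assert (H2 := Cmod_ge_0 (z - w)%C). assert (H3 := Cmod_ge_0 z).
  assert (H4 := Cmod_ge_0 (z ^ n - w ^ n)%C). nra.
Qed.

(** Continuity up to the boundary of the disk. *)
Lemma CPS_lipschitz a z w : rapid a -> Cmod z <= 1 -> Cmod w <= 1 ->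
  Cmod (CPS a z - CPS a w)%C <= Series (fun n => INR n * Rabs (a n)) * Cmod (z - w)%C.
Proof.
intros Ha Hz Hw. assert (Ha0 := rapid_abs a Ha).
unfold CPS. rewrite <- CSeries_minus by now apply CPS_summable.
rewrite <- Series_scal_r.
assert (X : ex_series (fun n => INR n * Rabs (a n) * Cmod (z - w)%C)).
{ apply ex_series_scal_r. eapply ex_series_ext; [|apply (Ha 1%nat)].
  intros n; simpl; ring. }
assert (B : forall n, Cmod (RtoC (a n) * z ^ n - RtoC (a n) * w ^ n)%C
   <= INR n * Rabs (a n) * Cmod (z - w)%C).
{ intros n. replace (RtoC (a n) * z ^ n - RtoC (a n) * w ^ n)%C
    with (RtoC (a n) * (z ^ n - w ^ n))%C by ring.
  rewrite Cmod_mult, Cmod_R. generalize (Cpow_lipschitz z w n Hz Hw) (Rabs_pos (a n)).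
  intros. nra. }
eapply Rle_trans. apply Cmod_CSeries_le.
- apply ex_series_Rle with (2 := X). intros n. rewrite Rabs_pos_eq by apply Cmod_ge_0.
  apply B.
- apply Series_le; trivial. intros n. split. apply Cmod_ge_0. apply B.
Qed.

(** The derivative of z^n, by cases because its exponent n - 1 is truncated at
    n = 0. *)
Definition Cpow_derive (z : C) (n : nat) : C :=
  match n with O => RtoC 0 | S m => (RtoC (INR (S m)) * z ^ m)%C end.

Lemma Cpow_remainder z h n : Cmod z <= 1 -> Cmod (z + h)%C <= 1 ->
  Cmod ((z + h) ^ n - z ^ n - Cpow_derive z n * h)%C <= INR n ^ 2 * Cmod h ^ 2.
Proof.
intros Hz Hzh. induction n as [|n IH].
- simpl. replace (1 - 1 - 0 * h)%C with (RtoC 0) by ring. rewrite Cmod_0.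
  generalize (Cmod_ge_0 h); nra.
- assert (E : ((z + h) ^ S n - z ^ S n - Cpow_derive z (S n) * h
    = (z + h) * ((z + h) ^ n - z ^ n - Cpow_derive z n * h) + Cpow_derive z n * (h * h))%C).
  { destruct n as [|m]; unfold Cpow_derive.
    - simpl. ring.
    - rewrite (S_INR (S m)), RtoC_plus, !Cpow_S. ring. }
  rewrite E. eapply Rle_trans. apply Cmod_triangle. rewrite !Cmod_mult.
  assert (D : Cmod (Cpow_derive z n) <= INR n).
  { destruct n as [|m]; unfold Cpow_derive. rewrite Cmod_0; simpl; lra.
    rewrite Cmod_mult, Cmod_R, Rabs_pos_eq by apply pos_INR.
    generalize (Cmod_pow_le_1 z m Hz) (pos_INR (S m)). nra. }
  rewrite S_INR. assert (H0 := Cmod_ge_0 h). assert (H1 := pos_INR n).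
  set (e := Cmod ((z + h) ^ n - z ^ n - Cpow_derive z n * h)%C) in *.
  assert (H2 : 0 <= e) by apply Cmod_ge_0. assert (H3 := Cmod_ge_0 (z + h)%C).
  assert (Cmod (z + h)%C * e <= e) by nra.
  assert (Cmod (Cpow_derive z n) * (Cmod h * Cmod h) <= INR n * (Cmod h * Cmod h))
    by (apply Rmult_le_compat_r; nra).
  assert (0 <= INR n * (Cmod h * Cmod h)) by nra. nra.
Qed.

(** Termwise, with the remainder of z^n bounded by n^2 |h|^2 on the closed disk,
    which the coefficients absorb. *)
Lemma Cderiv_CPS a z : rapid a -> Cmod z < 1 -> Cderiv (CPS a) z (CPS (PS_derive a) z).
Proof.
intros Ha Hz. assert (Ha0 := rapid_abs a Ha).
assert (Hd0 := rapid_abs _ (rapid_derive a Ha)).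
assert (Dsum : Cabs_summable (fun n => RtoC (a n) * Cpow_derive z n)%C).
{ apply (ex_series_incr_1 (fun n => Cmod (RtoC (a n) * Cpow_derive z n)%C)).
  eapply ex_series_ext; [|apply (CPS_summable _ z Hd0); lra].
  intros n. simpl. f_equal. unfold PS_derive. rewrite RtoC_mult.
  change (match n with O => 1 | S _ => INR n + 1 end) with (INR (S n)). ring. }
assert (Deq : CPS (PS_derive a) z = CSeries (fun n => RtoC (a n) * Cpow_derive z n)%C).
{ rewrite (CSeries_incr_1 _ Dsum). unfold Cpow_derive at 1. 
  rewrite Cmult_0_r, Cplus_0_l. apply CSeries_ext. intros n.
  unfold PS_derive, Cpow_derive. rewrite RtoC_mult. ring. }
apply (Cderiv_quadratic _ _ _ (Series (fun n => INR n ^ 2 * Rabs (a n))) (1 - Cmod z)).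
lra.
intros h Hh.
assert (Hzh : Cmod (z + h)%C <= 1) by (eapply Rle_trans; [apply Cmod_triangle|lra]).
rewrite Deq. unfold CPS.
assert (S1 := CPS_summable a z Ha0 (Rlt_le _ _ Hz)).
assert (S2 := CPS_summable a (z + h)%C Ha0 Hzh).
assert (S3 := Cabs_summable_scal h _ Dsum).
assert (S4 : Cabs_summable (fun n => RtoC (a n) * (z + h) ^ n - RtoC (a n) * z ^ n)%C).
{ eapply ex_series_ext; [|apply (Cabs_summable_plus _ _ S2 (Cabs_summable_scal (- (1)) _ S1))].
  intros n. simpl. f_equal. ring. }
rewrite <- CSeries_minus, (Cmult_comm _ h), <- CSeries_scal, <- CSeries_minus; trivial.
rewrite <- Series_scal_r.
assert (X : ex_series (fun n => INR n ^ 2 * Rabs (a n) * Cmod h ^ 2))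
  by (apply ex_series_scal_r, Ha).
assert (B : forall n, Cmod (RtoC (a n) * (z + h) ^ n - RtoC (a n) * z ^ n
    - h * (RtoC (a n) * Cpow_derive z n))%C <= INR n ^ 2 * Rabs (a n) * Cmod h ^ 2).
{ intros n.
  replace (RtoC (a n) * (z + h) ^ n - RtoC (a n) * z ^ n
    - h * (RtoC (a n) * Cpow_derive z n))%C
    with (RtoC (a n) * ((z + h) ^ n - z ^ n - Cpow_derive z n * h))%C by ring.
  rewrite Cmod_mult, Cmod_R.
  generalize (Cpow_remainder z h n (Rlt_le _ _ Hz) Hzh) (Rabs_pos (a n)). intros. nra. }
eapply Rle_trans. apply Cmod_CSeries_le.
- apply ex_series_Rle with (2 := X). intros n. rewrite Rabs_pos_eq by apply Cmod_ge_0.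
  apply B.
- apply Series_le; trivial. intros n. split. apply Cmod_ge_0. apply B.
Qed.

(** * Formal power series *)

(** The operators s d/ds, multiplication by s, and s |-> -s on formal series
    in s. *)
Definition theta (u : nat -> R) (n : nat) : R := INR n * u n.
Definition mulX (u : nat -> R) (n : nat) : R := match n with O => 0 | S k => u k end.
Definition twist (u : nat -> R) (n : nat) : R := (-1) ^ n * u n.

Definition PS_one (n : nat) : R := match n with O => 1 | _ => 0 end.

Lemma PS_mult_ext u u' v v' n : (forall k, u k = u' k) -> (forall k, v k = v' k) ->
  PS_mult u v n = PS_mult u' v' n.
Proof. intros H H'. apply sum_eq. intros. now rewrite H, H'. Qed.

Lemma PS_mult_Sn u v n :
  PS_mult u v (S n) = u O * v (S n) + PS_mult (fun k => u (S k)) v n.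
Proof. unfold PS_mult. rewrite decomp_sum by lia. simpl. reflexivity. Qed.

Lemma PS_mult_lin_l x u y v w n :
  PS_mult (fun k => x * u k + y * v k) w n = x * PS_mult u w n + y * PS_mult v w n.
Proof.
unfold PS_mult. rewrite !scal_sum, <- plus_sum. apply sum_eq. intros; ring.
Qed.

Lemma PS_mult_comm u v n : PS_mult u v n = PS_mult v u n.
Proof.
unfold PS_mult. rewrite <- !sum_n_Reals.
revert u v. induction n as [|n IH]; intros u v.
- rewrite !sum_O. simpl. ring.
- rewrite !sum_n_Reals in *. rewrite decomp_sum, tech5 by lia. simpl pred.
  rewrite Nat.sub_diag, Nat.sub_0_r.
  assert (E := IH (fun k => u (S k)) v). rewrite !sum_n_Reals in E. cbv beta in E.
  replace (sum_f_R0 (fun i => u (S i) * v (S n - S i)%nat) n)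
    with (sum_f_R0 (fun k => u (S k) * v (n - k)%nat) n) by (apply sum_eq; intros; reflexivity).
  rewrite E. rewrite (sum_eq (fun k => v k * u (S (n - k))) (fun k => v k * u (S n - k)%nat)).
  ring. intros i Hi. do 2 f_equal. lia.
Qed.

Lemma PS_mult_lin_r x u y v w n :
  PS_mult w (fun k => x * u k + y * v k) n = x * PS_mult w u n + y * PS_mult w v n.
Proof.
rewrite PS_mult_comm, PS_mult_lin_l, (PS_mult_comm u), (PS_mult_comm v). reflexivity.
Qed.

Lemma PS_mult_assoc u v w n :
  PS_mult (PS_mult u v) w n = PS_mult u (PS_mult v w) n.
Proof.
revert u v w. induction n as [|n IH]; intros u v w.
- unfold PS_mult. simpl. ring.
- rewrite !PS_mult_Sn.
  rewrite (PS_mult_ext (fun k => PS_mult u v (S k))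
    (fun k => u O * v (S k) + 1 * PS_mult (fun k => u (S k)) v k) w w n)
    by (intros; try rewrite PS_mult_Sn; ring).
  rewrite PS_mult_lin_l, IH. unfold PS_mult at 1. simpl. ring.
Qed.

Lemma theta_mult u v n :
  theta (PS_mult u v) n = PS_mult (theta u) v n + PS_mult u (theta v) n.
Proof.
unfold theta, PS_mult. rewrite Rmult_comm, <- plus_sum, Rmult_comm, scal_sum.
apply sum_eq. intros k Hk. rewrite (minus_INR n k Hk). ring.
Qed.

Lemma mulX_mult u v n : PS_mult (mulX u) v n = mulX (PS_mult u v) n.
Proof.
destruct n as [|n].
- unfold PS_mult. simpl. ring.
- rewrite PS_mult_Sn. simpl. ring_simplify. apply PS_mult_ext; reflexivity.
Qed.

Lemma mulX_mult_r u v n : PS_mult u (mulX v) n = mulX (PS_mult u v) n.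
Proof.
rewrite PS_mult_comm, mulX_mult. destruct n; simpl; trivial. apply PS_mult_comm.
Qed.

Lemma twist_twist u n : twist (twist u) n = u n.
Proof.
unfold twist. rewrite <- Rmult_assoc, <- Rpow_mult_distr.
replace (-1 * -1) with 1 by ring. rewrite pow1. ring.
Qed.

Lemma twist_mult u v n : PS_mult (twist u) (twist v) n = twist (PS_mult u v) n.
Proof.
unfold twist, PS_mult. rewrite scal_sum. apply sum_eq. intros k Hk.
assert (E : (-1) ^ n = (-1) ^ k * (-1) ^ (n - k)) by (rewrite <- pow_add; f_equal; lia).
rewrite E. ring.
Qed.

Lemma pow_m1_even n : (-1) ^ (2 * n) = 1.
Proof. rewrite pow_mult. replace ((-1) ^ 2) with 1 by ring. apply pow1. Qed.

Lemma PS_mult_even u v n : (forall k, v (2 * k + 1)%nat = 0) ->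
  PS_mult u v (2 * n) = PS_mult (fun k => u (2 * k)%nat) (fun k => v (2 * k)%nat) n.
Proof.
intros Hv. unfold PS_mult.
assert (H : forall m, (m <= n)%nat ->
  sum_f_R0 (fun k => u k * v (2 * n - k)%nat) (2 * m) =
  sum_f_R0 (fun k => u (2 * k)%nat * v (2 * (n - k))%nat) m).
{ induction m as [|m IH]; intros Hm.
  - change (u O * v (2 * n - 0)%nat = u O * v (2 * (n - 0))%nat).
    now rewrite !Nat.sub_0_r.
  - replace (2 * S m)%nat with (S (S (2 * m))) by lia.
    rewrite !tech5, IH by lia.
    replace (2 * n - S (2 * m))%nat with (2 * (n - S m) + 1)%nat by lia.
    rewrite Hv, Rmult_0_r, Rplus_0_r.
    replace (S (S (2 * m)))%nat with (2 * S m)%nat by lia.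
    replace (2 * n - 2 * S m)%nat with (2 * (n - S m))%nat by lia. reflexivity. }
apply H. lia.
Qed.

(** * The coefficients of J, I and their product *)

(** [(z/2)^nu / Gamma (nu+1)] times the series in [z^2] with coefficients
    [twist (Icoef nu)], [Icoef nu] are [J_nu (z)] and [I_nu (z)]. *)
Fixpoint Icoef (nu : R) (n : nat) : R :=
  match n with
  | O => 1
  | S k => Icoef nu k / (4 * INR (S k) * (nu + INR (S k)))
  end.

(** Absolute values of the coefficients of [J_nu I_nu] in w = z^4, normalized to
    1 at w = 0: in closed form 1 / (16^n n! (nu+1)_n (nu+1)_(2n)). *)
Fixpoint Pabs (nu : R) (n : nat) : R :=
  match n with
  | O => 1
  | S k => Pabs nu k /
     (16 * INR (S k) * (nu + INR (S k)) * (nu + INR (2 * k + 1)) * (nu + INR (2 * k + 2)))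
  end.

Definition Pcoef (nu : R) : nat -> R := twist (Pabs nu).

Section Coefficients.

Variable nu : R.
Hypothesis Hnu : -1 < nu.

Lemma nu_INR_pos n : 0 < nu + INR (S n).
Proof. rewrite S_INR. generalize (pos_INR n). lra. Qed.

Lemma Icoef_pos n : 0 < Icoef nu n.
Proof.
induction n as [|n IH]; [simpl; lra|]. 
change (0 < Icoef nu n / (4 * INR (S n) * (nu + INR (S n)))).
apply Rdiv_lt_0_compat; trivial. repeat apply Rmult_lt_0_compat; try lra.
apply lt_0_INR; lia. apply nu_INR_pos.
Qed.

Lemma Pabs_pos n : 0 < Pabs nu n.
Proof.
induction n as [|n IH]; [simpl; lra|]. 
change (0 < Pabs nu n / (16 * INR (S n) * (nu + INR (S n))
   * (nu + INR (2 * n + 1)) * (nu + INR (2 * n + 2)))).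
apply Rdiv_lt_0_compat; trivial. repeat apply Rmult_lt_0_compat; try lra.
apply lt_0_INR; lia. apply nu_INR_pos.
replace (2 * n + 1)%nat with (S (2 * n)) by lia. apply nu_INR_pos.
replace (2 * n + 2)%nat with (S (S (2 * n))) by lia. apply nu_INR_pos.
Qed.

Notation A := (twist (Icoef nu)).
Notation B := (Icoef nu).

(** Bessel's equation (z d/dz)^2 y - nu^2 y = z^2 y for I_nu, and with - z^2 y for
    J_nu, in terms of s = z^2 and after removal of the factor z^nu. *)
Lemma I_ode n : theta (theta B) n = - nu * theta B n + / 4 * mulX B n.
Proof.
destruct n as [|n]; unfold theta, mulX. simpl; ring.
change (B (S n)) with (B n / (4 * INR (S n) * (nu + INR (S n)))).
field. split. generalize (nu_INR_pos n); lra. apply not_0_INR; lia.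
Qed.

Lemma J_ode n : theta (theta A) n = - nu * theta A n + (- / 4) * mulX A n.
Proof.
assert (H := I_ode n). destruct n as [|n]; unfold theta, mulX, twist in *. simpl; ring.
simpl pow. 
transitivity (- (-1) ^ n * (INR (S n) * (INR (S n) * B (S n)))). ring. rewrite H. ring.
Qed.

(** The Wronskian [W] and the product [M] of the derivatives close up, together
    with [P] = A B, to a first-order system, because J and I satisfy equations
    differing only in one sign. *)
Let P := PS_mult A B.
Let W n := 1 * PS_mult (theta A) B n + (-1) * PS_mult A (theta B) n.
Let M := PS_mult (theta A) (theta B).

Lemma W_rec n : (INR n + nu) * W n = - / 2 * mulX P n.
Proof.
assert (E : INR n * W n = 1 * theta (PS_mult (theta A) B) n
   + (-1) * theta (PS_mult A (theta B)) n) by (unfold W, theta; ring).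
rewrite !theta_mult in E.
rewrite (PS_mult_ext _ _ B B n J_ode (fun _ => eq_refl)), PS_mult_lin_l in E.
rewrite (PS_mult_ext A A _ _ n (fun _ => eq_refl) I_ode), PS_mult_lin_r in E.
rewrite mulX_mult, mulX_mult_r in E. fold P in E.
rewrite Rmult_plus_distr_r, E. unfold W. field.
Qed.

Lemma P_rec n : INR n * (INR n + nu) * P n = 2 * M n.
Proof.
assert (E : INR n * (INR n * P n) = theta (PS_mult (theta A) B) n + theta (PS_mult A (theta B)) n).
{ unfold theta at 1 3. rewrite <- Rmult_plus_distr_l. f_equal. rewrite <- theta_mult. reflexivity. }
assert (E1 : INR n * P n = PS_mult (theta A) B n + PS_mult A (theta B) n) by apply theta_mult.
rewrite !theta_mult in E.
rewrite (PS_mult_ext _ _ B B n J_ode (fun _ => eq_refl)), PS_mult_lin_l in E.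
rewrite (PS_mult_ext A A _ _ n (fun _ => eq_refl) I_ode), PS_mult_lin_r in E.
rewrite mulX_mult, mulX_mult_r in E. fold P M in E.
replace (INR n * (INR n + nu) * P n) with (INR n * (INR n * P n) + nu * (INR n * P n)) by ring.
rewrite E, E1. field.
Qed.

Lemma M_rec n : (INR n + 2 * nu) * M n = / 4 * mulX W n.
Proof.
assert (E : INR n * M n = PS_mult (theta (theta A)) (theta B) n
   + PS_mult (theta A) (theta (theta B)) n) by apply theta_mult.
rewrite (PS_mult_ext _ _ (theta B) (theta B) n J_ode (fun _ => eq_refl)), PS_mult_lin_l in E.
rewrite (PS_mult_ext (theta A) (theta A) _ _ n (fun _ => eq_refl) I_ode), PS_mult_lin_r in E.
rewrite mulX_mult, mulX_mult_r in E. fold M in E.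
replace ((INR n + 2 * nu) * M n) with (INR n * M n + 2 * nu * M n) by ring.
rewrite E. destruct n; simpl; unfold W; ring.
Qed.

Lemma P_rec2 n : P (S (S n)) = - P n /
  (4 * (INR n + 2) * (nu + INR n + 2) * (INR n + 2 + 2 * nu) * (nu + INR n + 1)).
Proof.
assert (H1 := P_rec (S (S n))). assert (H2 := M_rec (S (S n))). assert (H3 := W_rec (S n)).
simpl mulX in H2, H3. rewrite !S_INR in *.
assert (Hn := pos_INR n).
assert (N1 : nu + INR n + 1 <> 0) by lra.
replace (W (S n)) with (- P n / (2 * (nu + INR n + 1))) in H2.
2:{ apply Rmult_eq_reg_l with (INR n + 1 + nu); [|lra]. rewrite H3. field; lra. }
replace (M (S (S n))) with (- P n / (8 * (nu + INR n + 1) * (INR n + 2 + 2 * nu))) in H1.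
2:{ apply Rmult_eq_reg_l with (INR n + 1 + 1 + 2 * nu); [|lra]. rewrite H2. field; lra. }
apply Rmult_eq_reg_l with ((INR n + 1 + 1) * (INR n + 1 + 1 + nu)); [|apply Rgt_not_eq; nra].
rewrite H1. field. lra.
Qed.

(** Elimination of [W] and [M] leaves a two-term recurrence of step 2 for the
    coefficients of [P]. *)
Lemma JI_product_even n : PS_mult A B (2 * n) = Pcoef nu n.
Proof.
change (P (2 * n)%nat = Pcoef nu n).
induction n as [|n IH].
- unfold P, PS_mult, Pcoef, twist. simpl. ring.
- replace (2 * S n)%nat with (S (S (2 * n))) by lia. rewrite P_rec2, IH.
  unfold Pcoef, twist. change (Pabs nu (S n)) with (Pabs nu n /
     (16 * INR (S n) * (nu + INR (S n)) * (nu + INR (2 * n + 1)) * (nu + INR (2 * n + 2)))).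
  rewrite S_INR, !plus_INR, mult_INR. simpl INR. simpl pow.
  assert (Hn := pos_INR n). field. repeat split; lra.
Qed.

Lemma JI_product_odd n : PS_mult A B (2 * n + 1) = 0.
Proof.
change (P (2 * n + 1)%nat = 0).
induction n as [|n IH].
- unfold P, PS_mult, twist. simpl. field. lra.
- replace (2 * S n + 1)%nat with (S (S (2 * n + 1))) by lia. rewrite P_rec2, IH.
  unfold Rdiv. ring.
Qed.

(** * Rayleigh sums *)

Lemma strong_recursion (step : nat -> (nat -> R) -> R) :
  (forall n u v, (forall k, (k < n)%nat -> u k = v k) -> step n u = step n v) ->
  exists u, forall n, u n = step n u.
Proof.
intros H.
set (upto := fix upto n : nat -> R := match n with
  | O => fun _ => 0
  | S n => fun k => if Nat.eq_dec k n then step n (upto n) else upto n k end).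
assert (E : forall n k, (k < n)%nat -> upto n k = upto (S k) k).
{ induction n as [|n IH]; intros k Hk. lia.
  simpl. destruct (Nat.eq_dec k n) as [->|Hkn].
  - destruct (Nat.eq_dec n n); [reflexivity|congruence].
  - rewrite IH by lia. reflexivity. }
exists (fun n => upto (S n) n). intros n.
change (upto (S n) n) with (if Nat.eq_dec n n then step n (upto n) else upto n n).
destruct (Nat.eq_dec n n) as [_|]; [|congruence].
apply H. intros k Hk. apply E; trivial.
Qed.

(** Kishore's recurrence for the Rayleigh sums sigma_n = sum_j j^(-2n) over the
    positive zeros of J_nu: it is the Riccati equation satisfied by the
    logarithmic derivative of the first Bessel series, and it shows at once
    that the sums are nonnegative. *)
Lemma Rayleigh_exists : exists sigma : nat -> R, sigma O = 0 /\ sigma 1%nat = / (4 * (nu + 1)) /\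
  (forall n, 0 <= sigma n) /\
  (forall n, theta sigma n = - nu * sigma n + 1 * (/ 4 * mulX PS_one n
      + 1 * PS_mult sigma sigma n)).
Proof.
destruct (strong_recursion (fun n u => match n with
  | O => 0
  | S m => ((match m with O => / 4 | _ => 0 end) +
      PS_mult (fun k => if Nat.eq_dec k n then 0 else u k)
              (fun k => if Nat.eq_dec k n then 0 else u k) n) / (nu + INR n) end)) as [s Hs].
{ intros [|m] u v H; trivial. f_equal. f_equal. apply sum_eq. intros k Hk.
  destruct (Nat.eq_dec k (S m)), (Nat.eq_dec (S m - k) (S m)); try ring.
  rewrite (H k), (H (S m - k)%nat) by lia. reflexivity. }
assert (S0 : s O = 0) by (apply (Hs O)).
assert (HS : forall m, s (S m) = ((match m with O => / 4 | _ => 0 end) + PS_mult s s (S m)) / (nu + INR (S m))).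
{ intros m. rewrite (Hs (S m)). f_equal. f_equal. apply sum_eq. intros k Hk.
  destruct (Nat.eq_dec k (S m)) as [->|].
  - rewrite Nat.sub_diag, S0. ring.
  - destruct (Nat.eq_dec (S m - k) (S m)); trivial.
    replace k with O by lia. rewrite S0. ring. }
exists s. repeat split; trivial.
- rewrite HS. unfold PS_mult. simpl. rewrite S0. field. lra.
- intros n. induction n as [n IH] using lt_wf_ind.
  destruct n as [|m]. rewrite S0; lra.
  rewrite (Hs (S m)). apply Rdiv_le_0_compat; [|apply nu_INR_pos].
  assert (0 <= match m with O => / 4 | _ => 0 end) by (destruct m; lra).
  apply Rplus_le_le_0_compat; trivial.
  apply cond_pos_sum. intros k.
  destruct (Nat.eq_dec k (S m)); [lra|].
  destruct (Nat.eq_dec (S m - k) (S m)); [lra|].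
  destruct (Nat.le_gt_cases k m).
  + apply Rmult_le_pos; apply IH; lia.
  + replace (S m - k)%nat with O by lia. rewrite S0. lra.
- intros [|m]; unfold theta.
  + rewrite S0. unfold PS_mult. simpl. rewrite S0. ring.
  + replace (INR (S m) * s (S m)) with ((nu + INR (S m)) * s (S m) - nu * s (S m)) by ring.
    rewrite HS at 1. simpl mulX. generalize (nu_INR_pos m). intros.
    destruct m; unfold PS_one; field; lra.
Qed.

(** The defect D = sigma A + theta A of the expected identity satisfies
    theta D + nu D = sigma D, whose only formal solution is 0 since sigma has no
    constant term. *)
Lemma Rayleigh_logderiv sigma : sigma O = 0 ->
  (forall n, theta sigma n = - nu * sigma n + 1 * (/ 4 * mulX PS_one n
      + 1 * PS_mult sigma sigma n)) ->
  forall n, PS_mult sigma A n = - theta A n.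
Proof.
intros S0 HS.
set (D n := 1 * PS_mult sigma A n + 1 * theta A n).
assert (HD : forall n, (INR n + nu) * D n = PS_mult sigma D n).
{ intros n.
  assert (U : forall v k, PS_mult (mulX PS_one) v k = mulX v k).
  { unfold PS_one. intros v k. rewrite mulX_mult. destruct k as [|k]; simpl; trivial.
    destruct k as [|k]. unfold PS_mult; simpl; ring.
    rewrite PS_mult_Sn. rewrite (PS_mult_ext _ (fun k => 0 * v k + 0 * v k) v v) by (intros; ring).
    rewrite PS_mult_lin_l. ring. }
  unfold D. rewrite PS_mult_lin_r.
  assert (E : INR n * PS_mult sigma A n = PS_mult (theta sigma) A n + PS_mult sigma (theta A) n)
    by apply theta_mult.
  rewrite (PS_mult_ext _ _ A A n HS (fun _ => eq_refl)), PS_mult_lin_l in E.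
  rewrite PS_mult_lin_l, U, PS_mult_assoc in E.
  assert (E2 := J_ode n). unfold theta at 1 in E2.
  replace ((INR n + nu) * (1 * PS_mult sigma A n + 1 * theta A n))
    with (INR n * PS_mult sigma A n + INR n * theta A n
          + nu * PS_mult sigma A n + nu * theta A n) by ring.
  rewrite E, E2. ring. }
assert (D0 : forall n, D n = 0).
{ intros n. induction n as [n IH] using lt_wf_ind.
  destruct n as [|n].
  - unfold D, theta, PS_mult. simpl. rewrite S0. ring.
  - assert (E := HD (S n)). rewrite PS_mult_Sn, S0 in E.
    replace (PS_mult (fun k => sigma (S k)) D n) with 0 in E.
    + apply Rmult_eq_reg_l with (INR (S n) + nu). rewrite E. ring.
      generalize (nu_INR_pos n). lra.
    + symmetry. unfold PS_mult. rewrite (sum_eq _ (fun _ => 0)).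
      rewrite sum_cte. ring.
      intros k Hk. rewrite IH by lia. ring. }
intros n. generalize (D0 n). unfold D. lra.
Qed.

(** The even Rayleigh sums are the coefficients of the logarithmic derivative
    of the product series: the odd ones cancel between J and I. *)
Lemma even_Rayleigh : exists s : nat -> R, (forall n, 0 <= s n) /\ 0 < s O /\
  forall n, PS_mult s (Pcoef nu) n = - PS_derive (Pcoef nu) n.
Proof.
destruct Rayleigh_exists as [sg [S0 [S1 [SP SR]]]].
assert (LA := Rayleigh_logderiv sg S0 SR).
assert (LB : forall n, PS_mult (twist sg) B n = - theta B n).
{ intros n. rewrite (PS_mult_ext (twist sg) (twist sg) B (twist A)) by
    (intros; try rewrite twist_twist; reflexivity).
  rewrite twist_mult. unfold twist at 1. rewrite LA. unfold theta, twist.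
  transitivity (- ((-1) ^ n * (-1) ^ n) * (INR n * B n)). ring.
  rewrite <- Rpow_mult_distr. replace (-1 * -1) with 1 by ring. rewrite pow1. ring. }
assert (LP : forall n, PS_mult (fun k => 1 * sg k + 1 * twist sg k) P n = - theta P n).
{ intros n. rewrite PS_mult_lin_l. unfold P at 1 2. rewrite <- PS_mult_assoc.
  rewrite (PS_mult_ext _ _ B B n LA (fun _ => eq_refl)).
  rewrite (PS_mult_ext (twist sg) (twist sg) _ (PS_mult B A) n)
    by (trivial; intros; apply PS_mult_comm).
  rewrite <- PS_mult_assoc. rewrite (PS_mult_ext _ _ A A n LB (fun _ => eq_refl)).
  rewrite (PS_mult_ext (fun k => - theta A k) (fun k => (-1) * theta A k + 0 * theta A k) B B)
    by (intros; ring).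
  rewrite (PS_mult_ext (fun k => - theta B k) (fun k => (-1) * theta B k + 0 * theta B k) A A)
    by (intros; ring).
  rewrite !PS_mult_lin_l, (PS_mult_comm (theta B)). unfold P. rewrite theta_mult. ring. }
exists (fun n => sg (2 * n + 2)%nat). repeat split.
- intros n. apply SP.
- (* 2 sigma_2 = - nu sigma_2 + sigma_1^2 *)
  assert (E := SR 2%nat). unfold theta, PS_mult in E. simpl in E. rewrite S0, S1 in E.
  assert (E' : (nu + 2) * sg 2%nat = / (4 * (nu + 1)) * / (4 * (nu + 1))) by lra.
  assert (0 < / (4 * (nu + 1))) by (apply Rinv_0_lt_compat; lra).
  simpl. nra.
- intros n. assert (E := LP (2 * S n)%nat).
  rewrite PS_mult_even in E by (intros; apply JI_product_odd).
  rewrite PS_mult_Sn in E. simpl (2 * 0)%nat in E.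
  replace (theta P (2 * S n)) with (2 * INR (S n) * Pcoef nu (S n)) in E.
  2:{ unfold theta, P. rewrite JI_product_even, mult_INR. reflexivity. }
  rewrite (PS_mult_ext _ (fun k => 2 * sg (2 * k + 2)%nat + 0 * sg (2 * k + 2)%nat) _ (Pcoef nu)) in E.
  + rewrite PS_mult_lin_l in E. replace (twist sg 0) with 0 in E by (unfold twist; rewrite S0; ring).
    rewrite S0 in E. unfold PS_derive. lra.
  + intros k. unfold twist. rewrite pow_m1_even. replace (2 * S k)%nat with (2 * k + 2)%nat by lia. ring.
  + intros k. apply JI_product_even.
Qed.

End Coefficients.

(** * Principal logarithm and powers *)

Definition Clog (z : C) : C := (ln (Cmod z), Carg z).

Lemma Carg_bounds (z : C) : z <> 0 -> - PI < Carg z <= PI.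
Proof.
intros Hz. assert (H0 : 0 < Cmod z) by now apply Cmod_gt_0.
assert (HPI := PI_RGT_0). assert (Hb := acos_bound (Re z / Cmod z)).
unfold Carg. destruct Rle_dec as [H|H]; [split; lra|].
split; [|lra]. apply Ropp_lt_contravar.
(* acos t = PI would force Re z = - |z|, hence Im z = 0 *)
destruct Hb as [_ [Hb|Hb]]; trivial. exfalso.
assert (Hr : -1 <= Re z / Cmod z <= 1).
{ assert (R1 := Re_abs_le z). apply Rabs_le_between in R1.
  split; [apply Rle_div_r|apply Rle_div_l]; lra. }
assert (E := cos_acos _ Hr). rewrite Hb, cos_PI in E.
assert (E2 : Re z = - Cmod z).
{ apply Rmult_eq_reg_r with (/ Cmod z). fold (Re z / Cmod z). rewrite <- E. field; lra.
  apply Rinv_neq_0_compat; lra. }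
assert (E3 : Cmod z ^ 2 = Re z ^ 2 + Im z ^ 2).
{ unfold Cmod. rewrite pow2_sqrt by nra. reflexivity. }
rewrite E2 in E3. nra.
Qed.

Lemma Cexp_Clog (z : C) : z <> 0 -> Cexp (Clog z) = z.
Proof.
intros Hz. assert (H0 : 0 < Cmod z) by now apply Cmod_gt_0.
assert (Hr : -1 <= Re z / Cmod z <= 1).
{ assert (R1 := Re_abs_le z). apply Rabs_le_between in R1.
  split; [apply Rle_div_r|apply Rle_div_l]; lra. }
assert (E3 : Cmod z ^ 2 = Re z ^ 2 + Im z ^ 2).
{ unfold Cmod. rewrite pow2_sqrt by nra. reflexivity. }
assert (S : sin (acos (Re z / Cmod z)) = Rabs (Im z) / Cmod z).
{ rewrite sin_acos by trivial. unfold Rsqr.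
  replace (1 - Re z / Cmod z * (Re z / Cmod z)) with ((Rabs (Im z) / Cmod z) ^ 2).
  rewrite sqrt_pow2; trivial. apply Rdiv_le_0_compat; auto using Rabs_pos.
  unfold Rdiv. rewrite Rpow_mult_distr, pow2_abs.
  replace (Im z ^ 2) with (Cmod z ^ 2 - Re z ^ 2) by lra. field; lra. }
change (Cexp (Clog z)) with
  (exp (ln (Cmod z)) * cos (Carg z), exp (ln (Cmod z)) * sin (Carg z)).
rewrite exp_ln by trivial.
unfold Carg. destruct Rle_dec as [H|H].
- rewrite cos_acos, S, Rabs_pos_eq by trivial. destruct z as [a b]. unfold Re, Im; simpl fst; simpl snd.
  f_equal; field; lra.
- rewrite cos_neg, sin_neg, cos_acos, S, Rabs_left by (trivial; lra).
  destruct z as [a b]. unfold Re, Im; simpl fst; simpl snd.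
  f_equal; field; lra.
Qed.

Lemma Cpower_Cexp (z : C) (a : R) : z <> 0 -> Cpower z a = Cexp (RtoC a * Clog z).
Proof.
intros Hz. assert (H0 : 0 < Cmod z) by now apply Cmod_gt_0.
unfold Cpower. destruct Req_EM_T as [H|_]; [lra|].
unfold Cexp, Clog, Rpower, Re, Im; simpl. f_equal; f_equal; f_equal; ring.
Qed.

Lemma Clog_Cexp y : - PI < Im y <= PI -> Clog (Cexp y) = y.
Proof.
intros Hy. unfold Clog. rewrite Cmod_Cexp, ln_exp.
replace (Carg (Cexp y)) with (Im y); [now destruct y|].
assert (He := exp_pos (Re y)).
unfold Carg. rewrite Cmod_Cexp.
replace (Re (Cexp y) / exp (Re y)) with (cos (Im y))
  by (unfold Cexp, Re; simpl; field; unfold Re in He; lra).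
change (Im (Cexp y)) with (exp (Re y) * sin (Im y)).
destruct Rle_dec as [H|H].
- assert (0 <= sin (Im y)) by nra.
  rewrite acos_cos; trivial. split; [|lra].
  destruct (Rle_dec 0 (Im y)); trivial.
  assert (0 < sin (- Im y)) by (apply sin_gt_0; lra). rewrite sin_neg in *. lra.
- assert (sin (Im y) < 0) by nra.
  assert (Im y < 0).
  { destruct (Rlt_dec (Im y) 0); trivial.
    assert (0 <= sin (Im y)) by (apply sin_ge_0; lra). lra. }
  rewrite <- cos_neg, acos_cos; lra.
Qed.

Lemma Cpower_of_Cexp y a : - PI < Im y <= PI -> Cpower (Cexp y) a = Cexp (RtoC a * y).
Proof.
intros Hy. rewrite Cpower_Cexp by apply Cexp_neq_0. now rewrite Clog_Cexp.
Qed.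

Lemma Cpower_plus (z : C) a b : z <> 0 -> (Cpower z a * Cpower z b)%C = Cpower z (a + b).
Proof.
intros Hz. rewrite !Cpower_Cexp, <- Cexp_plus by trivial. f_equal.
rewrite RtoC_plus. ring.
Qed.

Lemma Cpower_neq_0 (z : C) a : z <> 0 -> Cpower z a <> 0.
Proof. intros Hz. rewrite Cpower_Cexp by trivial. apply Cexp_neq_0. Qed.

Lemma Cpower_1 (z : C) : z <> 0 -> Cpower z 1 = z.
Proof. intros Hz. rewrite Cpower_Cexp, Cmult_1_l by trivial. now apply Cexp_Clog. Qed.

Lemma Cpower_exp_0 (z : C) : z <> 0 -> Cpower z 0 = 1.
Proof. intros Hz. rewrite Cpower_Cexp, Cmult_0_l by trivial. apply Cexp_0. Qed.

Lemma Cpower_0_neq a : a <> 0 -> Cpower 0 a = 0.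
Proof.
intros Ha. unfold Cpower. destruct Req_EM_T as [_|H]; [|now rewrite Cmod_0 in H].
destruct Req_EM_T; [contradiction|reflexivity].
Qed.

Lemma half_neq_0 (z : C) : z <> 0 -> (z / 2)%C <> 0.
Proof.
intros Hz. apply Cmult_neq_0; trivial. intros H.
assert (E : (2 * / 2)%C = 1) by (field; intros E; apply RtoC_inj in E; lra).
rewrite H, Cmult_0_r in E. apply RtoC_inj in E. lra.
Qed.

Lemma Clog_half (z : C) : z <> 0 -> Clog (z / 2) = (Clog z - ln 2)%C.
Proof.
intros Hz. assert (H0 : 0 < Cmod z) by now apply Cmod_gt_0.
assert (E : (z / 2)%C = (RtoC (/ 2) * z)%C)
  by (rewrite RtoC_inv by lra; unfold Cdiv; ring).
unfold Clog. rewrite E, Cmod_mult, Cmod_R, Rabs_pos_eq by lra.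
replace (Carg (RtoC (/ 2) * z)) with (Carg z).
- rewrite ln_mult, ln_Rinv by lra. unfold Cminus, Cplus, RtoC; simpl. f_equal; ring.
- unfold Carg. rewrite Cmod_mult, Cmod_R, (Rabs_pos_eq (/ 2)) by lra.
  replace (Re (RtoC (/ 2) * z)%C) with (/ 2 * Re z) by (destruct z; unfold Re; simpl; ring).
  replace (Im (RtoC (/ 2) * z)%C) with (/ 2 * Im z) by (destruct z; unfold Im; simpl; ring).
  replace (/ 2 * Re z / (/ 2 * Cmod z)) with (Re z / Cmod z) by (field; lra).
  destruct (Rle_dec 0 (Im z)), (Rle_dec 0 (/ 2 * Im z)); try reflexivity; lra.
Qed.

Lemma Cpower_half (z : C) a : z <> 0 -> Cpower (z / 2) a = (RtoC (Rpower 2 (- a)) * Cpower z a)%C.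
Proof.
intros Hz. rewrite !Cpower_Cexp, Clog_half by auto using half_neq_0.
unfold Rpower. rewrite <- Cexp_R, <- Cexp_plus. f_equal.
rewrite !RtoC_mult, RtoC_opp. ring.
Qed.

(** For b between 0 and 1 the number b Arg z stays in ]-PI, PI], so that the
    principal logarithm of z^b is b log z. *)
Lemma Cpower_Cpower (z : C) a b : z <> 0 -> 0 <= b <= 1 ->
  Cpower (Cpower z b) a = Cpower z (a * b).
Proof.
intros Hz Hb. rewrite (Cpower_Cexp z b), Cpower_of_Cexp, (Cpower_Cexp z) by
  (trivial; assert (H := Carg_bounds z Hz); 
   replace (Im (RtoC b * Clog z)%C) with (b * Carg z)
     by (unfold Clog, Im; simpl; ring);
   assert (HPI := PI_RGT_0); nra).
f_equal. rewrite RtoC_mult. ring.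
Qed.

(** * Starlikeness from a logarithm with nonnegative coefficients *)

Lemma PS_derive_Int s n : PS_derive (PS_Int s) n = s n.
Proof.
unfold PS_derive, PS_Int. field. apply not_0_INR. lia.
Qed.

Lemma left_limit_nonneg (u : R -> R) (L : R) :
  (forall x, 0 < x < 1 -> Rabs (u x - u 1) <= L * (1 - x)) ->
  (forall x, 0 < x < 1 -> 0 < u x) -> 0 <= u 1.
Proof.
intros HL H. apply Rnot_lt_le. intros N.
set (d := Rmin (/ 2) (- u 1 / (Rabs L + 1))).
assert (HA := Rabs_pos L). assert (HB := Rle_abs L).
assert (Hd : 0 < d) by (apply Rmin_pos; [lra|apply Rdiv_lt_0_compat; lra]).
assert (Hd1 : d <= / 2) by apply Rmin_l.
assert (Hd2 : d * (Rabs L + 1) <= - u 1) by (apply Rle_div_r; [lra|apply Rmin_r]).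
assert (X := H (1 - d) ltac:(lra)). assert (Y := HL (1 - d) ltac:(lra)).
apply Rabs_le_between in Y. nra.
Qed.

Section Starlike.

Variables (s : nat -> R) (k : R) (m : nat).
Hypothesis s_pos : forall n, 0 <= s n.
Hypothesis s_rapid : rapid s.
Hypothesis k_pos : 0 < k.

(** [G] has the coefficients s_n / (n+1) at w^(n+1), so that w G' = w (sum s_n w^n)
    and z F' / F = 1 - k (m+1) w (sum s_n w^n) at w = z^(m+1).  The coefficients
    being nonnegative, the real part of this is least at z = 1. *)
Let G := CPS (PS_Int s).
Let F (z : C) : C := (z * Cexp (- (RtoC k * G (z ^ S m))))%C.

Lemma pow_disk z : Cmod z < 1 -> Cmod (z ^ S m)%C < 1.
Proof.
intros Hz. rewrite Cpow_S, Cmod_mult.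
assert (Cmod (z ^ m)%C <= 1) by (apply Cmod_pow_le_1; lra).
generalize (Cmod_ge_0 z) (Cmod_ge_0 (z ^ m)%C). nra.
Qed.

Lemma Cderiv_exp_form z : Cmod z < 1 ->
  Cderiv F z (Cexp (- (RtoC k * G (z ^ S m)))
     * (1 - RtoC (k * INR (S m)) * (z ^ S m * CPS s (z ^ S m))))%C.
Proof.
intros Hz. unfold F. evar_last.
- apply Cderiv_mult. apply Cderiv_id.
  apply (Cderiv_comp Cexp). apply Cderiv_Cexp.
  apply (Cderiv_ext (fun x => (- RtoC k) * G (x ^ S m))%C). intros; ring.
  apply Cderiv_scal. apply (Cderiv_comp G).
  + apply Cderiv_CPS. now apply rapid_Int. now apply pow_disk.
  + apply Cderiv_pow.
- cbv beta. rewrite (CPS_ext _ s) by apply PS_derive_Int.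
  rewrite RtoC_mult. set (E := Cexp _). set (q := CPS s _). rewrite Cpow_S. ring.
Qed.

Variable f : C -> C.
Hypothesis f_exp_form : forall z, Cmod z < 1 -> f z = F z.

Lemma Cderiv_of_exp_form z : Cmod z < 1 ->
  Cderiv f z (Cexp (- (RtoC k * G (z ^ S m)))
     * (1 - RtoC (k * INR (S m)) * (z ^ S m * CPS s (z ^ S m))))%C.
Proof.
intros Hz. apply (Cderiv_ext_ball F) with (1 - Cmod z); [lra| |now apply Cderiv_exp_form].
intros x Hx. symmetry. apply f_exp_form.
replace x with (z + (x - z))%C by ring.
eapply Rle_lt_trans. apply Cmod_triangle. lra.
Qed.

Lemma exp_form_logderiv (z : C) : Cmod z < 1 -> z <> 0 ->
  (z * C_derive f z / f z)%C = (1 - RtoC (k * INR (S m)) * (z ^ S m * CPS s (z ^ S m)))%C.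
Proof.
intros Hz Hz0.
rewrite (is_C_derive_unique f z _ (Cderiv_is_derive _ _ _ (Cderiv_of_exp_form z Hz))).
rewrite f_exp_form by trivial. unfold F. field. split; trivial. apply Cexp_neq_0.
Qed.

Lemma CPS_bound a z : ex_series (fun n => Rabs (a n)) -> Cmod z <= 1 ->
  Cmod (CPS a z) <= Series (fun n => Rabs (a n)).
Proof.
intros Ha Hz. eapply Rle_trans. apply Cmod_CSeries_le. now apply CPS_summable.
apply Series_le; trivial. intros n. split. apply Cmod_ge_0.
rewrite Cmod_mult, Cmod_R. rewrite <- (Rmult_1_r (Rabs (a n))) at 2.
apply Rmult_le_compat_l. apply Rabs_pos. now apply Cmod_pow_le_1.
Qed.

(** In the logarithmic coordinate [z = Cexp a], the map [G (z ^ (m+1))] is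
    Lipschitz with constant [(m + 1) * Series s] times the bound r on |z|: the
    powers [Cexp (N * a)] are Lipschitz with constant N r^N <= N r, and the factors
    N = (m + 1) * (n + 1) cancel the denominators of [PS_Int]. *)
Lemma log_lipschitz a b r : r < 1 -> Cmod (Cexp a) <= r -> Cmod (Cexp b) <= r ->
  Cmod (G (Cexp a ^ S m) - G (Cexp b ^ S m))%C
  <= INR (S m) * Series s * r * Cmod (a - b)%C.
Proof.
intros Hr Ha Hb.
assert (Hr0 : 0 < r) by (rewrite Cmod_Cexp in Ha; generalize (exp_pos (Re a)); lra).
assert (Hla : Re a <= ln r).
{ rewrite Cmod_Cexp in Ha. rewrite <- (ln_exp (Re a)). apply ln_le; trivial. apply exp_pos. }
assert (Hlb : Re b <= ln r).
{ rewrite Cmod_Cexp in Hb. rewrite <- (ln_exp (Re b)). apply ln_le; trivial. apply exp_pos. }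
assert (Hlr : ln r < 0) by (rewrite <- ln_1; now apply ln_increasing).
assert (Hi : ex_series (fun n => Rabs (PS_Int s n))) by (apply rapid_abs, rapid_Int; trivial).
assert (Es : ex_series s).
{ apply ex_series_Rabs, rapid_abs; trivial. }
unfold G, CPS. rewrite <- CSeries_minus by
  (apply CPS_summable; trivial; left; apply pow_disk; lra).
set (u := fun n => (RtoC (PS_Int s n) * (Cexp a ^ S m) ^ n
                   - RtoC (PS_Int s n) * (Cexp b ^ S m) ^ n)%C).
assert (B : forall n, Cmod (u (S n)) <= s n * (INR (S m) * r * Cmod (a - b)%C)).
{ intros n. unfold u. rewrite <- !Cpow_mult_r, !Cexp_pow.
  set (N := (S m * S n)%nat).
  replace (RtoC (PS_Int s (S n)) * Cexp (RtoC (INR N) * a) -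
           RtoC (PS_Int s (S n)) * Cexp (RtoC (INR N) * b))%C
    with (RtoC (PS_Int s (S n)) * (Cexp (RtoC (INR N) * a) - Cexp (RtoC (INR N) * b)))%C by ring.
  rewrite Cmod_mult, Cmod_R.
  assert (HN : 1 <= INR N) by (apply (le_INR 1); unfold N; lia).
  assert (L := Cexp_lipschitz (RtoC (INR N) * a) (RtoC (INR N) * b) (ln r)).
  replace (RtoC (INR N) * a - RtoC (INR N) * b)%C with (RtoC (INR N) * (a - b))%C in L by ring.
  rewrite exp_ln, Cmod_mult, Cmod_R, Rabs_pos_eq in L by lra.
  unfold PS_Int. rewrite Rabs_pos_eq by
    (apply Rdiv_le_0_compat; [apply s_pos|apply lt_0_INR; lia]).
  assert (Hn : 0 < INR (S n)) by (apply lt_0_INR; lia).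
  apply Rle_trans with (s n / INR (S n) * (r * (INR N * Cmod (a - b)%C))).
  - apply Rmult_le_compat_l. apply Rdiv_le_0_compat; auto.
    apply L.
    + replace (Re (RtoC (INR N) * a)%C) with (INR N * Re a) by (destruct a; unfold Re; simpl; ring).
      nra.
    + replace (Re (RtoC (INR N) * b)%C) with (INR N * Re b) by (destruct b; unfold Re; simpl; ring).
      nra.
  - right. unfold N. rewrite mult_INR. field. lra. }
assert (U0 : u O = 0) by (unfold u, PS_Int; ring).
assert (Xs : ex_series (fun n => s n * (INR (S m) * r * Cmod (a - b)%C)))
  by (apply ex_series_scal_r, Es).
assert (Us : Cabs_summable (fun n => u (S n))).
{ apply ex_series_Rle with (2 := Xs). intros n. rewrite Rabs_pos_eq by apply Cmod_ge_0.
  apply B. }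
assert (Us' : Cabs_summable u) by (now apply (ex_series_incr_1 (fun n => Cmod (u n)))).
rewrite CSeries_incr_1, U0, Cplus_0_l by trivial.
eapply Rle_trans. apply Cmod_CSeries_le; trivial.
eapply Rle_trans. apply Series_le with (2 := Xs).
{ intros n. split. apply Cmod_ge_0. apply B. }
rewrite Series_scal_r. right; ring.
Qed.

(** Univalence comes from contraction: if z1 = e^a and F z1 = F z2, then
    z2 = e^b for b = a - k (G (z1^(m+1)) - G (z2^(m+1))), so that |a - b| is at
    most k (m+1) (Series s) max(|z1|,|z2|) |a - b|, whence a = b. *)
Lemma exp_form_starlike (alpha : R) : 0 <= alpha < 1 -> 0 < s O ->
  k * INR (S m) * Series s <= 1 - alpha -> starlike_of_order alpha f.
Proof.
intros Hal Hs0 HQ.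
assert (Es : ex_series s) by (apply ex_series_Rabs, rapid_abs; trivial).
assert (Hm : 0 < INR (S m)) by (apply lt_0_INR; lia).
assert (M0 : Cmod 0 < 1) by (rewrite Cmod_0; lra).
assert (Q0 : 0 < Series s).
{ rewrite Series_incr_1 by trivial.
  assert (0 <= Series (fun n => s (S n))).
  { apply Series_nonneg. intros; apply s_pos. now apply (ex_series_incr_1 s). }
  lra. }
repeat split.
- intros z Hz. eexists. apply Cderiv_is_derive, Cderiv_of_exp_form. exact Hz.
- rewrite f_exp_form by trivial. unfold F. ring.
- rewrite (is_C_derive_unique _ _ _ (Cderiv_is_derive _ _ _ (Cderiv_of_exp_form 0 M0))).
  rewrite Cpow_S, !Cmult_0_l, Cmult_0_r. unfold G. rewrite CPS_0.
  simpl PS_Int. rewrite Cmult_0_r. replace (- 0)%C with (RtoC 0) by ring.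
  rewrite Cexp_0. ring. now apply rapid_abs, rapid_Int.
- intros z1 z2 H1 H2 E. rewrite !f_exp_form in E by trivial. unfold F in E.
  destruct (Ceq_dec z1 0) as [->|N1].
  { rewrite Cmult_0_l in E. destruct (Ceq_dec z2 0) as [->|N2]; trivial.
    exfalso. symmetry in E. revert E. apply Cmult_neq_0; trivial. apply Cexp_neq_0. }
  destruct (Ceq_dec z2 0) as [->|N2].
  { exfalso. rewrite Cmult_0_l in E. revert E. apply Cmult_neq_0; trivial. apply Cexp_neq_0. }
  set (a := Clog z1).
  assert (Ea : Cexp a = z1) by now apply Cexp_Clog.
  set (b := (a - RtoC k * (G (z1 ^ S m) - G (z2 ^ S m)))%C).
  assert (Eb : Cexp b = z2).
  { unfold b. replace (a - RtoC k * (G (z1 ^ S m) - G (z2 ^ S m)))%C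
      with (a + (- (RtoC k * G (z1 ^ S m)) + RtoC k * G (z2 ^ S m)))%C by ring.
    rewrite !Cexp_plus, Ea, Cmult_assoc, E, <- Cmult_assoc, <- Cexp_plus.
    replace (- (RtoC k * G (z2 ^ S m)) + RtoC k * G (z2 ^ S m))%C with (RtoC 0) by ring.
    rewrite Cexp_0. ring. }
  set (r := Rmax (Cmod z1) (Cmod z2)).
  assert (Hr : r < 1) by now apply Rmax_lub_lt.
  assert (Hr0 : 0 <= r) by (eapply Rle_trans; [apply (Cmod_ge_0 z1)|apply Rmax_l]).
  assert (L := log_lipschitz a b r Hr).
  rewrite Ea, Eb in L. specialize (L (Rmax_l _ _) (Rmax_r _ _)).
  assert (Eab : (a - b)%C = (RtoC k * (G (z1 ^ S m) - G (z2 ^ S m)))%C) by (unfold b; ring).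
  assert (D : Cmod (a - b)%C <= r * Cmod (a - b)%C).
  { rewrite Eab at 1. rewrite Cmod_mult, Cmod_R, Rabs_pos_eq by lra.
    assert (Hd := Cmod_ge_0 (a - b)%C). set (d := Cmod (a - b)%C) in *.
    apply Rle_trans with (k * (INR (S m) * Series s * r * d)).
    apply Rmult_le_compat_l; lra.
    replace (k * (INR (S m) * Series s * r * d)) with ((k * INR (S m) * Series s) * (r * d)) by ring.
    rewrite <- (Rmult_1_l (r * d)) at 2. apply Rmult_le_compat_r; nra. }
  assert (D0 : Cmod (a - b)%C = 0).
  { generalize (Cmod_ge_0 (a - b)%C). nra. }
  apply Cmod_eq_0 in D0. apply Ceq_minus in D0. now rewrite <- Ea, <- Eb, D0.
- intros z Hz Hz0.
  rewrite exp_form_logderiv by trivial. set (q := (z ^ S m * CPS s (z ^ S m))%C).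
  assert (Hq : Cmod q < Series s).
  { unfold q. rewrite Cmod_mult. assert (W := pow_disk z Hz).
    assert (CB : Cmod (CPS s (z ^ S m)) <= Series s).
    { rewrite (Series_ext s (fun n => Rabs (s n))) by (intros; rewrite Rabs_pos_eq; auto).
      apply CPS_bound. now apply rapid_abs. lra. }
    generalize (Cmod_ge_0 (z ^ S m)%C) (Cmod_ge_0 (CPS s (z ^ S m))). nra. }
  replace (Re (1 - RtoC (k * INR (S m)) * q)%C) with (1 - k * INR (S m) * Re q).
  2:{ destruct q; unfold Re; simpl fst. simpl. ring. }
  assert (Re q < Series s) by (generalize (Re_abs_le q) (Rle_abs (Re q)); lra).
  assert (0 < k * INR (S m)) by now apply Rmult_lt_0_compat.
  nra.
Qed.

(** Conversely, let z tend to 1 along the real axis. *)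
Lemma starlike_exp_form_bound alpha : starlike_of_order alpha f ->
  k * INR (S m) * Series s <= 1 - alpha.
Proof.
intros [_ [_ [_ [_ H]]]].
set (u := fun x : R => 1 - k * INR (S m) * Re (RtoC x ^ S m * CPS s (RtoC x ^ S m))%C).
assert (Es : ex_series (fun n => Rabs (s n))) by now apply rapid_abs.
assert (U1 : u 1 = 1 - k * INR (S m) * Series s).
{ unfold u. rewrite Cpow_1_l, Cmult_1_l, CPS_R. simpl Re. do 2 f_equal.
  apply Series_ext. intros; rewrite pow1; ring. }
enough (0 <= u 1 - alpha) by lra.
set (L := Series (fun n => INR n * Rabs (mulX s n))).
apply (left_limit_nonneg (fun x => u x - alpha) (Rabs (k * INR (S m)) * (L * INR (S m)))).
- intros x Hx. unfold u.
  assert (Ew : forall w : C, Cmod w <= 1 -> (w * CPS s w)%C = CPS (mulX s) w).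
  { intros w Hw. rewrite (CPS_incr_1 (mulX s)) by
      (trivial; now apply (ex_series_incr_1 (fun n => Rabs (mulX s n)))).
    simpl. now rewrite Cplus_0_l. }
  assert (Hx1 : Cmod x <= 1) by (rewrite Cmod_R, Rabs_pos_eq; lra).
  assert (H11 : Cmod 1 <= 1) by (rewrite Cmod_1; lra).
  rewrite !Ew by now apply Cmod_pow_le_1.
  match goal with |- Rabs ?t <= _ => replace t with
    (k * INR (S m) * Re (CPS (mulX s) (RtoC 1 ^ S m) - CPS (mulX s) (RtoC x ^ S m))%C) end.
  2:{ unfold Re, Cminus, Cplus, Copp; simpl fst; ring. }
  rewrite Rabs_mult, Rmult_assoc. apply Rmult_le_compat_l. apply Rabs_pos.
  eapply Rle_trans. apply Re_abs_le.
  eapply Rle_trans. apply CPS_lipschitz; try now apply Cmod_pow_le_1.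
  apply rapid_unshift. exact s_rapid.
  fold L. rewrite Rmult_assoc. apply Rmult_le_compat_l.
  { apply Series_nonneg. intros; apply Rmult_le_pos; auto using pos_INR, Rabs_pos.
    assert (K := rapid_unshift (mulX s) s_rapid 1%nat).
    eapply ex_series_ext; [|apply K]. intros; simpl; ring. }
  eapply Rle_trans. apply Cpow_lipschitz; trivial.
  rewrite <- RtoC_minus, Cmod_R, Rabs_pos_eq; lra.
- intros x Hx. assert (Hxm : Cmod x < 1) by (rewrite Cmod_R, Rabs_pos_eq; lra).
  assert (Hx0 : RtoC x <> 0) by (intros E; apply RtoC_inj in E; lra).
  specialize (H x Hxm Hx0). rewrite exp_form_logderiv in H by trivial. unfold u.
  replace (Re (1 - RtoC (k * INR (S m)) * (RtoC x ^ S m * CPS s (RtoC x ^ S m)))%C)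
    with (1 - k * INR (S m) * Re (RtoC x ^ S m * CPS s (RtoC x ^ S m))%C) in H.
  lra. generalize (k * INR (S m)). intros c.
  destruct (RtoC x ^ S m * CPS s (RtoC x ^ S m))%C. unfold Re; simpl. ring.
Qed.

End Starlike.

(** * Euler's integral *)

(** A positive continuous function on the half line whose integrals over
    compact intervals are bounded has an improper integral, by monotonicity at
    both ends. *)
Lemma is_RInt_gen_pos_bounded (f : R -> R) (M : R) :
  (forall t, 0 < t -> 0 < f t) -> (forall t, 0 < t -> continuous f t) ->
  (forall a, 0 < a <= 1 -> RInt f a 1 <= M) ->
  (forall b, 1 <= b -> RInt f 1 b <= M) ->
  exists l, 0 < l /\ is_RInt_gen f (at_right 0) (Rbar_locally p_infty) l.
Proof.
intros Hp Hc Ha Hb.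
assert (Ex : forall a b, 0 < a -> a <= b -> ex_RInt f a b).
{ intros a b H0 Hab. apply (@ex_RInt_continuous R_CompleteNormedModule).
  rewrite Rmin_left, Rmax_right by lra. intros t Ht. apply Hc. lra. }
assert (P : forall a b, 0 < a -> a <= b -> 0 <= RInt f a b).
{ intros a b H0 Hab. apply RInt_ge_0; auto. intros t Ht. left. apply Hp. lra. }
assert (Ch : forall a b c, 0 < a -> a <= b -> b <= c -> RInt f a c = RInt f a b + RInt f b c).
{ intros a b c H0 Hab Hbc. symmetry. apply (@RInt_Chasles R_CompleteNormedModule); apply Ex; lra. }
destruct (completeness (fun y => exists a, 0 < a <= 1 /\ y = RInt f a 1)) as [l1 [U1 L1]].
{ exists M. intros y [a [H ->]]. now apply Ha. }
{ exists (RInt f 1 1). exists 1. split; trivial; lra. }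
destruct (completeness (fun y => exists b, 1 <= b /\ y = RInt f 1 b)) as [l2 [U2 L2]].
{ exists M. intros y [a [H ->]]. now apply Hb. }
{ exists (RInt f 1 1). exists 1. split; trivial; lra. }
exists (l1 + l2). split.
{ assert (0 <= l1) by (eapply Rle_trans; [apply (P 1 1); lra|apply U1; exists 1; split; trivial; lra]).
  assert (RInt f 1 2 <= l2) by (apply U2; exists 2; split; trivial; lra).
  assert (0 < RInt f 1 2).
  { apply RInt_gt_0; [lra| |]; intros t Ht; [apply Hp|apply Hc]; lra. }
  lra. }
apply (@is_RInt_gen_Chasles R_NormedModule) with 1.
- apply at_right_proper_filter.
- apply Rbar_locally_filter.
- intros P0 [eps HP].
  assert (N : exists a0, 0 < a0 <= 1 /\ l1 - eps < RInt f a0 1).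
  { destruct (Classical_Prop.classic (exists a0, 0 < a0 <= 1 /\ l1 - eps < RInt f a0 1)) as [H|H]; trivial.
    exfalso. assert (l1 <= l1 - eps); [|generalize (cond_pos eps); lra].
    apply L1. intros y [a [Hy ->]]. apply Rnot_lt_le. intros K. apply H. now exists a. }
  destruct N as [a0 [Ha0 HN]].
  exists (fun a => 0 < a < a0) (fun b => b = 1).
  + exists (mkposreal a0 (proj1 Ha0)). intros y Hy Hy0. split; trivial.
    change (Rabs (y - 0) < a0) in Hy. rewrite Rminus_0_r, Rabs_pos_eq in Hy; lra.
  + reflexivity.
  + intros a b Ha1 ->. exists (RInt f a 1). split.
    * apply (@RInt_correct R_CompleteNormedModule), Ex; simpl; lra.
    * apply HP. change (Rabs (RInt f a 1 - l1) < eps).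
      assert (RInt f a 1 <= l1) by (apply U1; exists a; split; trivial; lra).
      rewrite (Ch a a0 1) in * by lra. assert (0 <= RInt f a a0) by (apply P; lra).
      rewrite Rabs_left1; lra.
- intros P0 [eps HP].
  assert (N : exists b0, 1 <= b0 /\ l2 - eps < RInt f 1 b0).
  { destruct (Classical_Prop.classic (exists b0, 1 <= b0 /\ l2 - eps < RInt f 1 b0)) as [H|H]; trivial.
    exfalso. assert (l2 <= l2 - eps); [|generalize (cond_pos eps); lra].
    apply L2. intros y [a [Hy ->]]. apply Rnot_lt_le. intros K. apply H. now exists a. }
  destruct N as [b0 [Hb0 HN]].
  exists (fun a => a = 1) (fun b => b0 < b).
  + reflexivity.
  + exists b0. trivial.
  + intros a b -> Hb1. exists (RInt f 1 b). split.
    * apply (@RInt_correct R_CompleteNormedModule), Ex; simpl; lra.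
    * apply HP. change (Rabs (RInt f 1 b - l2) < eps).
      assert (RInt f 1 b <= l2) by (apply U2; exists b; split; trivial; lra).
      rewrite (Ch 1 b0 b) in * by lra. assert (0 <= RInt f b0 b) by (apply P; lra).
      rewrite Rabs_left1; lra.
Qed.

Lemma is_derive_Rpower x t : 0 < t -> is_derive (fun t => Rpower t x) t (x * Rpower t (x - 1)).
Proof.
intros Ht. apply is_derive_Reals. 
now apply derivable_pt_lim_power.
Qed.

Lemma continuous_Rpower x t : 0 < t -> continuous (fun t => Rpower t x) t.
Proof.
intros Ht. apply (@ex_derive_continuous R_AbsRing R_NormedModule).
eexists. now apply is_derive_Rpower.
Qed.

Lemma Rpower_pos t x : 0 < Rpower t x.
Proof. apply exp_pos. Qed.

Lemma Rpower_le_exp x : exists K, 0 < K /\ forall t, 1 <= t -> Rpower t x <= K * exp (t / 2).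
Proof.
destruct (Rle_dec x 0) as [Hx|Hx].
- exists 1. split; [lra|]. intros t Ht. assert (H0 : 0 < t) by lra. rewrite Rmult_1_l.
  unfold Rpower. assert (0 <= ln t) by (rewrite <- ln_1; apply ln_le; lra).
  assert (x * ln t <= t / 2) by nra.
  destruct H1; [left; now apply exp_increasing|right; now rewrite H1].
- apply Rnot_le_lt in Hx. exists (exp (x * ln (2 * x))). split. apply exp_pos.
  intros t Ht. assert (H0 : 0 < t) by lra. rewrite <- exp_plus. unfold Rpower.
  (* ln (t / 2x) <= t / 2x *)
  assert (L : ln (t / (2 * x)) <= t / (2 * x)).
  { assert (0 < t / (2 * x)) by (apply Rdiv_lt_0_compat; lra).
    generalize (exp_ineq1_le (ln (t / (2 * x)))). rewrite exp_ln by trivial. lra. }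
  rewrite ln_div in L by lra.
  assert (x * ln t <= x * ln (2 * x) + t / 2).
  { replace (t / 2) with (x * (t / (2 * x))) by (field; lra).
    rewrite <- Rmult_plus_distr_l. apply Rmult_le_compat_l; lra. }
  destruct H; [left; now apply exp_increasing|right; now rewrite H].
Qed.

(** Comparison with t^(x-1) on ]0, 1] and with a multiple of e^(-t/2) beyond 1. *)
Lemma Gamma_convergent x : 0 < x -> exists l, 0 < l /\
  is_RInt_gen (fun t => Rpower t (x - 1) * exp (- t)) (at_right 0) (Rbar_locally p_infty) l.
Proof.
intros Hx. destruct (Rpower_le_exp (x - 1)) as [K [HK0 HK]].
assert (Hc : forall t, 0 < t -> continuous (fun t => Rpower t (x - 1) * exp (- t)) t).
{ intros t Ht. apply (continuous_mult (fun t => Rpower t (x - 1)) (fun t => exp (- t))).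
  now apply continuous_Rpower.
  apply (@ex_derive_continuous R_AbsRing R_NormedModule). auto_derive. trivial. }
apply is_RInt_gen_pos_bounded with (/ x + 2 * K).
- intros t _. apply Rmult_lt_0_compat; apply exp_pos.
- exact Hc.
- intros a Ha.
  assert (I : is_RInt (fun t => Rpower t (x - 1)) a 1 (Rpower 1 x / x - Rpower a x / x)).
  { apply (@is_RInt_derive R_CompleteNormedModule (fun t => Rpower t x / x)).
    - rewrite Rmin_left, Rmax_right by lra. intros t Ht.
      apply is_derive_ext with (fun t => / x * Rpower t x). intros; unfold Rdiv; apply Rmult_comm.
      evar_last. apply is_derive_scal. apply is_derive_Rpower. lra.
      change (/ x * (x * Rpower t (x - 1)) = Rpower t (x - 1)). field; lra.
    - rewrite Rmin_left, Rmax_right by lra. intros t Ht. apply continuous_Rpower. lra. }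
  apply Rle_trans with (RInt (fun t => Rpower t (x - 1)) a 1).
  + apply RInt_le; [lra| |eexists; apply I|].
    * apply (@ex_RInt_continuous R_CompleteNormedModule).
      rewrite Rmin_left, Rmax_right by lra. intros t Ht. apply Hc. lra.
    * intros t Ht. rewrite <- (Rmult_1_r (Rpower t (x - 1))) at 2.
      apply Rmult_le_compat_l. left; apply exp_pos.
      rewrite <- exp_0. left. apply exp_increasing. lra.
  + rewrite (is_RInt_unique _ _ _ _ I). unfold Rpower at 1. rewrite ln_1, Rmult_0_r, exp_0.
    assert (0 < Rpower a x / x) by (apply Rdiv_lt_0_compat; [apply exp_pos|lra]).
    unfold Rdiv at 1. lra.
- intros b Hb.
  assert (I : is_RInt (fun t => K * exp (- t / 2)) 1 b ((-2 * K) * exp (- b / 2) - (-2 * K) * exp (- 1 / 2))).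
  { apply (@is_RInt_derive R_CompleteNormedModule (fun t => (-2 * K) * exp (- t / 2))).
    - intros t Ht. auto_derive; trivial. unfold Rdiv. field.
    - intros t Ht. apply (@ex_derive_continuous R_AbsRing R_NormedModule). auto_derive. trivial. }
  apply Rle_trans with (RInt (fun t => K * exp (- t / 2)) 1 b).
  + apply RInt_le; [lra| |eexists; apply I|].
    * apply (@ex_RInt_continuous R_CompleteNormedModule).
      rewrite Rmin_left, Rmax_right by lra. intros t Ht. apply Hc. lra.
    * intros t Ht. replace (K * exp (- t / 2)) with (K * exp (t / 2) * exp (- t)).
      apply Rmult_le_compat_r. left; apply exp_pos. apply HK; lra.
      rewrite Rmult_assoc, <- exp_plus. f_equal. f_equal. field.
  + rewrite (is_RInt_unique _ _ _ _ I).
    assert (0 < exp (- b / 2)) by apply exp_pos.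
    assert (exp (- 1 / 2) < 1) by (rewrite <- exp_0; apply exp_increasing; lra).
    assert (0 < / x) by (now apply Rinv_0_lt_compat).
    nra.
Qed.

Lemma is_RInt_gen_Gamma x : 0 < x ->
  is_RInt_gen (fun t => Rpower t (x - 1) * exp (- t)) (at_right 0) (Rbar_locally p_infty) (Gamma x).
Proof.
intros Hx. destruct (Gamma_convergent x Hx) as [l [_ H]].
unfold Gamma. now rewrite (is_RInt_gen_unique _ _ H).
Qed.

Lemma Gamma_pos x : 0 < x -> 0 < Gamma x.
Proof.
intros Hx. destruct (Gamma_convergent x Hx) as [l [Hl H]].
unfold Gamma. now rewrite (is_RInt_gen_unique _ _ H).
Qed.

(** Integration by parts, with antiderivative - t^x e^(-t) vanishing at both
    ends. *)
Lemma Gamma_succ x : 0 < x -> Gamma (x + 1) = x * Gamma x.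
Proof.
intros Hx.
set (h := fun t => - (Rpower t x * exp (- t))).
assert (Dh : forall t, 0 < t -> is_derive h t
   (Rpower t x * exp (- t) - x * (Rpower t (x - 1) * exp (- t)))).
{ intros t Ht. unfold h. evar_last.
  apply (@is_derive_opp R_AbsRing R_NormedModule).
  apply (is_derive_mult (fun t => Rpower t x) (fun t => exp (- t))).
  apply is_derive_Rpower; trivial. auto_derive; trivial.
  intros n m; exact (Rmult_comm n m). unfold opp, plus, mult; simpl. ring. }
assert (Pos : filter_prod (at_right 0) (Rbar_locally p_infty) (fun ab =>
   0 < fst ab /\ 0 < snd ab)).
{ exists (fun a => 0 < a) (fun b => 0 < b).
  - exists (mkposreal 1 Rlt_0_1). intros; trivial.
  - exists 0; trivial.
  - intros; split; trivial. }
assert (I : is_RInt_gen (Derive h) (at_right 0) (Rbar_locally p_infty) (0 - 0)).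
{ apply is_RInt_gen_Derive; try (apply filter_filter).
  - eapply filter_imp; [|apply Pos]. intros [a b] [Ha Hb] t [Ht _]. simpl in *.
    eexists. apply Dh. eapply Rlt_le_trans; [|apply Ht]. now apply Rmin_glb_lt.
  - eapply filter_imp; [|apply Pos]. intros [a b] [Ha Hb] t [Ht _]. simpl in *.
    assert (Ht0 : 0 < t) by (eapply Rlt_le_trans; [|apply Ht]; now apply Rmin_glb_lt).
    apply continuous_ext_loc with
      (fun t => Rpower t x * exp (- t) - x * (Rpower t (x - 1) * exp (- t))).
    + exists (mkposreal t Ht0). intros y Hy. symmetry. apply is_derive_unique, Dh.
      change (Rabs (y - t) < t) in Hy. apply Rabs_lt_between in Hy. lra.
    + assert (C : forall p, continuous (fun t => Rpower t p * exp (- t)) t).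
      { intros p. apply (continuous_mult (fun t => Rpower t p) (fun t => exp (- t))).
        now apply continuous_Rpower.
        apply (@ex_derive_continuous R_AbsRing R_NormedModule). auto_derive. trivial. }
      apply (@continuous_minus R_UniformSpace R_AbsRing R_NormedModule). apply C.
      apply (@continuous_scal_r R_UniformSpace R_AbsRing R_NormedModule x), C.
  - (* |h t| <= t^x near 0 *)
    apply filterlim_locally. intros eps.
    assert (Hd : 0 < Rpower eps (/ x)) by apply exp_pos.
    exists (mkposreal _ Hd). intros t Ht Ht0.
    change (Rabs (t - 0) < Rpower eps (/ x)) in Ht. rewrite Rminus_0_r, Rabs_pos_eq in Ht by lra.
    change (Rabs (h t - 0) < eps). unfold h. rewrite Rminus_0_r, Rabs_Ropp.
    rewrite Rabs_pos_eq by (left; apply Rmult_lt_0_compat; apply exp_pos).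
    assert (E1 : Rpower t x < eps).
    { rewrite <- (Rpower_1 eps) by apply eps. 
      replace 1 with (/ x * x) by (field; lra). rewrite <- Rpower_mult.
      apply Rlt_Rpower_l; [trivial|now split]. }
    assert (E2 : exp (- t) < 1) by (rewrite <- exp_0; apply exp_increasing; lra).
    assert (E3 := Rpower_pos t x). assert (E4 := exp_pos (- t)). nra.
  - destruct (Rpower_le_exp x) as [K [HK0 HK]].
    apply filterlim_locally. intros eps.
    (* K e^(-t/2) < eps as soon as t > 2 K / eps *)
    exists (Rmax 1 (2 * K / eps)). intros t Ht.
    assert (Ht1 : 1 < t) by (eapply Rle_lt_trans; [apply Rmax_l|apply Ht]).
    assert (Ht2 : 2 * K / eps < t) by (eapply Rle_lt_trans; [apply Rmax_r|apply Ht]).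
    change (Rabs (h t - 0) < eps). unfold h. rewrite Rminus_0_r, Rabs_Ropp.
    rewrite Rabs_pos_eq by (left; apply Rmult_lt_0_compat; apply exp_pos).
    apply Rle_lt_trans with (K * exp (t / 2) * exp (- t)).
    { apply Rmult_le_compat_r. left; apply exp_pos. apply HK; lra. }
    rewrite Rmult_assoc, <- exp_plus. replace (t / 2 + - t) with (- (t / 2)) by field.
    rewrite exp_Ropp. apply Rlt_div_l. apply exp_pos.
    apply Rlt_div_l in Ht2; [|apply eps].
    generalize (exp_ineq1_le (t / 2)) (cond_pos eps). nra. }
assert (G : is_RInt_gen (fun t => Rpower t (x + 1 - 1) * exp (- t))
   (at_right 0) (Rbar_locally p_infty) (x * Gamma x + (0 - 0))).
{ eapply is_RInt_gen_ext.
  2:{ apply (@is_RInt_gen_plus R_NormedModule). 1, 2: apply filter_filter.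
      apply (@is_RInt_gen_scal R_NormedModule). 1, 2: apply filter_filter.
      now apply is_RInt_gen_Gamma. apply I. }
  eapply filter_imp; [|apply Pos]. intros [a b] [Ha Hb] t [Ht _]. simpl in *.
  assert (Ht0 : 0 < t) by (eapply Rlt_trans; [|apply Ht]; now apply Rmin_glb_lt).
  rewrite (is_derive_unique _ _ _ (Dh t Ht0)). unfold plus, scal; simpl. unfold mult; simpl.
  replace (x + 1 - 1) with x by ring. ring. }
unfold Gamma at 1. rewrite (is_RInt_gen_unique _ _ G). ring.
Qed.

(** * Estimates for the product series *)

Lemma geometric_half (d : nat -> R) n : (forall n, d (S n) <= d n / 2) ->
  d n <= d O * (/ 2) ^ n.
Proof.
intros H. induction n as [|n IH]; [simpl; lra|].
eapply Rle_trans. apply H. simpl. lra.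
Qed.

Lemma halving_summable (d : nat -> R) : (forall n, 0 <= d n) -> (forall n, d (S n) <= d n / 2) ->
  ex_series d /\ Series d <= 2 * d O.
Proof.
intros H0 H.
assert (G : ex_series (fun n => d O * (/ 2) ^ n)).
{ apply ex_series_scal_R, ex_series_geom. rewrite Rabs_pos_eq; lra. }
assert (B : forall n, 0 <= d n <= d O * (/ 2) ^ n) by (split; auto using geometric_half).
split.
- apply ex_series_Rle with (2 := G). intros n. rewrite Rabs_pos_eq; apply B.
- eapply Rle_trans. apply Series_le with (2 := G); trivial.
  rewrite Series_scal_l, Series_geom by (rewrite Rabs_pos_eq; lra). lra.
Qed.

Lemma twist_abs d n : Rabs (twist d n) = Rabs (d n).
Proof. unfold twist. rewrite Rabs_mult, pow_1_abs. ring. Qed.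

Lemma twist_series_incr d : ex_series (fun n => Rabs (d n)) ->
  Series (twist d) = d O - Series (twist (fun n => d (S n))).
Proof.
intros H. rewrite Series_incr_1.
- rewrite (Series_ext (fun k => twist d (S k)) (fun k => -1 * twist (fun n => d (S n)) k)).
  rewrite Series_scal_l. unfold twist at 1. simpl. ring.
  intros n. unfold twist. simpl. ring.
- apply ex_series_Rabs. eapply ex_series_ext; [|apply H].
  intros; now rewrite twist_abs.
Qed.

(** A ratio at most 1/2 makes the tail after any term no larger than that term,
    which is all that the usual pairing of terms needs. *)
Lemma alternating_bounds (d : nat -> R) : (forall n, 0 <= d n) ->
  (forall n, d (S n) <= d n / 2) -> d O - d 1%nat <= Series (twist d) <= d O.
Proof.
assert (P : forall d, (forall n, 0 <= d n) -> (forall n, d (S n) <= d n / 2) ->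
  ex_series (fun n => Rabs (d n)) /\ 0 <= Series (twist d)).
{ clear. intros d H0 H. 
  assert (A : ex_series (fun n => Rabs (d n))).
  { eapply ex_series_ext; [|apply (halving_summable d H0 H)].
    intros n; now rewrite Rabs_pos_eq. }
  split; trivial.
  rewrite twist_series_incr by trivial.
  destruct (halving_summable (fun n => d (S n)) (fun n => H0 (S n)) (fun n => H (S n))) as [E L].
  assert (Rabs (Series (twist (fun n => d (S n)))) <= Series (fun n => d (S n))).
  { rewrite (Series_ext (fun n => d (S n)) (fun n => Rabs (twist (fun n => d (S n)) n)))
      by (intros; rewrite twist_abs, Rabs_pos_eq; auto).
    apply Series_Rabs. eapply ex_series_ext; [|apply E].
    intros; rewrite twist_abs, Rabs_pos_eq; auto. }
  generalize (Rle_abs (Series (twist (fun n => d (S n))))) (H O). lra. }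
intros H0 H. destruct (P d H0 H) as [A A1].
destruct (P (fun n => d (S n)) (fun n => H0 (S n)) (fun n => H (S n))) as [B B1].
destruct (P (fun n => d (S (S n))) (fun n => H0 (S (S n))) (fun n => H (S (S n)))) as [C C1].
rewrite twist_series_incr by trivial. split; [|lra].
rewrite twist_series_incr by trivial. lra.
Qed.

Definition Pratio (nu : R) (k : nat) : R :=
  / (16 * INR (S k) * (nu + INR (S k)) * (nu + INR (2 * k + 1)) * (nu + INR (2 * k + 2))).

Lemma Pabs_S nu k : Pabs nu (S k) = Pabs nu k * Pratio nu k.
Proof. reflexivity. Qed.

Lemma Pratio_eq nu k : Pratio nu k =
  / (16 * (INR k + 1) * (nu + (INR k + 1)) * (nu + 2 * INR k + 1) * (nu + 2 * INR k + 2)).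
Proof.
unfold Pratio. rewrite S_INR, !plus_INR, mult_INR. simpl INR. f_equal. ring.
Qed.

Lemma Pabs_1 nu : Pabs nu 1 = / (16 * (nu + 1) ^ 2 * (nu + 2)).
Proof.
rewrite Pabs_S, Pratio_eq. simpl. rewrite Rmult_1_l. f_equal. ring.
Qed.

Lemma Pratio_pos nu k : -1 < nu -> 0 < Pratio nu k.
Proof.
intros H. rewrite Pratio_eq. apply Rinv_0_lt_compat. generalize (pos_INR k). intros.
repeat apply Rmult_lt_0_compat; lra.
Qed.

Lemma Pratio_small nu k : -1 < nu -> Pratio nu (S k) <= / 192.
Proof.
intros H. rewrite Pratio_eq, S_INR. assert (Hk := pos_INR k).
apply Rinv_le_contravar; [lra|].
set (a := INR k) in *.
assert (H1 : 2 <= a + 1 + 1) by lra.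
assert (H2 : 1 <= nu + (a + 1 + 1)) by lra.
assert (H3 : 2 <= nu + 2 * (a + 1) + 1) by lra.
assert (H4 : 3 <= nu + 2 * (a + 1) + 2) by lra.
assert (2 * 1 <= (a + 1 + 1) * (nu + (a + 1 + 1))) by (apply Rmult_le_compat; lra).
assert (2 * 1 * 2 <= (a + 1 + 1) * (nu + (a + 1 + 1)) * (nu + 2 * (a + 1) + 1))
  by (apply Rmult_le_compat; lra).
assert (2 * 1 * 2 * 3 <= (a + 1 + 1) * (nu + (a + 1 + 1)) * (nu + 2 * (a + 1) + 1)
   * (nu + 2 * (a + 1) + 2)) by (apply Rmult_le_compat; lra).
lra.
Qed.

Lemma Pabs_ratio nu n : -1 < nu -> Pabs nu (S (S n)) <= Pabs nu (S n) / 192.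
Proof.
intros H. rewrite (Pabs_S nu (S n)). unfold Rdiv. apply Rmult_le_compat_l.
left; now apply Pabs_pos. now apply Pratio_small.
Qed.

Lemma Pcoef_rapid nu : -1 < nu -> rapid (Pcoef nu).
Proof.
intros H. apply rapid_unshift.
apply rapid_geometric with (Pabs nu 1) (/ 2). lra.
intros n. unfold Pcoef. rewrite twist_abs, Rabs_pos_eq by (left; now apply Pabs_pos).
apply (geometric_half (fun n => Pabs nu (S n))). intros k.
generalize (Pabs_ratio nu k H) (Pabs_pos nu H (S k)). lra.
Qed.

(** phi(1) and phi'(1), for phi(w) the product series in w = z^4. *)
Definition Phi0 (nu : R) : R := Series (Pcoef nu).
Definition Phi1 (nu : R) : R := Series (theta (Pcoef nu)).

Lemma Phi0_eq nu : -1 < nu -> Phi0 nu = 1 - Series (twist (fun n => Pabs nu (S n))).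
Proof.
intros H. unfold Phi0, Pcoef. rewrite twist_series_incr; [reflexivity|].
eapply ex_series_ext; [|apply rapid_abs, (Pcoef_rapid nu H)].
intros; apply twist_abs.
Qed.

Lemma Phi1_eq nu : -1 < nu ->
  Phi1 nu = - Series (twist (fun n => INR (S n) * Pabs nu (S n))).
Proof.
intros H. unfold Phi1.
rewrite (Series_ext _ (twist (theta (Pabs nu)))) by
  (intros; unfold theta, Pcoef, twist; ring).
rewrite twist_series_incr.
- unfold theta. simpl (INR 0). ring.
- eapply ex_series_ext; [|apply rapid_abs, rapid_INR, (Pcoef_rapid nu H)].
  intros n. unfold theta, Pcoef. rewrite !Rabs_mult, twist_abs. reflexivity.
Qed.

Lemma weighted_halving (d : nat -> R) : (forall n, 0 <= d n) -> (forall n, d (S n) <= d n / 96) ->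
  forall n, INR (S (S n)) * d (S n) <= INR (S n) * d n / 2.
Proof.
intros H0 H n. rewrite !S_INR. generalize (pos_INR n) (H0 n) (H n). intros.
assert (INR n * d (S n) <= INR n * (d n / 96)) by (apply Rmult_le_compat_l; lra).
nra.
Qed.

Lemma Phi_bounds nu : -1 < nu ->
  1 - Pabs nu 1 <= Phi0 nu <= 1 - Pabs nu 1 + Pabs nu 2 /\
  - Pabs nu 1 <= Phi1 nu <= - Pabs nu 1 + 2 * Pabs nu 2.
Proof.
intros H. rewrite Phi0_eq, Phi1_eq by trivial.
assert (P := fun n => Rlt_le _ _ (Pabs_pos nu H (S n))).
assert (R96 : forall n, Pabs nu (S (S n)) <= Pabs nu (S n) / 96).
{ intros n. generalize (Pabs_ratio nu n H) (P n). lra. }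
destruct (alternating_bounds (fun n => Pabs nu (S n))); trivial.
{ intros n. generalize (R96 n) (P n). lra. }
destruct (alternating_bounds (fun n => INR (S n) * Pabs nu (S n))).
{ intros n. apply Rmult_le_pos; auto using pos_INR. }
{ intros n. apply (weighted_halving (fun n => Pabs nu (S n))); trivial. }
simpl INR in *. lra.
Qed.

(** * Monotonicity in the order *)

Lemma shift_quotient_decreasing x y d : 0 < x -> x <= y -> 0 <= d ->
  0 <= (y + d) / y <= (x + d) / x.
Proof.
intros Hx Hy Hd. split. apply Rdiv_le_0_compat; lra.
replace ((y + d) / y) with (1 + d * / y) by (field; lra).
replace ((x + d) / x) with (1 + d * / x) by (field; lra).
apply Rplus_le_compat_l, Rmult_le_compat_l; trivial. now apply Rinv_le_contravar.
Qed.

Lemma Pratio_quotient nu k : -1 < nu -> Pratio nu k / Pratio nu (S k) =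
  (INR k + 2) / (INR k + 1) *
  (((nu + INR k + 1 + 1) / (nu + INR k + 1)) *
  (((nu + 2 * INR k + 1 + 2) / (nu + 2 * INR k + 1)) *
   ((nu + 2 * INR k + 2 + 2) / (nu + 2 * INR k + 2)))).
Proof.
intros H. rewrite !Pratio_eq, S_INR. assert (Hk := pos_INR k).
field. repeat split; lra.
Qed.

Lemma Pratio_decreasing nu nu' k : -1 < nu -> nu < nu' -> Pratio nu' k < Pratio nu k.
Proof.
intros H H'. rewrite !Pratio_eq. assert (Hk := pos_INR k).
apply Rinv_lt_contravar.
- repeat apply Rmult_lt_0_compat; lra.
- apply Rmult_le_0_lt_compat; try lra. repeat apply Rmult_le_pos; lra.
  apply Rmult_le_0_lt_compat; try lra. repeat apply Rmult_le_pos; lra.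
  apply Rmult_lt_compat_l; lra.
Qed.

(** The second part expresses that c_n / r_n decreases with the order, r_n being
    the quotient of the coefficients c_(n+1) and c_n. *)
Lemma Pabs_decreasing nu nu' n : -1 < nu -> nu < nu' ->
  Pabs nu' (S n) < Pabs nu (S n) /\
  Pabs nu' (S n) / Pratio nu' (S n) <= Pabs nu (S n) / Pratio nu (S n).
Proof.
intros H H'. assert (H1 : -1 < nu') by lra.
assert (D : forall n, Pabs nu' n <= Pabs nu n).
{ clear n. induction n as [|n IH]. simpl; lra. rewrite !Pabs_S.
  apply Rmult_le_compat; trivial; try (left; now apply Pabs_pos).
  left; now apply Pratio_pos. left; now apply Pratio_decreasing. }
split.
- rewrite !Pabs_S. apply Rle_lt_trans with (Pabs nu n * Pratio nu' n).
  apply Rmult_le_compat_r; trivial. left; now apply Pratio_pos.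
  apply Rmult_lt_compat_l. now apply Pabs_pos. now apply Pratio_decreasing.
- rewrite !Pabs_S. unfold Rdiv. rewrite !Rmult_assoc.
  fold (Pratio nu n / Pratio nu (S n)). fold (Pratio nu' n / Pratio nu' (S n)).
  rewrite !Pratio_quotient by trivial. assert (Hk := pos_INR n).
  assert (Q0 : 0 <= (INR n + 2) / (INR n + 1)) by (apply Rdiv_le_0_compat; lra).
  destruct (shift_quotient_decreasing (nu + INR n + 1) (nu' + INR n + 1) 1) as [A1 B1]; try lra.
  revert A1 B1. generalize ((nu + INR n + 1 + 1) / (nu + INR n + 1)),
    ((nu' + INR n + 1 + 1) / (nu' + INR n + 1)). intros x1 y1 A1 B1.
  destruct (shift_quotient_decreasing (nu + 2 * INR n + 1) (nu' + 2 * INR n + 1) 2) as [A2 B2]; try lra.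
  revert A2 B2. generalize ((nu + 2 * INR n + 1 + 2) / (nu + 2 * INR n + 1)),
    ((nu' + 2 * INR n + 1 + 2) / (nu' + 2 * INR n + 1)). intros x2 y2 A2 B2.
  destruct (shift_quotient_decreasing (nu + 2 * INR n + 2) (nu' + 2 * INR n + 2) 2) as [A3 B3]; try lra.
  revert A3 B3. generalize ((nu + 2 * INR n + 2 + 2) / (nu + 2 * INR n + 2)),
    ((nu' + 2 * INR n + 2 + 2) / (nu' + 2 * INR n + 2)). intros x3 y3 A3 B3.
  revert Q0. generalize ((INR n + 2) / (INR n + 1)). intros q Q0.
  assert (N := Rlt_le _ _ (Pabs_pos nu' H1 n)).
  repeat apply Rmult_le_compat; try apply Rle_refl; trivial;
    repeat (apply Rmult_le_pos; trivial); try tauto.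
Qed.

(** The decrease of the n-th coefficient between two orders again drops
    geometrically with n.  With c = c_n, r = c_(n+1) / c_n and a prime for the
    larger order, c r - c' r' <= 2 r (c - c'): indeed c' / c <= r' / r. *)
Lemma Pabs_difference_ratio nu nu' n : -1 < nu -> nu < nu' ->
  Pabs nu (S (S n)) - Pabs nu' (S (S n)) <= (Pabs nu (S n) - Pabs nu' (S n)) / 96.
Proof.
intros H H'. assert (H1 : -1 < nu') by lra.
destruct (Pabs_decreasing nu nu' n H H') as [D E].
rewrite (Pabs_S nu (S n)), (Pabs_S nu' (S n)).
assert (R0 := Pratio_pos nu (S n) H). assert (R1 := Pratio_pos nu' (S n) H1).
assert (RS := Pratio_small nu n H).
assert (C0 := Pabs_pos nu H (S n)). assert (C1 := Pabs_pos nu' H1 (S n)).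
set (c := Pabs nu (S n)) in *. set (c' := Pabs nu' (S n)) in *.
set (r := Pratio nu (S n)) in *. set (r' := Pratio nu' (S n)) in *.
assert (X : c' * r <= c * r').
{ apply Rmult_le_reg_r with (/ (r * r')).
  apply Rinv_0_lt_compat, Rmult_lt_0_compat; trivial.
  replace (c' * r * / (r * r')) with (c' / r') by (field; lra).
  replace (c * r' * / (r * r')) with (c / r) by (field; lra). exact E. }
(* c' (r - r') <= c' r (1 - c'/c) <= r (c - c') *)
assert (Y : c * (c' * (r - r')) <= c * (r * (c - c'))).
{ assert (X1 := Rmult_le_compat_l c' _ _ (Rlt_le _ _ C1) X).
  assert (X2 : (c' * r) * (c - c') <= (c * r) * (c - c')).
  { apply Rmult_le_compat_r; [lra|]. apply Rmult_le_compat_r; lra. }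
  lra. }
apply Rmult_le_reg_l in Y; trivial.
assert (r * (c - c') <= / 192 * (c - c')) by (apply Rmult_le_compat_r; lra).
lra.
Qed.

(** Both differences are alternating series in the decreases of the coefficients,
    so they have the sign of, and are bounded by, the first decrease; the upper
    bounds yield continuity in the order. *)
Lemma Phi_increasing nu nu' : -1 < nu -> nu < nu' ->
  0 < Phi0 nu' - Phi0 nu <= Pabs nu 1 - Pabs nu' 1 /\
  0 < Phi1 nu' - Phi1 nu <= Pabs nu 1 - Pabs nu' 1.
Proof.
intros H H'. assert (H1 : -1 < nu') by lra.
rewrite !Phi0_eq, !Phi1_eq by trivial.
set (D := fun n => Pabs nu (S n) - Pabs nu' (S n)).
assert (D0 : forall n, 0 < D n) by (intros n; unfold D; generalize (Pabs_decreasing nu nu' n H H'); lra).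
assert (D1 : forall n, D (S n) <= D n / 96) by (intros; now apply Pabs_difference_ratio).
assert (Ex : forall mu, -1 < mu -> ex_series (twist (fun n => Pabs mu (S n))) /\
   ex_series (twist (fun n => INR (S n) * Pabs mu (S n)))).
{ intros mu Hmu. split; apply ex_series_Rabs.
  - eapply ex_series_ext; [|apply rapid_abs, rapid_shift, (Pcoef_rapid mu Hmu)].
    intros n. unfold Pcoef. simpl. now rewrite !twist_abs.
  - eapply ex_series_ext; [|apply rapid_abs, rapid_derive, (Pcoef_rapid mu Hmu)].
    intros n. unfold PS_derive, Pcoef. rewrite Rabs_mult, !twist_abs, Rabs_mult. reflexivity. }
assert (S1 : Series (twist D) = Series (twist (fun n => Pabs nu (S n)))
    - Series (twist (fun n => Pabs nu' (S n)))).
{ rewrite <- Series_minus by (apply Ex; trivial). apply Series_ext. intros; unfold twist, D; ring. }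
assert (S2 : Series (twist (fun n => INR (S n) * D n))
   = Series (twist (fun n => INR (S n) * Pabs nu (S n)))
    - Series (twist (fun n => INR (S n) * Pabs nu' (S n)))).
{ rewrite <- Series_minus by (apply Ex; trivial). apply Series_ext. intros; unfold twist, D; ring. }
destruct (alternating_bounds D).
{ intros; left; trivial. } { intros n. generalize (D1 n) (D0 n). lra. }
destruct (alternating_bounds (fun n => INR (S n) * D n)).
{ intros; apply Rmult_le_pos. apply pos_INR. left; trivial. }
{ apply weighted_halving; trivial. intros; left; trivial. }
simpl INR in *. generalize (D1 O) (D0 O). fold (D O). lra.
Qed.

Lemma continuity_pt_Pabs_1 nu : -1 < nu -> continuity_pt (fun nu => Pabs nu 1) nu.
Proof.
intros H. apply continuity_pt_filterlim.
apply (@ex_derive_continuous R_AbsRing R_NormedModule).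
unfold Pabs. simpl. auto_derive. repeat split; trivial. apply Rgt_not_eq. 
repeat apply Rmult_lt_0_compat; lra.
Qed.

Lemma continuity_dominated (f g : R -> R) x : -1 < x -> continuity_pt g x ->
  (forall y z, -1 < y -> y < z -> 0 < f z - f y <= g y - g z) -> continuity_pt f x.
Proof.
intros Hx Hg H eps Heps. destruct (Hg eps Heps) as [d [Hd K]].
exists (Rmin d (x + 1)). split. apply Rmin_pos; lra.
intros y [Dy Hy]. simpl in Hy. unfold Rdist in Hy.
assert (Hy1 : Rabs (y - x) < d) by (eapply Rlt_le_trans; [apply Hy|apply Rmin_l]).
assert (Hy2 : Rabs (y - x) < x + 1) by (eapply Rlt_le_trans; [apply Hy|apply Rmin_r]).
apply Rabs_lt_between in Hy2.
eapply Rle_lt_trans; [|apply (K y); split; trivial]. simpl. unfold Rdist.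
destruct (Rtotal_order x y) as [L|[->|L]].
- generalize (H x y Hx L). intros. rewrite Rabs_pos_eq, Rabs_left1; lra.
- rewrite !Rminus_diag, Rabs_R0. lra.
- generalize (H y x ltac:(lra) L). intros. rewrite Rabs_left1, Rabs_pos_eq; lra.
Qed.

Lemma continuity_pt_Phi0 nu : -1 < nu -> continuity_pt Phi0 nu.
Proof.
intros H. apply (continuity_dominated Phi0 (fun nu => Pabs nu 1)); trivial.
now apply continuity_pt_Pabs_1. intros. now apply Phi_increasing.
Qed.

Lemma continuity_pt_Phi1 nu : -1 < nu -> continuity_pt Phi1 nu.
Proof.
intros H. apply (continuity_dominated Phi1 (fun nu => Pabs nu 1)); trivial.
now apply continuity_pt_Pabs_1. intros. now apply Phi_increasing.
Qed.

(** * Roots of the defining equations *)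

(** A positive multiple of the left-hand side of the equation, namely
    c phi(1) + 4 phi'(1). *)
Definition char_fun (c nu : R) : R := c * Phi0 nu + 4 * Phi1 nu.

Lemma char_fun_increasing c nu nu' : 0 <= c -> -1 < nu -> nu < nu' ->
  char_fun c nu < char_fun c nu'.
Proof.
intros Hc H H'. destruct (Phi_increasing nu nu' H H') as [A B]. unfold char_fun. nra.
Qed.

Lemma char_fun_bounds c nu : 0 <= c -> -1 < nu ->
  c - (c + 4) * Pabs nu 1 <= char_fun c nu <= c - (c + 4) * Pabs nu 1 + (c + 8) * Pabs nu 2.
Proof.
intros Hc H. destruct (Phi_bounds nu H) as [[A A'] [B B']]. unfold char_fun. split; nra.
Qed.

Lemma Pabs_1_bound_above nu b : -1 < nu -> 0 < b -> / b <= 16 * (nu + 1) ^ 2 * (nu + 2) ->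
  Pabs nu 1 <= b.
Proof.
intros H Hb E. rewrite Pabs_1, <- (Rinv_inv b). apply Rinv_le_contravar; trivial.
now apply Rinv_0_lt_compat.
Qed.

Lemma Pabs_1_bound_below nu b : -1 < nu -> 0 < b -> 16 * (nu + 1) ^ 2 * (nu + 2) <= / b ->
  b <= Pabs nu 1.
Proof.
intros H Hb E. rewrite Pabs_1, <- (Rinv_inv b). apply Rinv_le_contravar; trivial.
apply Rmult_lt_0_compat; nra.
Qed.

(** Thus every root lies to the right of -7/10, where the first coefficient is
    small enough for [even_Rayleigh_rapid]. *)
Lemma char_fun_neg_7_10 c : 0 < c <= 4 -> char_fun c (- (7 / 10)) < 0.
Proof.
intros Hc. 
assert (A : 53 / 100 <= Pabs (- (7 / 10)) 1) by (apply Pabs_1_bound_below; lra).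
assert (A' : Pabs (- (7 / 10)) 1 <= 54 / 100) by (apply Pabs_1_bound_above; lra).
assert (B := Pabs_ratio (- (7 / 10)) 0 ltac:(lra)).
destruct (char_fun_bounds c (- (7 / 10))); try lra. nra.
Qed.

Lemma char_fun_root c : 0 < c <= 4 -> exists nu, - (7 / 10) < nu /\ char_fun c nu = 0.
Proof.
intros Hc.
set (N := 4 / c).
assert (HN : 1 <= N) by (unfold N; apply Rle_div_r; lra).
assert (HN2 : c * N = 4) by (unfold N; field; lra).
assert (P : 0 < char_fun c N).
{ destruct (char_fun_bounds c N); try lra.
  assert (Pabs N 1 <= c / 100).
  { apply Pabs_1_bound_above; try lra.
    replace (/ (c / 100)) with (25 * N) by (unfold N; field; lra). nra. }
  nra. }
assert (Q := char_fun_neg_7_10 c Hc).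
destruct (IVT_interv (char_fun c) (- (7 / 10)) N) as [z [Hz E]]; try lra.
{ intros a Ha. unfold char_fun. apply continuity_pt_plus.
  apply continuity_pt_scal, continuity_pt_Phi0; lra.
  apply continuity_pt_scal, continuity_pt_Phi1; lra. }
exists z. split; trivial. destruct (proj1 Hz) as [L|L]; trivial. subst z. lra.
Qed.

(** The factor c = 2 nu b is nonpositive and at least -2 here: phi'(1) < 0 decides
    when phi(1) >= 0, and outweighs c phi(1) <= - 2 phi(1) otherwise. *)
Lemma char_fun_u_neg b nu : 0 < b <= 1 -> -1 < nu <= 0 -> char_fun (2 * nu * b) nu < 0.
Proof.
intros Hb H. destruct (Phi_bounds nu) as [[A A'] [B B']]; try lra.
assert (C := Pabs_ratio nu 0 ltac:(lra)). assert (C0 := Pabs_pos nu ltac:(lra) 1).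
unfold char_fun.
destruct (Rle_dec 0 (Phi0 nu)).
- assert (0 <= (- nu * b) * Phi0 nu) by (repeat apply Rmult_le_pos; lra). nra.
- assert ((- nu * b) * (- Phi0 nu) <= 1 * (- Phi0 nu)) by (apply Rmult_le_compat_r; nra). nra.
Qed.

Lemma Pabs_1_small nu : 0 <= nu -> 0 < Pabs nu 1 <= / 32.
Proof.
intros H. split. apply Pabs_pos; lra. apply Pabs_1_bound_above; try lra. rewrite Rinv_inv. nra.
Qed.

(** After division by nu, the factor of phi(1) is constant, and phi'(1) / nu
    increases since phi'(1) is negative and increasing. *)
Lemma char_fun_u_increasing b nu nu' : 0 < b -> 0 < nu -> nu < nu' ->
  char_fun (2 * nu * b) nu / nu < char_fun (2 * nu' * b) nu' / nu'.
Proof.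
intros Hb H H'. destruct (Phi_increasing nu nu') as [A B]; try lra.
destruct (Phi_bounds nu' ltac:(lra)) as [_ [_ C]].
assert (C1 := Pabs_ratio nu' 0 ltac:(lra)). assert (C0 := Pabs_1_small nu' ltac:(lra)).
unfold char_fun.
replace ((2 * nu * b * Phi0 nu + 4 * Phi1 nu) / nu)
  with (2 * b * Phi0 nu + 4 * (Phi1 nu / nu)) by (field; lra).
replace ((2 * nu' * b * Phi0 nu' + 4 * Phi1 nu') / nu')
  with (2 * b * Phi0 nu' + 4 * (Phi1 nu' / nu')) by (field; lra).
assert (Phi1 nu / nu < Phi1 nu' / nu').
{ apply Rlt_div_l; trivial. replace (Phi1 nu' / nu' * nu) with (Phi1 nu' * (nu / nu')) by (field; lra).
  assert (nu / nu' < 1) by (apply Rlt_div_l; lra). nra. }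
nra.
Qed.

Lemma char_fun_u_root b : 0 < b <= 1 -> exists nu, 5 / 100 <= nu /\ char_fun (2 * nu * b) nu = 0.
Proof.
intros Hb.
assert (Q : char_fun (2 * (5 / 100) * b) (5 / 100) < 0).
{ destruct (char_fun_bounds (2 * (5 / 100) * b) (5 / 100)); try lra.
  assert (27 / 1000 <= Pabs (5 / 100) 1) by (apply Pabs_1_bound_below; lra).
  assert (B := Pabs_ratio (5 / 100) 0 ltac:(lra)). assert (C := Pabs_1_small (5 / 100) ltac:(lra)). nra. }
assert (Hb1 : 1 <= / b) by (rewrite <- Rinv_1; apply Rinv_le_contravar; lra).
assert (P : 0 < char_fun (2 * / b * b) (/ b)).
{ replace (2 * / b * b) with 2 by (field; lra).
  destruct (char_fun_bounds 2 (/ b)); try lra. generalize (Pabs_1_small (/ b)). lra. }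
destruct (IVT_interv (fun nu => char_fun (2 * nu * b) nu) (5 / 100) (/ b)) as [z [Hz E]]; try lra.
{ intros a Ha. unfold char_fun. apply continuity_pt_plus.
  apply (continuity_pt_mult (fun nu => 2 * nu * b)).
  apply derivable_continuous_pt. reg.
  apply continuity_pt_Phi0; lra.
  apply continuity_pt_scal, continuity_pt_Phi1; lra. }
exists z. split; trivial. apply Hz.
Qed.

Lemma char_fun_u_unique b nu nu' : 0 < b <= 1 -> -1 < nu -> -1 < nu' ->
  char_fun (2 * nu * b) nu = 0 -> char_fun (2 * nu' * b) nu' = 0 -> nu = nu'.
Proof.
intros Hb H H' E E'.
assert (0 < nu) by (apply Rnot_le_lt; intros K; generalize (char_fun_u_neg b nu Hb); lra).
assert (0 < nu') by (apply Rnot_le_lt; intros K; generalize (char_fun_u_neg b nu' Hb); lra).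
destruct (Rtotal_order nu nu') as [L|[L|L]]; trivial; exfalso.
- generalize (char_fun_u_increasing b nu nu'). rewrite E, E'. unfold Rdiv. lra.
- generalize (char_fun_u_increasing b nu' nu). rewrite E, E'. unfold Rdiv. lra.
Qed.

(** * Convergence of the even Rayleigh sums *)

(** If c_n are the moduli of the coefficients of phi and c_1 <= 11/20, then
    c_1 / r + c_2 / r^2 + ... < 1 for r = 3/4, so that solving the relation of
    [even_Rayleigh] for its last term keeps s_n below a multiple of r^n. *)
Lemma even_Rayleigh_rapid nu (s : nat -> R) : -1 < nu -> Pabs nu 1 <= 11 / 20 ->
  (forall n, 0 <= s n) ->
  (forall n, PS_mult s (Pcoef nu) n = - PS_derive (Pcoef nu) n) -> rapid s.
Proof.
intros H H1 Hs E.
assert (P := Pabs_pos nu H).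
set (r := 3 / 4).
assert (Tb : forall m, sum_f_R0 (fun j => r ^ j * Pabs nu (S m - j)) m <= 3 / 4 * r ^ S m).
{ induction m as [|m IH].
  - simpl sum_f_R0. unfold r. simpl in *. lra.
  - rewrite tech5. replace (S (S m) - S m)%nat with 1%nat by lia.
    assert (sum_f_R0 (fun j => r ^ j * Pabs nu (S (S m) - j)) m
      <= / 96 * sum_f_R0 (fun j => r ^ j * Pabs nu (S m - j)) m).
    { rewrite scal_sum. apply sum_Rle. intros j Hj.
      replace (S (S m) - j)%nat with (S (S (m - j))) by lia.
      replace (S m - j)%nat with (S (m - j)) by lia.
      rewrite Rmult_assoc. apply Rmult_le_compat_l. apply pow_le; unfold r; lra.
      generalize (Pabs_ratio nu (m - j) H) (P (S (m - j))). lra. }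
    assert (0 < r ^ S m) by (apply pow_lt; unfold r; lra).
    assert (r ^ S m * Pabs nu 1 <= r ^ S m * (11 / 20)) by (apply Rmult_le_compat_l; lra).
    replace (r ^ S (S m)) with (3 / 4 * r ^ S m) by reflexivity. lra. }
assert (Cb : forall m, INR (S m) * Pabs nu (S m) <= 11 / 20 * r ^ m).
{ induction m as [|m IH]. simpl in *; lra.
  assert (INR (S (S m)) * Pabs nu (S (S m)) <= INR (S m) * Pabs nu (S m) / 2).
  { apply (weighted_halving (fun n => Pabs nu (S n))). intros; left; apply P.
    intros n. generalize (Pabs_ratio nu n H) (P (S n)). lra. }
  replace (r ^ S m) with (3 / 4 * r ^ m) by reflexivity.
  assert (0 < r ^ m) by (apply pow_lt; unfold r; lra). lra. }
assert (Sb : forall m, s m <= 3 * r ^ m).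
{ induction m as [m IH] using (well_founded_induction Wf_nat.lt_wf).
  assert (Em := E m).
  assert (Pd : Rabs (PS_derive (Pcoef nu) m) <= 11 / 20 * r ^ m).
  { unfold PS_derive, Pcoef. rewrite Rabs_mult, twist_abs, !Rabs_pos_eq; trivial.
    left; apply P. apply pos_INR. }
  assert (- PS_derive (Pcoef nu) m <= 11 / 20 * r ^ m).
  { rewrite <- Rabs_Ropp in Pd. generalize (Rle_abs (- PS_derive (Pcoef nu) m)). lra. }
  assert (0 < r ^ m) by (apply pow_lt; unfold r; lra).
  destruct m as [|m].
  - unfold PS_mult, Pcoef, twist in Em. simpl in Em, H0 |- *. unfold Pcoef, twist in *. simpl in *. lra.
  - unfold PS_mult in Em. rewrite tech5, Nat.sub_diag in Em.
    replace (Pcoef nu 0) with 1 in Em by (unfold Pcoef, twist; simpl; ring).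
    assert (- sum_f_R0 (fun k => s k * Pcoef nu (S m - k)) m <= 9 / 4 * r ^ S m).
    { apply Rle_trans with (3 * sum_f_R0 (fun j => r ^ j * Pabs nu (S m - j)) m).
      2:{ generalize (Tb m). lra. }
      apply Rle_trans with (Rabs (sum_f_R0 (fun k => s k * Pcoef nu (S m - k)) m)).
      rewrite <- Rabs_Ropp. apply Rle_abs.
      eapply Rle_trans. apply Rsum_abs. rewrite scal_sum. apply sum_Rle. intros j Hj.
      unfold Pcoef. rewrite Rabs_mult, twist_abs, !Rabs_pos_eq by (auto; left; apply P).
      replace (r ^ j * Pabs nu (S m - j) * 3) with (3 * r ^ j * Pabs nu (S m - j)) by ring.
      apply Rmult_le_compat_r. left; apply P. apply IH. lia. }
    lra. }
apply rapid_geometric with 3 r. unfold r; lra.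
intros n. rewrite Rabs_pos_eq by trivial. apply Sb.
Qed.

(** * The Bessel functions as power series *)

Lemma Icoef_rapid nu : -1 < nu -> rapid (Icoef nu).
Proof.
intros H. apply rapid_unshift.
apply rapid_geometric with (Icoef nu 1) (/ 2). lra.
intros n. rewrite Rabs_pos_eq by (left; now apply Icoef_pos).
apply (geometric_half (fun n => Icoef nu (S n))). clear n. intros n.
change (Icoef nu (S n) / (4 * INR (S (S n)) * (nu + INR (S (S n)))) <= Icoef nu (S n) / 2).
unfold Rdiv. apply Rmult_le_compat_l. left; now apply Icoef_pos.
apply Rinv_le_contravar; [lra|]. rewrite !S_INR. generalize (pos_INR n). intros. nra.
Qed.

Lemma twist_rapid a : rapid a -> rapid (twist a).
Proof. apply rapid_le. intros n. rewrite twist_abs. lra. Qed.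

Lemma Icoef_Gamma nu n : -1 < nu ->
  / (INR (fact n) * Gamma (nu + INR n + 1)) = / Gamma (nu + 1) * Icoef nu n * 4 ^ n.
Proof.
intros H. induction n as [|n IH].
- simpl. rewrite Rplus_0_r, !Rmult_1_l, !Rmult_1_r. reflexivity.
- assert (P := nu_INR_pos nu H n).
  assert (G0 : 0 < Gamma (nu + INR n + 1)) by (apply Gamma_pos; rewrite S_INR in P; lra).
  assert (G1 : 0 < Gamma (nu + 1)) by (apply Gamma_pos; lra).
  replace (nu + INR (S n) + 1) with ((nu + INR n + 1) + 1) by (rewrite S_INR; ring).
  rewrite Gamma_succ by (rewrite S_INR in P; lra).
  change (Icoef nu (S n)) with (Icoef nu n / (4 * INR (S n) * (nu + INR (S n)))).
  replace (nu + INR n + 1) with (nu + INR (S n)) in * by (rewrite S_INR; ring).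
  change (fact (S n)) with (S n * fact n)%nat. rewrite mult_INR.
  assert (F0 := INR_fact_lt_0 n). assert (N0 : 0 < INR (S n)) by (apply lt_0_INR; lia).
  transitivity (/ (INR (fact n) * Gamma (nu + INR (S n))) * / (INR (S n) * (nu + INR (S n)))).
  field; lra. rewrite IH. simpl pow. field. lra.
Qed.

Lemma half_pow z n : ((z / 2) ^ (2 * n))%C = (RtoC (/ 4 ^ n) * (z ^ 2) ^ n)%C.
Proof.
rewrite Cpow_mult_r. replace ((z / 2) ^ 2)%C with (RtoC (/ 4) * z ^ 2)%C.
rewrite Cpow_mult_l. rewrite <- RtoC_pow, pow_inv. reflexivity.
replace (/ 4) with (/ 2 * / 2) by field. rewrite RtoC_mult, RtoC_inv by lra. simpl.
unfold Cdiv. ring.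
Qed.

Lemma Cmod_sqr_le_1 z : Cmod z <= 1 -> Cmod (z ^ 2)%C <= 1.
Proof. apply Cmod_pow_le_1. Qed.

Lemma BesselI_series nu z : -1 < nu -> Cmod z <= 1 -> BesselI nu z =
  (Cpower (z / 2) nu * (RtoC (/ Gamma (nu + 1)) * CPS (Icoef nu) (z ^ 2)))%C.
Proof.
intros H Hz. unfold BesselI. f_equal.
unfold CPS. rewrite <- CSeries_scal by
  (apply CPS_summable; [now apply rapid_abs, Icoef_rapid|now apply Cmod_sqr_le_1]).
apply CSeries_ext. intros n. rewrite half_pow. unfold Rdiv. rewrite Rmult_1_l, Icoef_Gamma by trivial.
rewrite !Cmult_assoc, <- !RtoC_mult. f_equal. f_equal. field.
split; try (apply pow_nonzero; lra); generalize (Gamma_pos (nu + 1)); lra.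
Qed.

Lemma BesselJ_series nu z : -1 < nu -> Cmod z <= 1 -> BesselJ nu z =
  (Cpower (z / 2) nu * (RtoC (/ Gamma (nu + 1)) * CPS (twist (Icoef nu)) (z ^ 2)))%C.
Proof.
intros H Hz. unfold BesselJ. f_equal.
unfold CPS. rewrite <- CSeries_scal by
  (apply CPS_summable; [now apply rapid_abs, twist_rapid, Icoef_rapid|now apply Cmod_sqr_le_1]).
apply CSeries_ext. intros n. rewrite half_pow. unfold Rdiv. rewrite Icoef_Gamma by trivial.
rewrite !Cmult_assoc, <- !RtoC_mult. f_equal. f_equal. unfold twist. field.
split; try (apply pow_nonzero; lra); generalize (Gamma_pos (nu + 1)); lra.
Qed.

Lemma Series_even (a : nat -> R) : ex_series a -> (forall k, a (2 * k + 1)%nat = 0) ->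
  Series a = Series (fun k => a (2 * k)%nat).
Proof.
intros Ha H. symmetry. apply is_series_unique.
apply Series_correct in Ha.
apply (is_lim_seq_subseq (sum_n a) (Series a) (fun n => (2 * n)%nat)) in Ha.
2:{ apply eventually_subseq. intros n; lia. }
revert Ha. apply is_lim_seq_ext. intros n. symmetry.
induction n as [|n IH].
- now rewrite !sum_O.
- replace (2 * S n)%nat with (S (S (2 * n))) by lia. rewrite !sum_Sn, IH.
  replace (S (2 * n)) with (2 * n + 1)%nat by lia. rewrite H.
  replace (S (2 * n + 1)) with (2 * S n)%nat by lia. unfold plus; simpl. ring.
Qed.

Lemma CPS_even a z : ex_series (fun n => Rabs (a n)) -> Cmod z <= 1 ->
  (forall k, a (2 * k + 1)%nat = 0) ->
  CPS a z = CPS (fun k => a (2 * k)%nat) (z ^ 2).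
Proof.
intros Ha Hz H. assert (S := CPS_summable a z Ha Hz).
unfold CPS, CSeries. rewrite (Series_even (fun n => Re _)), (Series_even (fun n => Im _)).
- f_equal; apply Series_ext; intros n; now rewrite Cpow_mult_r.
- now apply ex_series_Im.
- intros k. rewrite H, Cmult_0_l. reflexivity.
- now apply ex_series_Re.
- intros k. rewrite H, Cmult_0_l. reflexivity.
Qed.

Lemma PS_mult_abs_summable a b : ex_series (fun n => Rabs (a n)) ->
  ex_series (fun n => Rabs (b n)) -> ex_series (fun n => Rabs (PS_mult a b n)).
Proof.
intros Ha Hb.
apply ex_series_Rle with (PS_mult (fun n => Rabs (a n)) (fun n => Rabs (b n))).
- intros n. rewrite Rabs_Rabsolu. eapply Rle_trans. apply Rsum_abs.
  right. apply sum_eq. intros; apply Rabs_mult.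
- assert (D : forall u : nat -> R, ex_series (fun n => Rabs (u n)) ->
    ex_series (fun n => Rabs (Rabs (u n)))).
  { intros u. apply ex_series_ext. intros; now rewrite Rabs_Rabsolu. }
  eexists. apply is_series_mult; try (apply D; assumption); apply Series_correct; assumption.
Qed.

Lemma Series_PS_mult a b : ex_series (fun n => Rabs (a n)) ->
  ex_series (fun n => Rabs (b n)) -> Series (PS_mult a b) = Series a * Series b.
Proof.
intros Ha Hb. apply is_series_unique, is_series_mult; trivial;
  now apply Series_correct, ex_series_Rabs.
Qed.

Lemma phi_product nu z : -1 < nu -> Cmod z <= 1 ->
  (CPS (twist (Icoef nu)) z * CPS (Icoef nu) z)%C = CPS (Pcoef nu) (z ^ 2).
Proof.
intros H Hz. assert (R1 := rapid_abs _ (Icoef_rapid nu H)).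
assert (R2 := rapid_abs _ (twist_rapid _ (Icoef_rapid nu H))).
rewrite CPS_mult by trivial.
rewrite CPS_even by (auto using PS_mult_abs_summable, JI_product_odd).
apply CPS_ext. intros n. now apply JI_product_even.
Qed.

Lemma PiJI_series nu z : -1 < nu -> Cmod z <= 1 -> PiJI nu z =
  (Cpower (z / 2) nu * Cpower (z / 2) nu * RtoC (/ Gamma (nu + 1) ^ 2)
   * CPS (Pcoef nu) (z ^ 4))%C.
Proof.
intros H Hz. unfold PiJI. rewrite BesselJ_series, BesselI_series by trivial.
replace (z ^ 4)%C with ((z ^ 2) ^ 2)%C by ring.
rewrite <- phi_product by (trivial; now apply Cmod_sqr_le_1).
replace (/ Gamma (nu + 1) ^ 2) with (/ Gamma (nu + 1) * / Gamma (nu + 1)).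
rewrite RtoC_mult. ring.
field. generalize (Gamma_pos (nu + 1)). lra.
Qed.

Lemma Gamma_sqr_cancel nu : -1 < nu ->
  (RtoC (Gamma (nu + 1) ^ 2) * RtoC (/ Gamma (nu + 1) ^ 2))%C = 1.
Proof.
intros H. rewrite <- RtoC_mult, Rinv_r; trivial.
apply pow_nonzero. generalize (Gamma_pos (nu + 1)). lra.
Qed.

Lemma two_power_cancel nu :
  (RtoC (Rpower 2 (2 * nu)) * (RtoC (Rpower 2 (- nu)) * RtoC (Rpower 2 (- nu))))%C = 1.
Proof.
rewrite <- !RtoC_mult, <- !Rpower_plus. f_equal.
replace (2 * nu + (- nu + - nu)) with 0 by ring. apply Rpower_O. lra.
Qed.

(** The fractional powers of z cancel because all of them are principal. *)
Lemma v_fun_series nu z : -1 < nu -> Cmod z < 1 ->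
  v_fun nu z = (z * CPS (Pcoef nu) (z ^ 4))%C.
Proof.
intros H Hz. unfold v_fun. destruct (Ceq_dec z 0) as [->|Hz0].
{ destruct (Req_EM_T (- 2 * nu + 1) 0) as [E|E].
  - unfold PiJI, BesselJ. replace (0 / 2)%C with (RtoC 0) by (unfold Cdiv; ring).
    rewrite (Cpower_0_neq nu) by lra. ring.
  - rewrite Cpower_0_neq by trivial. ring. }
rewrite PiJI_series by (trivial; lra). rewrite Cpower_half by trivial.
transitivity ((RtoC (Rpower 2 (2 * nu)) * (RtoC (Rpower 2 (- nu)) * RtoC (Rpower 2 (- nu))))
  * (RtoC (Gamma (nu + 1) ^ 2) * RtoC (/ Gamma (nu + 1) ^ 2))
  * (Cpower z (- 2 * nu + 1) * Cpower z nu * Cpower z nu) * CPS (Pcoef nu) (z ^ 4))%C.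
ring.
rewrite two_power_cancel, Gamma_sqr_cancel, !Cpower_plus by trivial.
replace (- 2 * nu + 1 + nu + nu) with 1 by ring. rewrite Cpower_1 by trivial. ring.
Qed.

Lemma u_fun_series nu z : -1 < nu -> Cmod z < 1 ->
  u_fun nu z = (z * Cpower (CPS (Pcoef nu) (z ^ 4)) (1 / (2 * nu)))%C.
Proof.
intros H Hz. unfold u_fun. destruct (Ceq_dec z 0) as [->|Hz0]; [ring|].
f_equal. f_equal.
rewrite PiJI_series by (trivial; lra). rewrite Cpower_half by trivial.
transitivity ((RtoC (Rpower 2 (2 * nu)) * (RtoC (Rpower 2 (- nu)) * RtoC (Rpower 2 (- nu))))
  * (RtoC (Gamma (nu + 1) ^ 2) * RtoC (/ Gamma (nu + 1) ^ 2))
  * (Cpower z (- 2 * nu) * Cpower z nu * Cpower z nu) * CPS (Pcoef nu) (z ^ 4))%C.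
ring.
rewrite two_power_cancel, Gamma_sqr_cancel, !Cpower_plus by trivial.
replace (- 2 * nu + nu + nu) with 0 by ring. rewrite Cpower_exp_0 by trivial. ring.
Qed.

Lemma w_fun_series nu z : -1 < nu -> Cmod z < 1 ->
  w_fun nu z = (z * CPS (Pcoef nu) (z ^ 1))%C.
Proof.
intros H Hz. unfold w_fun. rewrite Cpow_1_r. destruct (Ceq_dec z 0) as [->|Hz0].
{ destruct (Req_EM_T (- nu / 2 + 1) 0) as [E|E].
  - unfold PiJI, BesselJ. rewrite (Cpower_0_neq (1 / 4)) by lra.
    replace (0 / 2)%C with (RtoC 0) by (unfold Cdiv; ring).
    rewrite (Cpower_0_neq nu) by lra. ring.
  - rewrite Cpower_0_neq by trivial. ring. }
set (y := Cpower z (1 / 4)).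
assert (Hy0 : y <> 0) by now apply Cpower_neq_0.
assert (Hy4 : (y ^ 4)%C = z).
{ unfold y. rewrite Cpower_Cexp, Cexp_pow by trivial.
  rewrite Cmult_assoc, <- RtoC_mult. replace (INR 4 * (1 / 4)) with 1 by (simpl; field).
  rewrite Cmult_1_l. now apply Cexp_Clog. }
assert (Hy : Cmod y <= 1).
{ apply Rnot_lt_le. intros K. 
  assert (Cmod z = Cmod y ^ 4) by (rewrite <- Cmod_pow, Hy4; reflexivity).
  assert (1 <= Cmod y ^ 4) by (apply pow_R1_Rle; lra). lra. }
rewrite PiJI_series by trivial. rewrite Hy4, Cpower_half by trivial.
unfold y. rewrite Cpower_Cpower by (trivial; lra).
transitivity ((RtoC (Rpower 2 (2 * nu)) * (RtoC (Rpower 2 (- nu)) * RtoC (Rpower 2 (- nu))))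
  * (RtoC (Gamma (nu + 1) ^ 2) * RtoC (/ Gamma (nu + 1) ^ 2))
  * (Cpower z (- nu / 2 + 1) * Cpower z (nu * (1 / 4)) * Cpower z (nu * (1 / 4)))
  * CPS (Pcoef nu) z)%C.
ring.
rewrite two_power_cancel, Gamma_sqr_cancel, !Cpower_plus by trivial.
replace (- nu / 2 + 1 + nu * (1 / 4) + nu * (1 / 4)) with 1 by field.
rewrite Cpower_1 by trivial. ring.
Qed.

(** * The defining equation *)

Lemma Series_theta a : rapid a -> Series (theta a) = Series (PS_derive a).
Proof.
intros Ha. rewrite Series_incr_1.
- unfold theta at 1. simpl (INR 0). rewrite Rmult_0_l, Rplus_0_l. reflexivity.
- now apply ex_series_Rabs, rapid_abs, rapid_INR.
Qed.

(** The relation between I_(nu+1) and the derivative of I_nu. *)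
Lemma Icoef_succ nu n : -1 < nu ->
  Icoef (nu + 1) n = 4 * (nu + 1) * PS_derive (Icoef nu) n.
Proof.
intros H. unfold PS_derive. induction n as [|n IH].
- simpl. field. lra.
- change (Icoef (nu + 1) (S n)) with (Icoef (nu + 1) n / (4 * INR (S n) * (nu + 1 + INR (S n)))).
  change (Icoef nu (S (S n))) with (Icoef nu (S n) / (4 * INR (S (S n)) * (nu + INR (S (S n))))).
  rewrite IH. replace (nu + 1 + INR (S n)) with (nu + INR (S (S n))) by (rewrite (S_INR (S n)); ring).
  assert (N1 := nu_INR_pos nu H (S n)).
  assert (0 < INR (S n)) by (apply lt_0_INR; lia).
  assert (0 < INR (S (S n))) by (apply lt_0_INR; lia).
  field. repeat split; lra.
Qed.

(** [theta] is a derivation, so the second combination is the value at 1 of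
    theta (A B); A B is a series in s^2 = w, whence the factor 2. *)
Lemma product_theta nu : -1 < nu ->
  Series (twist (Icoef nu)) * Series (Icoef nu) = Phi0 nu /\
  Series (twist (Icoef nu)) * Series (PS_derive (Icoef nu))
  + Series (PS_derive (twist (Icoef nu))) * Series (Icoef nu) = 2 * Phi1 nu.
Proof.
intros H. assert (R1 := Icoef_rapid nu H). assert (R2 := twist_rapid _ R1).
assert (A1 := rapid_abs _ R1). assert (A2 := rapid_abs _ R2).
assert (B1 := rapid_abs _ (rapid_INR _ R1)). assert (B2 := rapid_abs _ (rapid_INR _ R2)).
split.
- rewrite <- Series_PS_mult by trivial.
  rewrite Series_even by (auto using JI_product_odd, ex_series_Rabs, PS_mult_abs_summable).
  apply Series_ext. intros n. now apply JI_product_even.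
- rewrite <- !Series_theta by trivial.
  rewrite <- !Series_PS_mult by trivial.
  assert (E1 := ex_series_Rabs _ (PS_mult_abs_summable _ _ A2 B1)).
  assert (E2 := ex_series_Rabs _ (PS_mult_abs_summable _ _ B2 A1)).
  rewrite <- Series_plus by trivial.
  assert (Et : forall n, theta (PS_mult (twist (Icoef nu)) (Icoef nu)) n =
    PS_mult (twist (Icoef nu)) (theta (Icoef nu)) n + PS_mult (theta (twist (Icoef nu))) (Icoef nu) n)
    by (intros n; rewrite theta_mult; ring).
  rewrite <- (Series_ext _ _ Et).
  rewrite Series_even.
  + unfold Phi1. rewrite <- Series_scal_l. apply Series_ext. intros n.
    unfold theta. rewrite JI_product_even, mult_INR by trivial. simpl INR. ring.
  + eapply ex_series_ext; [|apply (ex_series_plus_R _ _ E1 E2)]. intros n. symmetry. apply Et.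
  + intros n. unfold theta. rewrite JI_product_odd by trivial. ring.
Qed.

Lemma CPS_1 a : CPS a 1 = RtoC (Series a).
Proof. rewrite CPS_R. f_equal. apply Series_ext. intros n. rewrite pow1. ring. Qed.

Lemma equation_lhs_char_fun c nu : -1 < nu -> equation_lhs c nu =
  RtoC ((Rpower 2 (- nu) / Gamma (nu + 1)) ^ 2 * char_fun c nu).
Proof.
intros H.
assert (H1 : Cmod 1 <= 1) by (rewrite Cmod_1; lra).
assert (N1 : RtoC 1 <> 0) by apply C1_nz.
assert (G0 : 0 < Gamma (nu + 1)) by (apply Gamma_pos; lra).
assert (P1 : forall a, Cpower (1 / 2) a = RtoC (Rpower 2 (- a))).
{ intros a. rewrite Cpower_half by trivial. rewrite Cpower_Cexp by trivial.
  replace (Clog 1) with (RtoC 0). rewrite Cmult_0_r, Cexp_0. ring.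
  rewrite <- (Clog_Cexp 0). now rewrite Cexp_0. unfold Im; simpl. generalize PI_RGT_0; lra. }
assert (J1 : BesselJ (nu + 1) 1 = RtoC (Rpower 2 (- nu) / Gamma (nu + 1)
   * (- 2 * Series (PS_derive (twist (Icoef nu)))))).
{ rewrite BesselJ_series by (trivial; lra). rewrite P1, Cpow_1_l, CPS_1, <- !RtoC_mult. f_equal.
  rewrite Gamma_succ by lra.
  rewrite (Series_ext _ (fun n => (- 4 * (nu + 1)) * PS_derive (twist (Icoef nu)) n)).
  rewrite Series_scal_l. replace (- (nu + 1)) with (- nu + - (1)) by ring.
  rewrite Rpower_plus, (Rpower_Ropp 2 1), Rpower_1 by lra. field. lra.
  intros n. unfold twist at 1. rewrite Icoef_succ by trivial. unfold PS_derive, twist. simpl pow. ring. }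
assert (I1 : BesselI (nu + 1) 1 = RtoC (Rpower 2 (- nu) / Gamma (nu + 1)
   * (2 * Series (PS_derive (Icoef nu))))).
{ rewrite BesselI_series by (trivial; lra). rewrite P1, Cpow_1_l, CPS_1, <- !RtoC_mult. f_equal.
  rewrite Gamma_succ by lra.
  rewrite (Series_ext _ (fun n => (4 * (nu + 1)) * PS_derive (Icoef nu) n)).
  rewrite Series_scal_l. replace (- (nu + 1)) with (- nu + - (1)) by ring.
  rewrite Rpower_plus, (Rpower_Ropp 2 1), Rpower_1 by lra. field. lra.
  intros n. now rewrite Icoef_succ. }
unfold equation_lhs. rewrite J1, I1, BesselJ_series, BesselI_series, P1, Cpow_1_l, !CPS_1 by trivial.
rewrite <- !RtoC_mult, <- RtoC_minus, <- RtoC_plus. f_equal.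
destruct (product_theta nu H) as [E0 E1].
unfold char_fun. rewrite <- E0.
replace (4 * Phi1 nu) with (2 * (2 * Phi1 nu)) by ring. rewrite <- E1.
field. lra.
Qed.

Lemma equation_root c nu : -1 < nu -> equation_lhs c nu = 0 <-> char_fun c nu = 0.
Proof.
intros H. rewrite equation_lhs_char_fun by trivial.
assert (G0 : 0 < Gamma (nu + 1)) by (apply Gamma_pos; lra).
assert (K : 0 < (Rpower 2 (- nu) / Gamma (nu + 1)) ^ 2).
{ apply pow_lt, Rdiv_lt_0_compat; trivial. apply exp_pos. }
split.
- intros E. apply RtoC_inj in E. apply Rmult_integral in E. destruct E; lra.
- intros ->. now rewrite Rmult_0_r.
Qed.

(** * The logarithm of the product series *)

Lemma PS_Int_O s : PS_Int s O = 0.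
Proof. reflexivity. Qed.

(** The hypothesis says that p' = - p G' for the series G with derivative s, so
    that p exp G has derivative 0. *)
Lemma exp_of_log_series (p s : nat -> R) : rapid p -> rapid s -> p O = 1 ->
  (forall n, PS_mult s p n = - PS_derive p n) ->
  forall w : C, Cmod w < 1 -> CPS p w = Cexp (- CPS (PS_Int s) w).
Proof.
intros Hp Hs P0 HE w Hw.
set (f := fun w => (CPS p w * Cexp (CPS (PS_Int s) w))%C).
assert (Hd : forall z : C, Cmod z < 1 -> Cderiv f z 0).
{ intros z Hz. unfold f. evar_last.
  - apply Cderiv_mult. now apply Cderiv_CPS.
    apply (Cderiv_comp Cexp). apply Cderiv_Cexp.
    apply Cderiv_CPS; trivial. now apply rapid_Int.
  - cbv beta. rewrite (CPS_ext (PS_derive (PS_Int s)) s) by apply PS_derive_Int.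
    assert (E : (CPS s z * CPS p z)%C = (- CPS (PS_derive p) z)%C).
    { rewrite CPS_mult by (first [now apply rapid_abs|lra]).
      rewrite (CPS_ext _ (fun n => -1 * PS_derive p n)) by (intros; rewrite HE; ring).
      rewrite CPS_scal by (first [now apply rapid_abs, rapid_derive|lra]). ring. }
    transitivity ((CPS (PS_derive p) z + CPS s z * CPS p z) * Cexp (CPS (PS_Int s) z))%C.
    ring. rewrite E. ring. }
assert (E := Cderiv_zero_disk f 1 Rlt_0_1 Hd w Hw).
unfold f in E. rewrite !CPS_0 in E by (now apply rapid_abs, rapid_Int || now apply rapid_abs).
rewrite P0, PS_Int_O, Cexp_0, Cmult_1_l in E.
rewrite Cexp_opp. 
transitivity (CPS p w * Cexp (CPS (PS_Int s) w) * / Cexp (CPS (PS_Int s) w))%C.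
field. apply Cexp_neq_0. rewrite E. ring.
Qed.

(** Evaluating the relation of [even_Rayleigh] at w = 1 gives the sum of the
    even Rayleigh sums in terms of phi(1) and phi'(1). *)
Lemma product_log nu : - (7 / 10) <= nu -> exists s : nat -> R,
  (forall n, 0 <= s n) /\ 0 < s O /\ rapid s /\
  (forall w : C, Cmod w < 1 -> CPS (Pcoef nu) w = Cexp (- CPS (PS_Int s) w)) /\
  0 < Phi0 nu /\ Series s * Phi0 nu = - Phi1 nu.
Proof.
intros H. assert (H1 : -1 < nu) by lra.
assert (P1 : Pabs nu 1 <= 11 / 20).
{ apply Pabs_1_bound_above; try lra.
  assert ((3 / 10) ^ 2 * (13 / 10) <= (nu + 1) ^ 2 * (nu + 2)).
  { apply Rmult_le_compat; try lra. apply pow_incr; lra. }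
  lra. }
destruct (even_Rayleigh nu H1) as [s [S1 [S2 S3]]].
assert (S4 := even_Rayleigh_rapid nu s H1 P1 S1 S3).
assert (Rp := Pcoef_rapid nu H1).
exists s. repeat split; trivial.
- apply exp_of_log_series; trivial. unfold Pcoef, twist. simpl. ring.
- destruct (Phi_bounds nu H1). lra.
- unfold Phi0, Phi1. rewrite <- Series_PS_mult by now apply rapid_abs.
  rewrite (Series_ext _ _ S3), Series_opp, Series_theta by trivial. reflexivity.
Qed.

Lemma char_fun_log_bound c nu Q : 0 < Phi0 nu -> Q * Phi0 nu = - Phi1 nu ->
  0 <= char_fun c nu <-> Q <= c / 4.
Proof.
intros P E. unfold char_fun. replace (Phi1 nu) with (- (Q * Phi0 nu)) by lra. split; intros K.
- apply Rmult_le_reg_r with (Phi0 nu); trivial. lra.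
- apply Rmult_le_compat_r with (r := Phi0 nu) in K; lra.
Qed.

(** * Functions of the form z phi (z^(m+1)) *)

Lemma product_starlike m alpha nu (f : C -> C) : 0 <= alpha < 1 -> - (7 / 10) <= nu ->
  (forall z, Cmod z < 1 -> f z = (z * CPS (Pcoef nu) (z ^ S m))%C) ->
  0 <= char_fun (4 / INR (S m) * (1 - alpha)) nu -> starlike_of_order alpha f.
Proof.
intros Hal Hnu Hf HF.
destruct (product_log nu Hnu) as [s [S1 [S2 [S3 [S4 [S5 S6]]]]]].
assert (Hm : 0 < INR (S m)) by (apply lt_0_INR; lia).
apply (proj1 (char_fun_log_bound _ _ _ S5 S6)) in HF.
apply (exp_form_starlike s 1 m S1 S3 Rlt_0_1 f); trivial.
- intros z Hz. rewrite Hf, S4 by (trivial; now apply pow_disk).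
  f_equal. f_equal. ring.
- apply Rmult_le_compat_l with (r := INR (S m)) in HF; [|lra].
  replace (INR (S m) * (4 / INR (S m) * (1 - alpha) / 4)) with (1 - alpha) in HF by (field; lra).
  lra.
Qed.

Lemma lipschitz_continuity_pt (u : R -> R) (L : R) : 
  (forall x y, -1 <= x <= 1 -> -1 <= y <= 1 -> Rabs (u x - u y) <= L * Rabs (x - y)) ->
  forall x, -1 < x < 1 -> continuity_pt u x.
Proof.
intros H x Hx eps Heps.
assert (HL := Rle_abs L). assert (HL0 := Rabs_pos L).
exists (Rmin (Rmin (1 - x) (x + 1)) (eps / (Rabs L + 1))). split.
{ apply Rmin_pos. apply Rmin_pos; lra. apply Rdiv_lt_0_compat; lra. }
intros y [_ Hy]. simpl in *. unfold Rdist in *.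
apply Rmin_Rgt_l in Hy. destruct Hy as [Hy1 Hy2]. apply Rmin_Rgt_l in Hy1. destruct Hy1 as [Hy0 Hy1].
assert (Rabs (y - x) < eps / (Rabs L + 1)) by lra.
apply Rlt_div_r in H0; [|lra].
assert (Hb : -1 <= y <= 1).
{ apply Rgt_lt, Rabs_lt_between in Hy0. apply Rgt_lt, Rabs_lt_between in Hy1. lra. }
eapply Rle_lt_trans. apply H; lra. generalize (Rabs_pos (y - x)). nra.
Qed.

(** These bounds serve both for the intermediate value theorem inside ]-1, 1[ and
    for the limit at 1. *)
Lemma real_series_lipschitz a m : rapid a -> exists L, 0 <= L /\
  forall x y, -1 <= x <= 1 -> -1 <= y <= 1 ->
  Rabs (Series (fun n => a n * (x ^ S m) ^ n) - Series (fun n => a n * (y ^ S m) ^ n))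
  <= L * Rabs (x - y).
Proof.
intros Ha. set (L := Series (fun n => INR n * Rabs (a n))).
assert (L0 : 0 <= L).
{ apply Series_nonneg. intros; apply Rmult_le_pos; auto using pos_INR, Rabs_pos.
  eapply ex_series_ext; [|apply (Ha 1%nat)]. intros; simpl; ring. }
exists (L * INR (S m)). split. apply Rmult_le_pos; auto using pos_INR.
intros x y Hx Hy.
assert (Cx : Cmod x <= 1) by (rewrite Cmod_R; apply Rabs_le; lra).
assert (Cy : Cmod y <= 1) by (rewrite Cmod_R; apply Rabs_le; lra).
assert (K := CPS_lipschitz a (RtoC x ^ S m) (RtoC y ^ S m) Ha
  (Cmod_pow_le_1 _ _ Cx) (Cmod_pow_le_1 _ _ Cy)).
rewrite <- !RtoC_pow, !CPS_R, <- !RtoC_minus, !Cmod_R in K. fold L in K.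
eapply Rle_trans. apply K. rewrite Rmult_assoc. apply Rmult_le_compat_l; trivial.
assert (K2 := Cpow_lipschitz x y (S m) Cx Cy).
now rewrite <- !RtoC_pow, <- !RtoC_minus, !Cmod_R in K2.
Qed.

(** Where phi has a zero on the real axis the logarithmic derivative, being a
    quotient by 0, vanishes and hence is not above alpha; so phi is positive on
    the real axis, and the condition can be passed to the limit at 1. *)
Lemma starlike_product_bound m alpha nu (f : C -> C) : 0 <= alpha -> -1 < nu ->
  (forall z, Cmod z < 1 -> f z = (z * CPS (Pcoef nu) (z ^ S m))%C) ->
  starlike_of_order alpha f -> 0 <= char_fun (4 / INR (S m) * (1 - alpha)) nu.
Proof.
intros Hal Hnu Hf [_ [_ [_ [_ H]]]].
assert (Rp := Pcoef_rapid nu Hnu).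
assert (Rt : rapid (theta (Pcoef nu))) by now apply rapid_INR.
set (p := fun x => Series (fun n => Pcoef nu n * (x ^ S m) ^ n)).
set (t := fun x => Series (fun n => theta (Pcoef nu) n * (x ^ S m) ^ n)).
destruct (real_series_lipschitz (Pcoef nu) m Rp) as [L1 [L1p HL1]].
destruct (real_series_lipschitz (theta (Pcoef nu)) m Rt) as [L2 [L2p HL2]].
assert (Hm : 0 < INR (S m)) by (apply lt_0_INR; lia).
assert (LD : forall x : R, 0 < x < 1 -> p x <> 0 /\ alpha < 1 + INR (S m) * t x / p x).
{ intros x Hx.
  assert (Cx : Cmod x < 1) by (rewrite Cmod_R, Rabs_pos_eq; lra).
  assert (Cx0 : RtoC x <> 0) by (intros E; apply RtoC_inj in E; lra).
  assert (Cxm := pow_disk m x Cx).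
  specialize (H x Cx Cx0).
  assert (D : Cderiv f x (1 * CPS (Pcoef nu) (RtoC x ^ S m) + RtoC x *
     (RtoC (INR (S m)) * RtoC x ^ m * CPS (PS_derive (Pcoef nu)) (RtoC x ^ S m)))%C).
  { apply (Cderiv_ext_ball (fun z => z * CPS (Pcoef nu) (z ^ S m))%C _ _ _ (1 - Cmod x)); [lra| |].
    - intros z Hz. symmetry. apply Hf. replace z with (RtoC x + (z - RtoC x))%C by ring.
      eapply Rle_lt_trans. apply Cmod_triangle. lra.
    - apply (Cderiv_mult (fun z => z) (fun z => CPS (Pcoef nu) (z ^ S m))%C).
      apply Cderiv_id. apply (Cderiv_comp (CPS (Pcoef nu)) (fun z => z ^ S m)%C).
      now apply Cderiv_CPS. apply Cderiv_pow. }
  rewrite (is_C_derive_unique _ _ _ (Cderiv_is_derive _ _ _ D)), Hf in H by trivial.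
  assert (Et : (RtoC x ^ S m * CPS (PS_derive (Pcoef nu)) (RtoC x ^ S m))%C = RtoC (t x)).
  { transitivity (CPS (theta (Pcoef nu)) (RtoC x ^ S m)).
    - rewrite (CPS_incr_1 (theta _)) by (first [now apply rapid_abs|lra]).
      unfold theta at 1. simpl (INR 0). rewrite Rmult_0_l, Cplus_0_l. reflexivity.
    - unfold t. now rewrite <- RtoC_pow, CPS_R. }
  assert (Ep : CPS (Pcoef nu) (RtoC x ^ S m) = RtoC (p x)).
  { unfold p. now rewrite <- RtoC_pow, CPS_R. }
  replace (RtoC x * (1 * CPS (Pcoef nu) (RtoC x ^ S m) + RtoC x *
     (RtoC (INR (S m)) * RtoC x ^ m * CPS (PS_derive (Pcoef nu)) (RtoC x ^ S m))))%C
    with (RtoC (x * (p x + INR (S m) * t x))) in H.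
  2:{ rewrite RtoC_mult, RtoC_plus, RtoC_mult, <- Et, <- Ep, Cpow_S. ring. }
  rewrite Ep, <- RtoC_mult in H.
  destruct (Req_dec (p x) 0) as [E|E].
  - exfalso. rewrite E, Rmult_0_r in H.
    assert (I0 : (/ RtoC 0)%C = 0).
    { unfold Cinv, RtoC, Rdiv. simpl. f_equal; ring. }
    unfold Cdiv in H. rewrite I0, Cmult_0_r in H. simpl in H. lra.
  - split; trivial. rewrite <- RtoC_div in H by (apply Rmult_integral_contrapositive; lra).
    simpl in H. replace (1 + INR (S m) * t x / p x) with (x * (p x + INR (S m) * t x) / (x * p x)).
    exact H. field. lra. }
assert (P0 : p 0 = 1).
{ unfold p. assert (E := CPS_R (Pcoef nu) (0 ^ S m)). simpl pow in E.
  rewrite Rmult_0_l, CPS_0 in E by now apply rapid_abs. apply RtoC_inj in E.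
  simpl pow. rewrite Rmult_0_l, <- E. unfold Pcoef, twist. simpl. ring. }
assert (PP : forall x, 0 < x < 1 -> 0 < p x).
{ intros x Hx. apply Rnot_le_lt. intros K.
  destruct (LD x Hx) as [N _].
  destruct (IVT_interv (fun y => - p y) 0 x) as [z [Hz E]]; try lra.
  { intros y Hy. apply continuity_pt_opp. apply (lipschitz_continuity_pt p L1 HL1). lra. }
  assert (0 < z) by (destruct (proj1 Hz) as [?|<-]; lra).
  destruct (LD z); lra. }
set (u := fun x => (1 - alpha) * p x + INR (S m) * t x).
assert (U : 0 <= u 1).
{ apply (left_limit_nonneg u (Rabs (1 - alpha) * L1 + INR (S m) * L2)).
  - intros x Hx. unfold u.
    replace (_ - _) with ((1 - alpha) * (p x - p 1) + INR (S m) * (t x - t 1)) by ring.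
    eapply Rle_trans. apply Rabs_triang. rewrite !Rabs_mult, (Rabs_pos_eq (INR _)) by lra.
    assert (K1 := HL1 x 1 ltac:(lra) ltac:(lra)). assert (K2 := HL2 x 1 ltac:(lra) ltac:(lra)).
    rewrite (Rabs_left1 (x - 1)) in K1, K2 by lra.
    replace ((Rabs (1 - alpha) * L1 + INR (S m) * L2) * (1 - x))
      with (Rabs (1 - alpha) * (L1 * - (x - 1)) + INR (S m) * (L2 * - (x - 1))) by ring.
    apply Rplus_le_compat; apply Rmult_le_compat_l; [apply Rabs_pos|exact K1|lra|exact K2].
  - intros x Hx. destruct (LD x Hx) as [_ K]. assert (Q := PP x Hx). unfold u.
    apply Rmult_lt_compat_r with (r := p x) in K; trivial.
    replace ((1 + INR (S m) * t x / p x) * p x) with (p x + INR (S m) * t x) in K by (field; lra).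
    lra. }
assert (E1 : p 1 = Phi0 nu).
{ unfold p. rewrite pow1. apply Series_ext. intros n. rewrite pow1. ring. }
assert (E2 : t 1 = Phi1 nu).
{ unfold t. rewrite pow1. apply Series_ext. intros n. rewrite pow1. ring. }
unfold u in U. rewrite E1, E2 in U. unfold char_fun.
replace (4 / INR (S m) * (1 - alpha) * Phi0 nu + 4 * Phi1 nu)
  with (4 / INR (S m) * ((1 - alpha) * Phi0 nu + INR (S m) * Phi1 nu)) by (field; lra).
apply Rmult_le_pos; trivial. apply Rdiv_le_0_compat; lra.
Qed.

(** Here c does not depend on the order, so monotonicity of [char_fun c] gives
    the uniqueness of the root and turns the sign condition into
    [nu_star <= nu]. *)
Lemma product_theorem m (f : R -> C -> C) (c alpha : R) : 0 <= alpha < 1 ->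
  c = 4 / INR (S m) * (1 - alpha) -> c <= 4 ->
  (forall nu z, -1 < nu -> Cmod z < 1 -> f nu z = (z * CPS (Pcoef nu) (z ^ S m))%C) ->
  exists nu_star, is_unique_root (fun _ => c) nu_star /\ -1 < nu_star /\
    char_fun c nu_star = 0 /\
    forall nu, -1 < nu -> starlike_of_order alpha (f nu) <-> nu_star <= nu.
Proof.
intros Hal Hc Hc4 Hf.
assert (Hm : 0 < INR (S m)) by (apply lt_0_INR; lia).
assert (Hc0 : 0 < c).
{ rewrite Hc. apply Rmult_lt_0_compat; [apply Rdiv_lt_0_compat|]; lra. }
destruct (char_fun_root c) as [ns [N1 N2]]; [lra|].
exists ns. split; [|split; [lra|split; trivial]].
- split. { split. lra. apply (proj2 (equation_root _ ns ltac:(lra))). exact N2. }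
  intros nu [K1 K2]. apply (proj1 (equation_root _ nu K1)) in K2.
  destruct (Rtotal_order ns nu) as [L|[L|L]]; trivial; exfalso.
  + generalize (char_fun_increasing c ns nu). lra.
  + generalize (char_fun_increasing c nu ns). lra.
- intros nu Hnu. split.
  + intros St. apply Rnot_lt_le. intros L.
    assert (0 <= char_fun c nu).
    { rewrite Hc. apply (starlike_product_bound m alpha nu (f nu)); trivial. lra. auto. }
    generalize (char_fun_increasing c nu ns). lra.
  + intros L. apply (product_starlike m alpha nu); trivial. lra. auto. rewrite <- Hc.
    destruct L as [L|<-]; [|lra]. generalize (char_fun_increasing c ns nu). lra.
Qed.

(** * The power normalization *)

Lemma u_fun_exp_form nu s : 0 < nu -> (forall n, 0 <= s n) -> rapid s ->
  (forall w : C, Cmod w < 1 -> CPS (Pcoef nu) w = Cexp (- CPS (PS_Int s) w)) ->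
  0 < Phi0 nu -> Series s * Phi0 nu = - Phi1 nu ->
  forall z, Cmod z < 1 ->
  u_fun nu z = (z * Cexp (- (RtoC (/ (2 * nu)) * CPS (PS_Int s) (z ^ 4))))%C.
Proof.
intros Hnu S1 S3 S4 S5 S6 z Hz.
assert (Hz4 := pow_disk 3 z Hz).
rewrite u_fun_series, S4 by (trivial; lra).
(* the logarithm is too small for its imaginary part to leave ]-PI, PI] *)
rewrite Cpower_of_Cexp.
- f_equal. f_equal. replace (1 / (2 * nu)) with (/ (2 * nu)) by (field; lra). ring.
- destruct (Phi_bounds nu ltac:(lra)) as [[A _] [B _]].
  assert (C0 := Pabs_1_small nu ltac:(lra)).
  assert (Q : Series s <= 1).
  { apply Rmult_le_reg_r with (Phi0 nu); trivial. lra. }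
  assert (Es : ex_series (fun n => Rabs (s n))) by now apply rapid_abs.
  assert (Bd : Cmod (CPS (PS_Int s) (z ^ 4)) <= 1).
  { eapply Rle_trans. apply CPS_bound. now apply rapid_abs, rapid_Int. lra.
    eapply Rle_trans; [|apply Q]. rewrite Series_incr_1 by
      (now apply rapid_abs, rapid_Int). rewrite PS_Int_O, Rabs_R0, Rplus_0_l.
    apply Series_le; [|now apply ex_series_Rabs]. intros n. split. apply Rabs_pos.
    assert (1 <= INR (S n)) by (apply (le_INR 1); lia).
    unfold PS_Int. rewrite Rabs_pos_eq by (apply Rdiv_le_0_compat; auto; lra).
    apply Rle_div_l; [lra|]. generalize (S1 n). nra. }
  assert (Im1 := Im_abs_le (- CPS (PS_Int s) (z ^ 4))). rewrite Cmod_opp in Im1.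
  assert (Im2 : Rabs (Im (- CPS (PS_Int s) (z ^ 4))%C) <= 1) by lra.
  apply Rabs_le_between in Im2. generalize PI2_1. lra.
Qed.

(** The exponential form is available for all positive orders, so one bound on
    the even Rayleigh sums is both sufficient and necessary. *)
Lemma u_theorem alpha : 0 <= alpha < 1 -> exists nu_star,
  is_unique_root (fun nu => 2 * nu * (1 - alpha)) nu_star /\
  5 / 100 <= nu_star /\ char_fun (2 * nu_star * (1 - alpha)) nu_star = 0 /\
  (forall nu, nu_star <= nu -> starlike_of_order alpha (u_fun nu)) /\
  (forall nu, 0 < nu -> starlike_of_order alpha (u_fun nu) -> nu_star <= nu).
Proof.
intros Hal.
destruct (char_fun_u_root (1 - alpha)) as [ns [N1 N2]]; [lra|].
assert (X : forall nu, 0 < nu -> (0 <= char_fun (2 * nu * (1 - alpha)) nu <-> ns <= nu)).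
{ intros nu Hnu.
  assert (K : 0 <= char_fun (2 * nu * (1 - alpha)) nu <-> 0 <= char_fun (2 * nu * (1 - alpha)) nu / nu).
  { split; intros K. apply Rdiv_le_0_compat; lra. 
    replace (char_fun _ nu) with (char_fun (2 * nu * (1 - alpha)) nu / nu * nu) by (field; lra).
    apply Rmult_le_pos; lra. }
  rewrite K. assert (N3 : char_fun (2 * ns * (1 - alpha)) ns / ns = 0) by (rewrite N2; field; lra).
  split; intros L.
  - apply Rnot_lt_le. intros M. generalize (char_fun_u_increasing (1 - alpha) nu ns). lra.
  - destruct L as [L|<-]; [|lra]. generalize (char_fun_u_increasing (1 - alpha) ns nu). lra. }
exists ns. split; [|split; [|split; [|split]]]; trivial.
- split. { split. lra. apply (proj2 (equation_root _ ns ltac:(lra))). exact N2. }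
  intros nu [K1 K2]. apply (proj1 (equation_root _ nu K1)) in K2.
  apply (char_fun_u_unique (1 - alpha)); trivial; lra.
- intros nu L. assert (Hnu : 0 < nu) by lra. apply X in L; trivial.
  destruct (product_log nu ltac:(lra)) as [s [S1 [S2 [S3 [S4 [S5 S6]]]]]].
  apply (proj1 (char_fun_log_bound _ _ _ S5 S6)) in L.
  assert (Hk : 0 < / (2 * nu)) by (apply Rinv_0_lt_compat; lra).
  apply (exp_form_starlike s (/ (2 * nu)) 3 S1 S3 Hk (u_fun nu)); trivial.
  + intros z Hz. now apply u_fun_exp_form.
  + replace (INR 4) with 4 by (simpl; ring).
    apply Rmult_le_compat_l with (r := / (2 * nu) * 4) in L; [|lra].
    replace (/ (2 * nu) * 4 * (2 * nu * (1 - alpha) / 4)) with (1 - alpha) in L by (field; lra). lra.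
- intros nu Hnu St. apply X; trivial.
  destruct (product_log nu ltac:(lra)) as [s [S1 [S2 [S3 [S4 [S5 S6]]]]]].
  apply (char_fun_log_bound _ _ _ S5 S6).
  assert (Hk : 0 < / (2 * nu)) by (apply Rinv_0_lt_compat; lra).
  assert (B := starlike_exp_form_bound s (/ (2 * nu)) 3 S3 (u_fun nu)
    (u_fun_exp_form nu s Hnu S1 S3 S4 S5 S6) alpha St).
  replace (INR 4) with 4 in B by (simpl; ring).
  apply Rmult_le_compat_l with (r := 2 * nu / 4) in B; [|lra].
  replace (2 * nu / 4 * (/ (2 * nu) * 4 * Series s)) with (Series s) in B by (field; lra). lra.
Qed.

Theorem theorem19 :
  ((forall alpha : R, 0 <= alpha < 1 ->
      exists nu_star : R,
        is_unique_root (fun nu => 2 * nu * (1 - alpha)) nu_star /\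
        (forall nu : R, -1 < nu -> nu <> 0 -> nu_star <= nu ->
           starlike_of_order alpha (u_fun nu)) /\
        (forall nu : R, 0 < nu ->
           starlike_of_order alpha (u_fun nu) -> nu_star <= nu)) /\
   (exists nu_star : R,
      is_unique_root (fun nu => 2 * nu * (1 - 0)) nu_star /\
      5 / 100 <= nu_star < 6 / 100 /\
      (forall nu : R, -1 < nu -> nu <> 0 -> nu_star <= nu ->
         starlike (u_fun nu)) /\
      (forall nu : R, 0 < nu -> starlike (u_fun nu) -> nu_star <= nu)))
  /\
  ((forall alpha : R, 0 <= alpha < 1 ->
      exists nu_star : R,
        is_unique_root (fun _ => 1 - alpha) nu_star /\
        (forall nu : R, -1 < nu ->
           (starlike_of_order alpha (v_fun nu) <-> nu_star <= nu))) /\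
   (exists nu_star : R,
      is_unique_root (fun _ => 1 - 0) nu_star /\
      - (54 / 100) < nu_star <= - (53 / 100) /\
      (forall nu : R, -1 < nu -> (starlike (v_fun nu) <-> nu_star <= nu))))
  /\
  ((forall alpha : R, 0 <= alpha < 1 ->
      exists nu_star : R,
        is_unique_root (fun _ => 4 * (1 - alpha)) nu_star /\
        (forall nu : R, -1 < nu ->
           (starlike_of_order alpha (w_fun nu) <-> nu_star <= nu))) /\
   (exists nu_star : R,
      is_unique_root (fun _ => 4 * (1 - 0)) nu_star /\
      - (70 / 100) < nu_star <= - (69 / 100) /\
      (forall nu : R, -1 < nu -> (starlike (w_fun nu) <-> nu_star <= nu)))).
Proof.
assert (V : forall alpha, 0 <= alpha < 1 -> _) by
  (intros alpha Hal; refine (product_theorem 3 v_fun (1 - alpha) alpha Hal _ _ _);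
   [simpl; field|lra|intros; now apply v_fun_series]).
assert (W : forall alpha, 0 <= alpha < 1 -> _) by
  (intros alpha Hal; refine (product_theorem 0 w_fun (4 * (1 - alpha)) alpha Hal _ _ _);
   [simpl; field|lra|intros; now apply w_fun_series]).
assert (Below : forall c a b, 0 <= c -> -1 < a -> -1 < b -> char_fun c a < char_fun c b -> a < b).
{ intros c a b Hc Ha Hb L. apply Rnot_le_lt. intros [M|<-]; [|lra].
  generalize (char_fun_increasing c b a). lra. }
assert (H0 : 0 <= 0 < 1) by lra.
split; [|split]; split.
- intros alpha Hal. destruct (u_theorem alpha Hal) as [ns [E1 [_ [_ [E2 E3]]]]].
  exists ns. auto.
- destruct (u_theorem 0 H0) as [ns [E1 [B [N [E2 E3]]]]].
  exists ns. split; [exact E1|split; [|split; [intros nu _ _; apply E2|exact E3]]].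
  split; trivial. apply Rnot_le_lt. intros L.
  assert (C : 0 < char_fun (2 * (6 / 100) * (1 - 0)) (6 / 100)).
  { destruct (char_fun_bounds (2 * (6 / 100) * (1 - 0)) (6 / 100)); try lra.
    assert (Pabs (6 / 100) 1 <= 28 / 1000) by (apply Pabs_1_bound_above; lra). lra. }
  destruct L as [L|L].
  + assert (K := char_fun_u_increasing (1 - 0) (6 / 100) ns ltac:(lra) ltac:(lra) L).
    rewrite N in K. lra.
  + rewrite <- L in N. lra.
- intros alpha Hal. destruct (V alpha Hal) as [ns [E1 [_ [_ E2]]]]. exists ns. auto.
- destruct (V 0 H0) as [ns [E1 [B [N E2]]]].
  exists ns. split; [exact E1|split; [|exact E2]]. split.
  + apply (Below (1 - 0)); try lra. rewrite N.
    destruct (char_fun_bounds (1 - 0) (- (54 / 100))); try lra.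
    assert (202 / 1000 <= Pabs (- (54 / 100)) 1) by (apply Pabs_1_bound_below; lra).
    assert (Pabs (- (54 / 100)) 1 <= 203 / 1000) by (apply Pabs_1_bound_above; lra).
    assert (K := Pabs_ratio (- (54 / 100)) 0 ltac:(lra)). lra.
  + apply Rnot_lt_le. intros L.
    assert (K := char_fun_increasing (1 - 0) (- (53 / 100)) ns ltac:(lra) ltac:(lra) L). rewrite N in K.
    destruct (char_fun_bounds (1 - 0) (- (53 / 100))); try lra.
    assert (Pabs (- (53 / 100)) 1 <= 193 / 1000) by (apply Pabs_1_bound_above; lra). lra.
- intros alpha Hal. destruct (W alpha Hal) as [ns [E1 [_ [_ E2]]]]. exists ns. auto.
- destruct (W 0 H0) as [ns [E1 [B [N E2]]]].
  exists ns. split; [exact E1|split; [|exact E2]]. split.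
  + apply (Below (4 * (1 - 0))); try lra. rewrite N.
    replace (- (70 / 100)) with (- (7 / 10)) by field. apply char_fun_neg_7_10. lra.
  + apply Rnot_lt_le. intros L.
    assert (K := char_fun_increasing (4 * (1 - 0)) (- (69 / 100)) ns ltac:(lra) ltac:(lra) L). rewrite N in K.
    destruct (char_fun_bounds (4 * (1 - 0)) (- (69 / 100))); try lra.
    assert (Pabs (- (69 / 100)) 1 <= 499 / 1000) by (apply Pabs_1_bound_above; lra). lra.
Qed.
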